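(* Let $M$ be a connected locally uniformly pluri-Greenian complex manifold, let $V$ be a norming volume form on $M$, and let $\Phi_V:M\to L^1(M,V)$ be the mapping $\Phi_V(w)=c_V(w)^{-1}g_M(\cdot,w)$, where $c_V(w)=\|g_M(\cdot,w)\|_V$. Then: (1) $\Phi_V$ is a continuous bijection onto $\Phi_V(M)$; (2) for every compact set $N\subset M$ the mapping $\Phi_V$ is a homeomorphism between $N$ and $\Phi_V(N)$.
   Context: ''Negative'' means $\le 0$. Norming volume forms. For a positive continuous volume form $V$ on $M$, $L^1(M,V)$ is the Banach space of measurable functions $u$ (modulo equality a.e.) with $\|u\|_V=\int_M|u|\,dV<\infty$, and $\|u\|_{L^1(E,V)}=\int_E|u|\,dV$. $V$ is norming if for each compact set $F\subset M$ there is a constant $C(F)>0$, and for every increasing sequence of relatively compact open sets $M_j$ in $M$ with $\bigcup_j M_j=M$ there is a sequence of numbers $\varepsilon_j>0$ converging to $0$, such that for every negative plurisubharmonic function $u\not\equiv-\infty$ on $M$: (1) $\|u\|_V<\infty$; (2) $u(z)\le -C(F)\|u\|_V$ for every $z\in F$; (3) $\|u\|_{L^1(M\setminus M_j,V)}\le\varepsilon_j\|u\|_V$ for every $j$. (The constants do not depend on $u$.) Pluricomplex Green function. For $w\in M$, $g_M(z,w)=\sup u(z)$, where the supremum is over all negative plurisubharmonic functions $u$ on $M$ such that $u(z)-\log\|z-w\|$ is bounded above near $w$ (in local coordinates); here $u\equiv-\infty$ is allowed as a plurisubharmonic function. It is known that $g_M(z,w)$ is plurisubharmonic in $z$. A complex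 manifold $M$ is locally uniformly pluri-Greenian if every point $w_0\in M$ has a coordinate neighborhood $U$ for which there are an open set $W\subset U$ containing $w_0$ and a constant $c$ such that $g_M(z,w)>\log\|z-w\|+c$ for $z\in U$ whenever $w\in W$ (norm taken in the coordinates on $U$). The mapping $\Phi_V$ takes values in the set of negative plurisubharmonic functions $u$ with $\|u\|_V\le 1$, with the topology of $L^1(M,V)$. *)

(* Defs.v *)
From HB Require Import structures.
From mathcomp Require Import all_boot all_order all_algebra.
From mathcomp Require Import all_classical all_reals all_analysis measurable_realfun.
From mathcomp.real_closed Require Export complex.

Set Implicit Arguments.
Unset Strict Implicit.
Unset Printing Implicit Defensive.

Import Order.TTheory GRing.Theory Num.Theory.
Import numFieldNormedType.Exports.

Local Open Scope classical_set_scope.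
Local Open Scope ring_scope.

(* With R[i] normed by its modulus, 'rV[R[i]]_n is C^n as a normed space over
   R[i], so that [differentiable] on it means C-differentiable. *)
#[non_forgetful_inheritance]
HB.instance Definition _ (R : realType) := NormedModule.copy R[i] R[i]^o.

Section LebesgueTuple.
Context {R : realType}.
Local Notation mR := (measurableTypeR R).
Local Notation leb1 := (@lebesgue_measure R).

Section cons.
Variables (n : nat) (m : {sigma_finite_measure set (n.-tuple mR) -> \bar R}).

Let tcons (p : mR * n.-tuple mR) : n.+1.-tuple mR :=
  [the n.+1.-tuple mR of p.1 :: p.2].

Let measurable_tcons : measurable_fun [set: mR * n.-tuple mR] tcons.
Proof. exact: measurable_cons. Qed.

Definition leb_cons : set (n.+1.-tuple mR) -> \bar R :=
  pushforward (leb1 \x m)%E tcons.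

Let leb_cons0 : leb_cons set0 = 0%E.
Proof. exact: measure0. Qed.

Let leb_cons_ge0 A : (0 <= leb_cons A)%E.
Proof. exact: measure_ge0. Qed.

Let leb_cons_additive : semi_sigma_additive leb_cons.
Proof. exact: measure_semi_sigma_additive. Qed.

HB.instance Definition _ :=
  isMeasure.Build _ _ _ leb_cons leb_cons0 leb_cons_ge0 leb_cons_additive.

Lemma leb_cons_sigma_finite : sigma_finite [set: n.+1.-tuple mR] leb_cons.
Proof.
pose uncons (t : n.+1.-tuple mR) : mR * n.-tuple mR :=
  (thead t, [tuple of behead t]).
have muncons : measurable_fun setT uncons.
  apply/measurable_fun_pair; [exact: measurable_tnth|exact: measurable_behead].
have tconsK p : uncons (tcons p) = p.
  by case: p => x t; congr pair => //=; apply: val_inj.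
have /sigma_finiteP[F [TF ndF Foo]] := sigma_finiteT leb1.
have /sigma_finiteP[G [TG ndG Goo]] := sigma_finiteT m.
exists (fun k => uncons @^-1` (F k `*` G k)) => [|k].
  rewrite -preimage_bigcup -[LHS](preimage_setT uncons); congr (_ @^-1` _).
  rewrite -setXTT TF TG predeqE => -[x y]; split.
    move=> [/= [i _ Fnx] [k _ Gky]]; exists (maxn i k) => //; split.
    - by move: x Fnx; exact/subsetPset/ndF/leq_maxl.
    - by move: y Gky; exact/subsetPset/ndG/leq_maxr.
  by move=> [i _ []/= ? ?]; split; exists i.
have [mF Fk] := Foo k; have [mG Gk] := Goo k.
split.
  by rewrite -[_ @^-1` _]setTI; apply: muncons => //; exact: measurableX.
rewrite /leb_cons /pushforward.
suff -> : tcons @^-1` (uncons @^-1` (F k `*` G k)) = F k `*` G k.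
  by rewrite product_measure1E// lte_mul_pinfty// ge0_fin_numE.
by rewrite -comp_preimage (_ : uncons \o tcons = id)//; exact/funext.
Qed.

HB.instance Definition _ :=
  Measure_isSigmaFinite.Build _ _ _ leb_cons leb_cons_sigma_finite.

End cons.

(* Lebesgue measure on R^n. *)
Fixpoint leb_tuple (n : nat) :
    {sigma_finite_measure set (n.-tuple mR) -> \bar R} :=
  match n with
  | 0 => \d_ ([tuple] : 0.-tuple mR)
  | n'.+1 => leb_cons (leb_tuple n')
  end.

End LebesgueTuple.
Arguments leb_tuple R n : clear implicits.

Section ComplexSpace.
Context {R : realType} {n : nat}.

Definition enorm (z : 'rV[R[i]]_n) : R :=
  Num.sqrt (\sum_(i < n)
    (complex.Re (z ord0 i) ^+ 2 + complex.Im (z ord0 i) ^+ 2)).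

(* (x, y) in R^(2n) is identified with x + i y in C^n. *)
Definition of_reals (t : (n + n).-tuple (measurableTypeR R)) : 'rV[R[i]]_n :=
  \row_(i < n) (tnth t (lshift n i) +i* tnth t (rshift n i))%C.

End ComplexSpace.

Section L1.
Context d (T : measurableType d) (R : realType).
Variable mu : {measure set T -> \bar R}.

(* The library gives its space L^1 (modulo equality a.e.) no topology; [L1] is
   that space with the distance of the L^1 norm. *)
Definition L1 : Type := LspaceType1 mu.

HB.instance Definition _ := gen_eqMixin L1.
HB.instance Definition _ := gen_choiceMixin L1.

Definition L1_fun (f : L1) : T -> R := f : LspaceType1 mu.
Coercion L1_fun : L1 >-> Funclass.

Lemma measurable_aeEqMfun (g : {mfun_ mu, T >-> measurableTypeR R}) :
  measurable_fun setT (g : T -> R).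
Proof. exact: (@measurable_funPT _ _ _ _ (repr g)). Qed.

Lemma measurable_L1_fun (f : L1) : measurable_fun setT (L1_fun f).
Proof. exact: measurable_aeEqMfun. Qed.

Definition L1_ball (f : L1) (e : R) : set L1 :=
  [set g | ('N[mu]_1[EFin \o (f \- g)%R] < e%:E)%E].

Let L1_ent : set_system (L1 * L1) := entourage_ L1_ball.

Let L1_nbhs (f : L1) : set_system L1 := nbhs_ L1_ent f.

HB.instance Definition _ := hasNbhs.Build L1 L1_nbhs.

Let L1_ball_center (f : L1) (e : R) : 0 < e -> L1_ball f e f.
Proof.
move=> e0; rewrite /L1_ball/= (_ : _ \o _ = cst 0%E) ?Lnorm0//.
by apply/funext => x /=; rewrite subrr.
Qed.

Let L1_ball_sym (f g : L1) (e : R) : L1_ball f e g -> L1_ball g e f.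
Proof.
rewrite /L1_ball/= -oppe_Lnorm (_ : (\- _)%E = EFin \o (g \- f))//.
by apply/funext => x /=; congr EFin; rewrite opprB.
Qed.

Let L1_ball_triangle (f g h : L1) (e1 e2 : R) :
  L1_ball f e1 g -> L1_ball g e2 h -> L1_ball f (e1 + e2) h.
Proof.
rewrite /L1_ball/= => fg gh.
have -> : f \- h = (f \- g) \+ (g \- h).
  by apply/funext => x /=; rewrite addrA subrK.
have mB (u v : L1) : measurable_fun setT (u \- v).
  by apply: measurable_funB; exact: measurable_L1_fun.
by rewrite (le_lt_trans (eminkowski _ (mB f g) (mB g h) _))// EFinD lteD.
Qed.

HB.instance Definition _ := @Nbhs_isPseudoMetric.Build R L1 L1_ent erefl
  L1_ball L1_ball_center L1_ball_sym L1_ball_triangle erefl.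

End L1.

Definition is_homeomorphism (S T : topologicalType) (A : set S) (B : set T)
    (f : S -> T) :=
  [/\ set_bij A B f, {within A, continuous f} &
      exists g : T -> S, {in A, cancel f g} /\ {within B, continuous g}].

Definition borel (M : ptopologicalType) : Type := g_sigma_algebraType (@open M).
HB.instance Definition _ (M : ptopologicalType) := Measurable.on (borel M).

Section ComplexManifold.
Variables (R : realType) (n : nat) (M : ptopologicalType).
Local Notation Cn := 'rV[R[i]]_n.

(* Total functions; [cmap] matters on [cdom] only, [cinv] on [crange] only. *)
Record chart := Chart {
  cdom : set M;
  cmap : M -> Cn;
  cinv : Cn -> M
}.

Definition crange (c : chart) : set Cn := cmap c @` cdom c.

Definition is_chart (c : chart) :=
  [/\ open (cdom c),
      open (crange c),
      {in cdom c, cancel (cmap c) (cinv c)},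
      {within cdom c, continuous (cmap c)} &
      {within crange c, continuous (cinv c)}].

Definition holo_compatible (c c' : chart) :=
  forall z, (cmap c @` (cdom c `&` cdom c')) z ->
    differentiable (cmap c' \o cinv c) z.

Definition maximal_atlas (A : set chart) :=
  [/\ A `<=` is_chart,
      \bigcup_(c in A) cdom c = [set: M],
      (forall c c', A c -> A c' -> holo_compatible c c') &
      forall c, is_chart c ->
        (forall c', A c' -> holo_compatible c c' /\ holo_compatible c' c) ->
        A c].

Definition complex_manifold (A : set chart) :=
  [/\ hausdorff_space M, @second_countable M & maximal_atlas A].

Variable A : set chart.
Local Open Scope ereal_scope.

(* The circle means are integrals of functions that are bounded above but may
   take the value -oo. The function constantly -oo is plurisubharmonic. *)
Definition psh (u : M -> \bar R) :=
  [/\ (forall z, u z < +oo),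
      lower_semicontinuous (fun z => - u z) &
      forall c, A c -> forall a b : Cn,
        (forall x : R[i], (`|x| <= 1)%R -> crange c (a + x *: b)%R) ->
        u (cinv c a) <= ((2 * pi)^-1)%:E *
          \int[lebesgue_measure]_(t in `[0%R, (2 * pi)%R])
            u (cinv c (a + (cos t +i* sin t)%C *: b)%R)].

Definition neg_psh (u : M -> \bar R) := psh u /\ forall z, u z <= 0.

(* The chart does not matter, as coordinate changes are locally bi-Lipschitz;
   w itself is left out, u - log being undefined there. *)
Definition log_pole (u : M -> \bar R) (w : M) :=
  exists2 c, A c /\ cdom c w &
    exists K : R, \forall z \near w^',
      u z <= (ln (enorm (cmap c z - cmap c w)) + K)%:E.

Definition green (z w : M) : \bar R :=
  ereal_sup [set u z | u in [set u | neg_psh u /\ log_pole u w]].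

(* [z != w]: both sides are -oo at z = w, while [ln 0] is 0 here. *)
Definition loc_unif_pluriGreenian :=
  forall w0, exists2 c, A c /\ cdom c w0 &
    exists (W : set M) (K : R),
      [/\ open W, W `<=` cdom c, W w0 &
        forall w z, W w -> cdom c z -> z != w ->
          (ln (enorm (cmap c z - cmap c w)) + K)%:E < green z w].

Variable V : {measure set (borel M) -> \bar R}.

(* A positive continuous volume form is given by its measure: in every chart
   it has a positive continuous density with respect to Lebesgue measure. *)
Definition volume_form :=
  forall c, A c -> exists f : Cn -> R,
    [/\ {within crange c, continuous f},
        (forall z, crange c z -> (0 < f z)%R) &
        forall E : set (borel M), measurable E -> E `<=` cdom c ->
          V E = \int[leb_tuple R (n + n)]_(t in of_reals @^-1` (cmap c @` E))
                  (f (of_reals t))%:E].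

Definition L1norm (E : set M) (u : M -> \bar R) : \bar R :=
  \int[V]_(z in (E : set (borel M))) `|u z|.

Definition norming :=
  let P u := neg_psh u /\ exists z, u z != -oo in
  [/\ forall u, P u -> L1norm setT u < +oo,
      forall F : set M, compact F ->
        exists2 C : R, (0 < C)%R & forall u, P u ->
          forall z, F z -> u z <= - (C%:E * L1norm setT u) &
      forall Mj : (set M)^nat,
        (forall j, open (Mj j) /\ precompact (Mj j)) ->
        nondecreasing_seq Mj -> \bigcup_j Mj j = [set: M] ->
        exists eps : R^nat, [/\ forall j, (0 < eps j)%R,
          eps @ \oo --> (0%R : R) &
          forall u, P u -> forall j,
            L1norm (~` Mj j) u <= (eps j)%:E * L1norm setT u]].

Definition green_norm (w : M) : \bar R := L1norm setT (green ^~ w).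

(* Phi w is the class of the function c_V(w)^-1 g_M(., w), which is real-valued
   off a null set; this determines Phi. *)
Definition is_normalized_green (Phi : M -> L1 V) :=
  forall w, EFin \o Phi w = (fun z => (green_norm w)^-1 * green z w) %[ae V].

End ComplexManifold.

(* Main.v *)
From HB Require Import structures.
Require Import Defs.
From mathcomp Require Import all_boot all_order all_algebra.
From mathcomp Require Import all_classical all_reals all_analysis.
From mathcomp Require Import measurable_realfun ring lra.
Import Order.TTheory GRing.Theory Num.Theory.
Import numFieldNormedType.Exports.
Local Open Scope classical_set_scope.
Local Open Scope ring_scope.

Set Implicit Arguments.
Unset Strict Implicit.

(* Put [h z = - g_M(z, w)], a nonnegative superharmonic function with a pole at [w].
   If [w] and [w'] are both very near [w0], then [(1 + d) h] exceeds [h' + C] near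
   [w], [w'] and is smaller than [h' + C] a fixed distance away, for a constant [C];
   gluing the two gives a competitor for [g_M(., w')] which shows [h' <= (1 + d) h] off
   a small ball, and symmetrically. On the ball the lower bound
   [log |z - w| + K <= g_M(z, w)] makes the integrals of [h] and [h'] small, so
   [w |-> g_M(., w)] is continuous into L^1. That a glued function is plurisubharmonic
   requires the passage from local to global submean inequalities.
   Injectivity: if [h' = t h] almost everywhere with [w <> w'], then [h'] has a
   logarithmic pole at [w] too; truncating it there gives a larger competitor for
   [g_M(., w')] that is bounded below near [w], a contradiction. *)

(** * Norms on C and C^n *)

(** [psh] demands the submean inequality on every affine disc of every chart, whereas a glued
    function is known to satisfy it only on small discs; and [log_pole] lets the constant depend on
    the competitor, so that a supremum of competitors has no pole for free. Both obstacles are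
    reduced to one complex variable, on a line in a chart, where a minimum argument settles them: a
    local supermean function, corrected by a logarithm in the second case, minus a small multiple of
    [|z|^2] has no interior minimum. The outcome is a two-sided bound [ln |z - w| + K <= g_M(z, w)
    <= ln (|z - w| / r)] near the pole, with [K] and [r] uniform for [w] near [w0]. The factor
    [1 + d] in the comparison absorbs the gap between the two constants: on a sphere of radius [s]
    the surplus [d * ln (1 / s)] exceeds any constant once [s] is small, and this fixes how close
    [w] and [w'] have to be. Statement (2) then follows from the general fact about continuous
    injections of compact sets into Hausdorff spaces. *)

Section ComplexNorm.
Context {R : realType}.
Implicit Types z : R[i].

(** The norm of [R[i]] takes its values in [R[i]]; this is the same modulus as an element of [R],
    where the order is total. *)
Definition cabs z : R := complex.Re `|z|.

Lemma cabsE z : `|z| = (cabs z)%:C%C.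
Proof. by rewrite /cabs normc_def. Qed.

Lemma cabs_sqrt z : cabs z = Num.sqrt (complex.Re z ^+ 2 + complex.Im z ^+ 2).
Proof. by rewrite /cabs normc_def. Qed.

Lemma sqr_cabs z : cabs z ^+ 2 = complex.Re z ^+ 2 + complex.Im z ^+ 2.
Proof. by rewrite cabs_sqrt sqr_sqrtr// addr_ge0// sqr_ge0. Qed.

Lemma cabs_ge0 z : 0 <= cabs z.
Proof. by rewrite cabs_sqrt sqrtr_ge0. Qed.

Lemma cabsM z z' : cabs (z * z') = cabs z * cabs z'.
Proof.
by apply: (@complexI R); rewrite -cabsE normrM !cabsE -rmorphM.
Qed.

Lemma cabs0 : cabs 0 = 0 :> R.
Proof. by rewrite /cabs normr0. Qed.

Lemma cabs1 : cabs 1 = 1 :> R.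
Proof. by rewrite /cabs normr1. Qed.

Lemma cabs_eq0 z : (cabs z == 0) = (z == 0).
Proof. by rewrite -(inj_eq (@complexI R)) -cabsE normr_eq0. Qed.

Lemma cabs_real (x : R) : cabs x%:C%C = `|x|.
Proof. by rewrite cabs_sqrt /= expr0n/= addr0 sqrtr_sqr. Qed.

Lemma ler_cabsD z z' : cabs (z + z') <= cabs z + cabs z'.
Proof. by rewrite -lecR rmorphD/= -!cabsE ler_normD. Qed.

Lemma cabsN z : cabs (- z) = cabs z.
Proof. by rewrite /cabs normrN. Qed.

Lemma cabsB z z' : cabs (z - z') = cabs (z' - z).
Proof. by rewrite -opprB cabsN. Qed.

Lemma normr_Re_le z : `|complex.Re z| <= cabs z.
Proof. by rewrite cabs_sqrt -sqrtr_sqr ler_wsqrtr// lerDl sqr_ge0. Qed.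

Lemma normr_Im_le z : `|complex.Im z| <= cabs z.
Proof. by rewrite cabs_sqrt -sqrtr_sqr ler_wsqrtr// lerDr sqr_ge0. Qed.

Lemma ltc_cabs z (e : R) : (`|z| < e%:C%C) = (cabs z < e).
Proof. by rewrite cabsE ltcR. Qed.

Lemma lec_cabs z (e : R) : (`|z| <= e%:C%C) = (cabs z <= e).
Proof. by rewrite cabsE lecR. Qed.

Lemma posc_real (e : R[i]) : 0 < e -> e = (complex.Re e)%:C%C /\ 0 < complex.Re e.
Proof. by case: e => a b; rewrite ltcE/= => /andP[/eqP-> ?]. Qed.

Lemma nbhs_cabsP z (P : set R[i]) :
  nbhs z P <-> exists2 e : R, 0 < e & forall y, cabs (y - z) < e -> P y.
Proof.
split=> [/nbhs_ballP[e /= /posc_real[-> e0] zP]|[e e0 zP]].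
  by exists (complex.Re e) => // y ye; apply: zP; rewrite /ball/= ltc_cabs cabsB.
apply/nbhs_ballP; exists e%:C%C; first by rewrite /= ltcR.
by move=> y; rewrite /ball/= ltc_cabs cabsB; exact: zP.
Qed.

Lemma continuous_cplx (T : topologicalType) (f g : T -> R) (x : T) :
  {for x, continuous f} -> {for x, continuous g} ->
  {for x, continuous (fun t => (f t +i* g t)%C)}.
Proof.
move=> fx gx U; rewrite /= nbhs_simpl /= => /nbhs_cabsP[e e0 eU].
have e20 : 0 < e / 2 by rewrite divr_gt0.
have Hf := fx _ (nbhsx_ballx (f x) _ e20).
have Hg := gx _ (nbhsx_ballx (g x) _ e20).
near=> t; apply: eU.
have -> : ((f t +i* g t) - (f x +i* g x))%C =
  ((f t - f x)%:C + 'i * (g t - g x)%:C)%C :> R[i].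
  by apply/eqP; rewrite eq_complex/=; apply/andP; split; apply/eqP; ring.
apply: le_lt_trans (ler_cabsD _ _) _.
have -> : cabs ('i * (g t - g x)%:C)%C = `|g t - g x|.
  rewrite cabsM cabs_real -[RHS]mul1r; congr (_ * _).
  by rewrite cabs_sqrt/= expr0n/= add0r expr1n sqrtr1.
rewrite cabs_real [e]splitr ltrD// distrC.
  by near: t; exact: Hf.
by near: t; exact: Hg.
Unshelve. all: by end_near. Qed.

Lemma continuous_cabs : continuous cabs.
Proof.
move=> z U /nbhs_ballP[e /= e0 eU]; apply/nbhs_cabsP; exists e => // y /= H.
apply: eU; rewrite /ball/=.
have h1 := ler_cabsD (z - y) y; have h2 := ler_cabsD (y - z) z.
rewrite !subrK in h1 h2; rewrite cabsB in h1.
rewrite ltr_norml; lra.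
Qed.

Lemma compact_cdisc (e : R) : compact [set z : R[i] | cabs z <= e].
Proof.
pose f (p : R * R) : R[i] := (p.1 +i* p.2)%C.
have cf : continuous f.
  move=> p; apply: continuous_cplx; [exact: cvg_fst|exact: cvg_snd].
have cK : compact (f @` (`[-e, e] `*` `[-e, e])).
  apply: continuous_compact; first exact: continuous_subspaceT.
  by apply: compact_setX; exact: segment_compact.
apply: subclosed_compact cK _.
  apply: (@closed_comp _ _ cabs [set x | x <= e]); [by move=> + _; exact: continuous_cabs|exact: closed_le].
move=> z /= ze; exists (complex.Re z, complex.Im z) => /=; last by rewrite /f/=; case: z {ze}.
by split; rewrite in_itv/= -ler_norml (le_trans _ ze)// ?normr_Re_le ?normr_Im_le.
Qed.

End ComplexNorm.

Section EuclideanNorm.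
Context {R : realType} {n : nat}.
Implicit Types z : 'rV[R[i]]_n.

Lemma enormE z : enorm z = Num.sqrt (\sum_(i < n) cabs (z ord0 i) ^+ 2).
Proof. by rewrite /enorm; congr Num.sqrt; apply: eq_bigr => i _; rewrite sqr_cabs. Qed.

Lemma sqr_enorm z : enorm z ^+ 2 = \sum_(i < n) cabs (z ord0 i) ^+ 2.
Proof. by rewrite enormE sqr_sqrtr// sumr_ge0// => i _; rewrite sqr_ge0. Qed.

Lemma enorm_ge0 z : 0 <= enorm z.
Proof. exact: sqrtr_ge0. Qed.

Lemma cabs_le_enorm z i : cabs (z ord0 i) <= enorm z.
Proof.
rewrite -(@ler_pXn2r _ 2)// ?nnegrE ?cabs_ge0 ?enorm_ge0// sqr_enorm.
by rewrite (bigD1 i)//= lerDl sumr_ge0// => j _; rewrite sqr_ge0.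
Qed.

Lemma enormZ (x : R[i]) z : enorm (x *: z) = cabs x * enorm z.
Proof.
apply/eqP; rewrite -(@eqrXn2 _ 2)// ?mulr_ge0 ?cabs_ge0 ?enorm_ge0//.
rewrite exprMn !sqr_enorm mulr_sumr; apply/eqP/eq_bigr => i _.
by rewrite !mxE cabsM exprMn.
Qed.

Lemma enorm0 : enorm (0 : 'rV[R[i]]_n) = 0.
Proof. by rewrite -(scale0r 0) enormZ cabs0 mul0r. Qed.

Lemma enormN z : enorm (- z) = enorm z.
Proof. by rewrite -scaleN1r enormZ cabsN cabs1 mul1r. Qed.

Lemma enormB z z' : enorm (z - z') = enorm (z' - z).
Proof. by rewrite -opprB enormN. Qed.

Lemma enorm_eq0 z : (enorm z == 0) = (z == 0).
Proof.
apply/eqP/eqP => [z0|->]; last exact: enorm0.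
apply/rowP => i; rewrite mxE; apply/eqP; rewrite -cabs_eq0 eq_le cabs_ge0 andbT.
by rewrite -z0 cabs_le_enorm.
Qed.

Lemma enorm_gt0 z : (0 < enorm z) = (z != 0).
Proof. by rewrite lt_def enorm_eq0 enorm_ge0 andbT. Qed.

Lemma ler_enormD z z' : enorm (z + z') <= enorm z + enorm z'.
Proof.
have [->|z0] := eqVneq z 0; first by rewrite add0r enorm0 add0r.
have [->|z'0] := eqVneq z' 0; first by rewrite addr0 enorm0 addr0.
have a0 : 0 < enorm z by rewrite enorm_gt0.
have b0 : 0 < enorm z' by rewrite enorm_gt0.
rewrite -(@ler_pXn2r _ 2)// ?nnegrE ?addr_ge0 ?enorm_ge0//.
pose s := \sum_(i < n) cabs (z ord0 i) * cabs (z' ord0 i).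
(* Cauchy-Schwarz: expand the sum of the squares of [enorm z' * |z_i| - enorm z * |z'_i|] and divide
   by the product of the norms, which is why zero vectors are set apart. *)
have sab : s <= enorm z * enorm z'.
  have : 0 <= \sum_(i < n) (enorm z' * cabs (z ord0 i) - enorm z * cabs (z' ord0 i)) ^+ 2.
    by rewrite sumr_ge0// => i _; rewrite sqr_ge0.
  under eq_bigr do rewrite sqrrB !exprMn.
  rewrite !big_split/= -!mulr_sumr -!sqr_enorm sumrN.
  have -> : \sum_(i < n) enorm z' * cabs (z ord0 i) * (enorm z * cabs (z' ord0 i)) *+ 2 =
     (enorm z * enorm z') * (s *+ 2).
    by rewrite -sumrMnl mulr_sumr; apply: eq_bigr => i _; rewrite -mulrnAr; ring.
  have := mulr_gt0 a0 b0; set p := enorm z * enorm z' => p0 h.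
  rewrite -(ler_pM2l p0); move: h; rewrite /p; lra.
apply: (@le_trans _ _ (enorm z ^+ 2 + enorm z' ^+ 2 + s *+ 2)); last first.
  by move: sab; lra.
rewrite !sqr_enorm /s -sumrMnl -!big_split/=; apply: ler_sum => i _.
rewrite mxE; apply: (@le_trans _ _ ((cabs (z ord0 i) + cabs (z' ord0 i)) ^+ 2)).
  by rewrite lerXn2r ?nnegrE ?addr_ge0 ?cabs_ge0// ler_cabsD.
by rewrite le_eqVlt; apply/orP; left; apply/eqP; rewrite -mulr_natr; ring.
Qed.

Lemma enorm_triangle z z' z'' : enorm (z - z'') <= enorm (z - z') + enorm (z' - z'').
Proof. by rewrite (le_trans _ (ler_enormD _ _))// addrA subrK. Qed.

Lemma nbhs_enormP z (P : set 'rV[R[i]]_n) :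
  nbhs z P <-> exists2 e : R, 0 < e & forall y, enorm (y - z) < e -> P y.
Proof.
split=> [/nbhs_ballP[e /= /posc_real[-> e0] zP]|[e e0 zP]].
  exists (complex.Re e) => // y ye; apply: zP; split; first by rewrite ltcR.
  move=> i j.
  rewrite /ball/= ltc_cabs cabsB; apply: le_lt_trans ye.
  by rewrite (le_trans _ (cabs_le_enorm _ j))// !mxE !ord1.
(* A sup-norm ball of this radius suffices because [n * (e / (n + 1))^2 < e^2]; [n.+1] also covers
   [n = 0]. *)
have e1 : 0 < e / n.+1%:R by rewrite divr_gt0.
apply/nbhs_ballP; exists (e / n.+1%:R)%:C%C; first by rewrite /= ltcR.
move=> y zy; apply: zP; rewrite -(@ltr_pXn2r _ 2)// ?nnegrE ?enorm_ge0 ?ltW//.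
rewrite sqr_enorm; apply: (@le_lt_trans _ _ (\sum_(i < n) (e / n.+1%:R) ^+ 2)).
  apply: ler_sum => i _; rewrite ler_pXn2r ?nnegrE ?cabs_ge0 ?(ltW e1)//.
  have := zy.2 ord0 i; rewrite /ball/= ltc_cabs cabsB !mxE; exact: ltW.
rewrite sumr_const card_ord exprMn -mulrnAr gtr_pMr ?exprn_gt0//.
rewrite exprVn -mulr_natr mulrC ltr_pdivrMr ?exprn_gt0// mul1r -natrX ltr_nat.
by rewrite (@leq_trans (n.+1 ^ 1))// leq_pexp2l.
Qed.

Lemma continuous_enorm : continuous (@enorm R n).
Proof.
move=> z U /nbhs_ballP[e /= e0 eU]; apply/nbhs_enormP; exists e => // y /= H.
apply: eU; rewrite /ball/=.
have h1 := enorm_triangle z y 0; have h2 := enorm_triangle y z 0.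
rewrite !subr0 in h1 h2; rewrite (enormB z) in h1.
rewrite ltr_norml; lra.
Qed.

Lemma compact_enorm_ball z (e : R) : compact [set y | enorm (y - z) <= e].
Proof.
have cB : compact [set v : 'rV[R[i]]_n | forall i, cabs (v ord0 i) <= e].
  by apply: (@rV_compact R[i] n (fun=> [set z | cabs z <= e])) => i; exact: compact_cdisc.
have cB0 : compact [set y : 'rV[R[i]]_n | enorm y <= e].
  apply: subclosed_compact cB _.
    apply: (@closed_comp _ _ (@enorm R n) [set x | x <= e]); [by move=> + _; exact: continuous_enorm|exact: closed_le].
  by move=> y /= ye i; rewrite (le_trans _ ye)// cabs_le_enorm.
have -> : [set y | enorm (y - z) <= e] = (fun y => y + z) @` [set y : 'rV[R[i]]_n | enorm y <= e].
  apply/seteqP; split => [y/= ye|_ [y /= ye <-]]; last by rewrite addrK.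
  by exists (y - z) => //; rewrite subrK.
apply: continuous_compact => //; apply: continuous_subspaceT => y.
by apply: continuousD; [exact: cvg_id|exact: cst_continuous].
Qed.

End EuclideanNorm.

Section LimInf.
Context {R : realType}.
Local Open Scope ereal_scope.
Implicit Types u : (\bar R)^nat.

Lemma limn_einf_ge u (q : \bar R) N : (forall n, (N <= n)%N -> q <= u n) -> q <= limn_einf u.
Proof.
move=> qu; rewrite limn_einf_lim (cvg_lim _ (@cvg_einfs_sup _ u))//.
apply: (@le_trans _ _ (einfs u N)); last by apply: ereal_sup_ubound; exists N.
by apply: le_ereal_inf_tmp => _ [m /= Nm <-]; exact: qu.
Qed.

Lemma limn_einf_le u (q : \bar R) : (forall n, u n <= q) -> limn_einf u <= q.
Proof.
move=> uq; rewrite limn_einf_lim (cvg_lim _ (@cvg_einfs_sup _ u))//.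
apply: ge_ereal_sup => _ [n _ <-]; apply: le_trans (uq n).
by apply: ereal_inf_lbound; exists n => /=.
Qed.

End LimInf.

Lemma ereal_between (R : realType) (x y : \bar R) : (x < y)%E ->
  exists r : R, (x < r%:E < y)%E.
Proof.
move: x y => [x| |] [y| |] //=; rewrite ?lte_fin.
- by move=> xy; exists ((x + y) / 2); rewrite !lte_fin; apply/andP; split; lra.
- by move=> _; exists (x + 1); rewrite lte_fin ltry andbT ltrDl.
- by move=> _; exists (y - 1); rewrite lte_fin ltNyr/= ltrBlDr ltrDl.
- by move=> _; exists 0; rewrite ltNyr ltry.
Qed.

(** * Lower semicontinuity and circle means *)

Section LscAt.
Context {R : realType}.
Local Open Scope ereal_scope.

(** The pointwise notion depends only on the values near [x], so it passes through charts and
    through gluing. *)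
Definition lsc_at (T : topologicalType) (f : T -> \bar R) (x : T) :=
  forall q : R, q%:E < f x -> \forall y \near x, q%:E < f y.

Lemma lower_semicontinuous_at (T : topologicalType) (f : T -> \bar R) :
  lower_semicontinuous f <-> forall x, lsc_at f x.
Proof.
split=> [h x q qf|h x q /h H].
  by have [V xV Vq] := h x q qf; apply: filterS xV.
by exists [set y | q%:E < f y].
Qed.

Lemma lsc_at_comp (S T : topologicalType) (g : S -> T) (f : T -> \bar R) (x : S) :
  {for x, continuous g} -> lsc_at f (g x) -> lsc_at (f \o g) x.
Proof. by move=> gx fgx q /fgx; exact: gx. Qed.

Lemma near_lsc_at (T : topologicalType) (f g : T -> \bar R) (x : T) :
  (\forall y \near x, f y = g y) -> lsc_at f x -> lsc_at g x.
Proof.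
move=> fg fx q; rewrite -(nbhs_singleton fg) => /fx qf.
by apply: filterS2 fg qf => y /= ->.
Qed.

(** Superlevel sets are open, hence countable unions of the rational boxes that they contain, and
    boxes lie in the product sigma-algebra. *)
Lemma lsc_measurable_RR (f : R * R -> \bar R) :
  (forall p, lsc_at f p) ->
  measurable_fun [set: measurableTypeR R * measurableTypeR R] f.
Proof.
move=> lf; apply: (measurability _ (ErealGenOInfty.measurableE R)).
move=> /= _ [_ [a ->]] <-; apply: measurableI => //.
rewrite preimage_itvoy.
pose box (r : (rat * rat) * (rat * rat)) : set (measurableTypeR R * measurableTypeR R) :=
  (`](ratr r.1.1 : R), ratr r.1.2[ `*` `](ratr r.2.1 : R), ratr r.2.2[)%classic.
pose F r := if `[< box r `<=` [set p | a%:E < f p] >] then box r else set0.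
have -> : [set p | a%:E < f p] = \bigcup_r F r.
  apply/seteqP; split=> [p /= afp|p [r _]]; last first.
    by rewrite /F; case: ifPn => // /asboolP; apply.
  have [[U V] [/= p1U p2V] UV] := lf p a afp.
  have [e /= e0 eU] := (nbhs_ballP _ _).1 p1U.
  have [e' /= e'0 eV] := (nbhs_ballP _ _).1 p2V.
  have /rat_in_itvoo[r1] : (p.1 - e < p.1)%R by rewrite ltrBlDr ltrDl.
  rewrite in_itv/= => /andP[r1p r1p'].
  have /rat_in_itvoo[r2] : (p.1 < p.1 + e)%R by rewrite ltrDl.
  rewrite in_itv/= => /andP[r2p r2p'].
  have /rat_in_itvoo[r3] : (p.2 - e' < p.2)%R by rewrite ltrBlDr ltrDl.
  rewrite in_itv/= => /andP[r3p r3p'].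
  have /rat_in_itvoo[r4] : (p.2 < p.2 + e')%R by rewrite ltrDl.
  rewrite in_itv/= => /andP[r4p r4p'].
  have sub : box ((r1, r2), (r3, r4)) `<=` [set p | a%:E < f p].
    move=> [x y] [/=]; rewrite !in_itv/= => /andP[x1 x2] /andP[y1 y2].
    by apply: UV; split => /=; [apply: eU|apply: eV];
      rewrite /ball/= ltr_norml; apply/andP; split; lra.
  exists ((r1, r2), (r3, r4)) => //.
  rewrite /F; case: ifPn => [_|/asboolPn//].
  by split; rewrite /= in_itv/=; apply/andP.
apply: countable_bigcupT_measurable => [|r]; first exact: countableP.
rewrite /F; case: ifPn => // _; apply: measurableX; exact: measurable_itv.
Qed.

Lemma lsc_measurable (f : R -> \bar R) :
  (forall x, lsc_at f x) -> measurable_fun [set: measurableTypeR R] f.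
Proof. by move=> lf; apply: lower_semicontinuous_measurable; apply/lower_semicontinuous_at. Qed.

End LscAt.

(** * Circle means: semicontinuity, rotation invariance, Tonelli *)

Section Avg.
Context {R : realType}.
Local Notation mu := (@lebesgue_measure R).

Definition cis (t : R) : R[i] := (cos t +i* sin t)%C.

Lemma continuous_cis : continuous cis.
Proof. by move=> t; apply: continuous_cplx; [exact: continuous_cos|exact: continuous_sin]. Qed.

Lemma cabs_cis t : cabs (cis t) = 1.
Proof. by rewrite cabs_sqrt /= cos2Dsin2 sqrtr1. Qed.

Lemma cisD s t : cis (s + t) = cis s * cis t.
Proof.
by apply/eqP; rewrite eq_complex/= cosD sinD; apply/andP; split; apply/eqP; ring.
Qed.

Lemma cisD2pi t : cis (t + pi *+ 2) = cis t.
Proof.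
rewrite cisD [X in _ * X](_ : _ = 1) ?mulr1//.
by apply/eqP; rewrite eq_complex/= cos2pi sin2pi !eqxx.
Qed.

Lemma cis_exists (z : R[i]) : cabs z = 1 -> exists2 t, 0 <= t <= 2 * pi & z = cis t.
Proof.
case: z => x y z1; have := sqr_cabs (x +i* y)%C; rewrite z1 expr1n/= => xy.
have x1 : -1 <= x <= 1.
  by rewrite -ler_norml -(@ler_pXn2r _ 2)// ?nnegrE// expr1n real_normK ?num_real// xy lerDl sqr_ge0.
have sx : Num.sqrt (1 - x ^+ 2) = `|y| by rewrite xy addrAC subrr add0r sqrtr_sqr.
have xI : x \in `[-1, 1] by rewrite in_itv.
have h0 := acos_ge0 x1; have h1 := acos_lepi x1.
have [y0|y0] := leP 0 y.
  exists (acos x); first by apply/andP; split => //; have := pi_ge0 R; lra.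
  by rewrite /cis acosK// sin_acos// sx ger0_norm.
exists (- acos x + pi *+ 2); first by apply/andP; split; lra.
by rewrite cisD2pi /cis cosN sinN acosK// sin_acos// sx ltr0_norm// opprK.
Qed.

Local Open Scope ereal_scope.

Definition avg (h : R -> \bar R) : \bar R :=
  ((2 * pi)^-1)%:E * \int[mu]_(t in `[0%R, (2 * pi)%R]) h t.

Let pi2_gt0 : (0 < 2 * pi :> R)%R.
Proof. by rewrite mulr_gt0// pi_gt0. Qed.

Let pi2V_ge0 : 0 <= ((2 * pi)^-1)%:E :> \bar R.
Proof. by rewrite lee_fin invr_ge0 ltW. Qed.

Let mI (a b : R) : measurable (`[a, b]%classic : set (measurableTypeR R)).
Proof. exact: measurable_itv. Qed.

Lemma avg_ge0 h : (forall t, 0 <= h t) -> 0 <= avg h.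
Proof. by move=> h0; rewrite mule_ge0// integral_ge0. Qed.

Lemma eq_avg h h' : h =1 h' -> avg h = avg h'.
Proof. by move=> hh; congr avg; apply/funext. Qed.

Lemma le_avg h h' : (forall t, 0 <= h t) -> measurable_fun setT h -> measurable_fun setT h' ->
  (forall t, h t <= h' t) -> avg h <= avg h'.
Proof.
move=> h0 mh mh' hh'; apply: lee_wpmul2l => //.
by apply: ge0_le_integral => //; [exact: measurable_funS mh|exact: measurable_funS mh'].
Qed.

Lemma avgZ (k : R) h : (0 <= k)%R -> (forall t, 0 <= h t) -> measurable_fun setT h ->
  avg (fun t => k%:E * h t) = k%:E * avg h.
Proof.
move=> k0 h0 mh; rewrite /avg ge0_integralZl//; last exact: measurable_funS mh.
by rewrite muleCA.
Qed.

Lemma avg_cst (x : \bar R) : avg (fun=> x) = x.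
Proof.
rewrite /avg integral_cst//= lebesgue_measure_itv/= lte_fin pi2_gt0.
by rewrite sube0 muleCA -EFinM mulVf ?mule1// gt_eqF.
Qed.

Lemma avgD h h' : (forall t, 0 <= h t) -> measurable_fun setT h ->
  (forall t, 0 <= h' t) -> measurable_fun setT h' ->
  avg (fun t => h t + h' t) = avg h + avg h'.
Proof.
move=> h0 mh h'0 mh'; rewrite /avg ge0_integralD//; last 2 first.
- exact: measurable_funS mh.
- exact: measurable_funS mh'.
by rewrite ge0_muleDr// integral_ge0.
Qed.

(** These polynomials suffice as test functions: [|z + r cis t|^2] is of degree one in [cos t] and
    [sin t], and the second-order Taylor term of [ln] on a circle brings in [cos t ^+ 2]. *)
Lemma integral_trig (a b c d : R) :
  \int[mu]_(t in `[0%R, (2 * pi)%R]) (a + b * cos t + c * sin t + d * cos t ^+ 2)%:E =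
    (2 * pi * (a + d / 2))%:E.
Proof.
pose F (t : R) : R := (a * t + b * sin t - c * cos t + d * (2^-1 * (t + sin t * cos t)))%R.
have dF (t : R) : is_derive t 1%R F (a + b * cos t + c * sin t + d * cos t ^+ 2)%R.
  rewrite /F; apply: is_derive_eq.
  rewrite /GRing.scale/= ?mulr1 ?scaler0 ?addr0.
  have := cos2Dsin2 t; set x := cos t; set y := sin t => xy.
  by have -> : (y * - y = x ^+ 2 - 1)%R; [rewrite -xy; ring|field].
rewrite (@continuous_FTC2 _ _ F)//.
- rewrite /F -EFinD; congr (_%:E); rewrite mulr_natl sin2pi cos2pi sin0 cos0; ring.
- apply: continuous_subspaceT => t.
  by apply: differentiable_continuous; exact/derivable1_diffP.
- split.
  + by move=> t _; exact: ex_derive.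
  + apply: cvg_at_right_filter; apply: differentiable_continuous.
    exact/derivable1_diffP.
  + apply: cvg_at_left_filter; apply: differentiable_continuous.
    exact/derivable1_diffP.
- by move=> t _; rewrite derive1E derive_val.
Qed.

Lemma avg_ge_trig (a b c d : R) h : (forall t, 0 <= h t) -> measurable_fun setT h ->
  (forall t, (a + b * cos t + c * sin t + d * cos t ^+ 2)%:E <= h t) ->
  (a + d / 2)%:E <= avg h.
Proof.
move=> h0 mh ph; rewrite /avg lee_pdivlMl// -EFinM -(integral_trig a b c d).
pose p (t : R) : R := (a + b * cos t + c * sin t + d * cos t ^+ 2)%R.
have mp : measurable_fun setT (EFin \o p).
  apply/measurable_EFinP; apply: continuous_measurable_fun => t.
  by apply: differentiable_continuous; exact/derivable1_diffP.
(* The minorant may change sign. Its integral is at most that of its positive part, which is still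
   below [h] because [h >= 0]. *)
rewrite integralE; apply: (@le_trans _ _ (\int[mu]_(t in `[0%R, (2 * pi)%R]) (EFin \o p)^\+ t)).
  by apply: geeDl; rewrite oppe_le0 integral_ge0.
apply: ge0_le_integral => //.
- by apply: measurable_funS (measurable_funepos mp).
- exact: measurable_funS mh.
- by move=> t _; rewrite funeposE ge_max h0 andbT; exact: ph.
Qed.

(** Fatou's lemma: a failure of semicontinuity would give points [y k] in [B k] with
    [avg (f (y k)) <= q]. The countable neighbourhood base [B] is what makes sequences
    sufficient. *)
Lemma lsc_at_avg (T : topologicalType) (x : T) (B : nat -> set T) (f : T -> R -> \bar R) :
  (forall U, nbhs x U -> exists N, forall k, (N <= k)%N -> B k `<=` U) ->
  (forall k, nbhs x (B k)) ->
  (forall y t, 0 <= f y t) -> (\forall y \near x, measurable_fun setT (f y)) ->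
  (forall t, lsc_at (f ^~ t) x) -> lsc_at (fun y => avg (f y)) x.
Proof.
move=> Bsub Bx f0 mf lf q qf; apply: contrapT => nq.
have H k : exists y, [/\ B k y, measurable_fun setT (f y) & avg (f y) <= q%:E].
  apply: contrapT => nH; apply: nq; apply: filterS2 mf (Bx k) => y my By.
  by rewrite ltNge; apply/negP => yq; apply: nH; exists y.
have [y Hy] := choice H.
have flim t : f x t <= limn_einf (fun k => f (y k) t).
  rewrite leNgt; apply/negP => /ereal_between[r /andP[lr /(lf t)]].
  move=> /Bsub[N BN]; move: lr; rewrite ltNge => /negP; apply.
  apply: (@limn_einf_ge _ _ _ N) => k Nk; apply/ltW/(BN k Nk).
  by have [] := Hy k.
have : avg (f x) <= q%:E; last by rewrite leNgt qf.
rewrite /avg lee_pdivrMl//.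
apply: (@le_trans _ _ (\int[mu]_(t in `[0%R, (2 * pi)%R]) limn_einf (fun k => f (y k) t))).
  apply: ge0_le_integral => //.
  - exact: measurable_funS (nbhs_singleton mf).
  - apply: measurableT_comp => //; apply: measurable_fun_limn_esup => k.
    apply: measurableT_comp => //.
    by have [_ + _] := Hy k; exact: measurable_funS.
apply: le_trans (fatou _ _ _ _) _ => //.
  by move=> k; have [_ + _] := Hy k; exact: measurable_funS.
apply: limn_einf_le => k; have [_ _] := Hy k.
by rewrite /avg lee_pdivrMl.
Qed.

Let shift_integral (h : R -> \bar R) (a b s : R) : (forall t, 0 <= h t) -> measurable_fun setT h ->
  \int[mu]_(t in `]a, b]) h (t + s)%R = \int[mu]_(t in `](a + s)%R, (b + s)%R]) h t.
Proof.
move=> h0 mh.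
pose phi (t : measurableTypeR R) : measurableTypeR R := (t + s)%R.
have mphi : measurable_fun setT phi by exact: measurable_funD.
(* Translation invariance: the pushforward agrees with Lebesgue measure on half-open intervals,
   hence everywhere by uniqueness. *)
have lphi A : measurable A -> pushforward mu phi A = mu A.
  move=> mA; apply/esym/(@lebesgue_measure_unique _ (pushforward mu phi)) => //= _ [[c d] _ <-].
  rewrite /pushforward.
  have -> : phi @^-1` `]c, d]%classic = `](c - s)%R, (d - s)%R]%classic.
    by apply/seteqP; split => t; rewrite /= !in_itv/= /phi ltrBlDr lerBrDr.
  rewrite !lebesgue_measure_itv/= !lte_fin ltrD2r; case: ifP => // _.
  by rewrite -!EFinD; congr (_%:E); ring.
transitivity (\int[pushforward mu phi]_(t in `](a + s)%R, (b + s)%R]) h t).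
  rewrite ge0_integral_pushforward//; last exact: measurable_funS mh.
  congr (integral _ _ _); apply/seteqP; split => t; rewrite /= !in_itv/= /phi ltrD2r lerD2r//.
by apply: eq_measure_integral => A mA _; exact: lphi.
Qed.

Let split_integral (h : R -> \bar R) (a b c : R) : (a <= b <= c)%R ->
  (forall t, 0 <= h t) -> measurable_fun setT h ->
  \int[mu]_(t in `]a, c]) h t = \int[mu]_(t in `]a, b]) h t + \int[mu]_(t in `]b, c]) h t.
Proof.
move=> /andP[ab bc] h0 mh; rewrite -ge0_integral_setU//.
- congr (integral _ _ _); apply/seteqP; split => t /=; rewrite !in_itv/=.
    by move=> /andP[at_ tc]; have [tb|tb] := leP t b; [left; rewrite at_|right; rewrite tc].
  by move=> [/andP[-> tb]|/andP[bt ->]]; [rewrite (le_trans tb bc)|rewrite (le_lt_trans ab bt)].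
- exact: measurable_funS mh.
- by apply/disj_set2P; rewrite -subset0 => t /=; rewrite !in_itv/= => -[/andP[_ tb] /andP[]]; rewrite ltNge tb.
Qed.

(** Translation moves the integral to the interval from [s] to [2 pi + s]; the part beyond [2 pi] is
    moved back by one period. Half-open intervals make the pieces disjoint. *)
Lemma avg_shift (h : R -> \bar R) (s : R) : (0 <= s <= 2 * pi)%R ->
  (forall t, 0 <= h t) -> measurable_fun setT h -> (forall t, h (t + 2 * pi)%R = h t) ->
  avg (fun t => h (t + s)%R) = avg h.
Proof.
move=> s02 h0 mh hp; have /andP[s0 s2] := s02; rewrite /avg; congr (_ * _).
have mhs : measurable_fun setT (fun t : measurableTypeR R => h (t + s)%R).
  apply: (measurableT_comp mh); exact: measurable_funD.
rewrite -!integral_itv_obnd_cbnd; [|exact: measurable_funS mh|exact: measurable_funS mhs].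
have -> := shift_integral 0%R (2 * pi)%R s h0 mh; rewrite add0r.
have -> : \int[mu]_(t in `]s, (2 * pi + s)%R]) h t =
    \int[mu]_(t in `]s, (2 * pi)%R]) h t + \int[mu]_(t in `](2 * pi)%R, (2 * pi + s)%R]) h t.
  by apply: split_integral => //; rewrite s2/= lerDl.
have -> : \int[mu]_(t in `](2 * pi)%R, (2 * pi + s)%R]) h t = \int[mu]_(t in `]0%R, s]) h t.
  have := shift_integral 0%R s (2 * pi)%R h0 mh; rewrite add0r (addrC s) => <-.
  by apply: eq_integral => t _; rewrite hp.
by rewrite addeC -split_integral// s0.
Qed.

Lemma measurable_avg (h : R * R -> \bar R) : (forall p, 0 <= h p) -> (forall p, lsc_at h p) ->
  measurable_fun setT (fun s => avg (fun t => h (s, t))).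
Proof.
move=> h0 /lsc_measurable_RR mh; apply: measurable_funeM.
pose D : set (measurableTypeR R) := `[0%R, (2 * pi)%R]%classic.
have mD : measurable D by exact: mI.
pose h2 := h \_ (setT `*` D).
rewrite (_ : (fun s => _) = fubini_F mu h2).
  apply: measurable_fun_fubini_tonelli_F => [|p]; last by rewrite /h2 /patch; case: ifP.
  apply: (measurable_restrictT h (measurableX measurableT mD)).1; exact: measurable_funS mh.
apply/funext => s; rewrite /fubini_F [LHS]integral_mkcond; apply: eq_integral => t _.
by rewrite /h2 /patch in_setX in_setT.
Qed.

Lemma avg_swap (h : R * R -> \bar R) : (forall p, 0 <= h p) -> (forall p, lsc_at h p) ->
  avg (fun s => avg (fun t => h (s, t))) = avg (fun t => avg (fun s => h (s, t))).
Proof.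
move=> h0 lh.
have mh := lsc_measurable_RR lh.
pose D : set (measurableTypeR R) := `[0%R, (2 * pi)%R]%classic.
have mD : measurable D by exact: mI.
(* Tonelli is applied on the whole plane, to the function cut off to the square. *)
pose g := h \_ (D `*` D).
have mg : measurable_fun setT g.
  apply: (measurable_restrictT h (measurableX mD mD)).1; exact: measurable_funS mh.
have g0 p : 0 <= g p by rewrite /g /patch; case: ifP.
have E1 : \int[mu]_(s in D) \int[mu]_(t in D) h (s, t) = \int[mu]_s \int[mu]_t g (s, t).
  rewrite integral_mkcond; apply: eq_integral => s _.
  rewrite /patch; case: ifPn => sD.
    rewrite integral_mkcond; apply: eq_integral => t _.
    by rewrite /g /patch in_setX sD.
  apply/esym/integral0_eq => t _.
  by rewrite /g /patch in_setX (negPf sD).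
have E2 : \int[mu]_(t in D) \int[mu]_(s in D) h (s, t) = \int[mu]_t \int[mu]_s g (s, t).
  rewrite integral_mkcond; apply: eq_integral => s _.
  rewrite /patch; case: ifPn => sD.
    rewrite integral_mkcond; apply: eq_integral => t _.
    by rewrite /g /patch in_setX sD andbT.
  apply/esym/integral0_eq => t _.
  by rewrite /g /patch in_setX (negPf sD) andbF.
have mF : measurable_fun setT (fun s => \int[mu]_(t in D) h (s, t)).
  pose h2 := h \_ (setT `*` D).
  have -> : (fun s => \int[mu]_(t in D) h (s, t)) = fubini_F mu h2.
    apply/funext => s; rewrite /fubini_F [LHS]integral_mkcond; apply: eq_integral => t _.
    by rewrite /h2 /patch in_setX in_setT.
  apply: measurable_fun_fubini_tonelli_F => [|p]; last by rewrite /h2 /patch; case: ifP.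
  apply: (measurable_restrictT h (measurableX measurableT mD)).1; exact: measurable_funS mh.
have mG : measurable_fun setT (fun t => \int[mu]_(s in D) h (s, t)).
  pose h2 := h \_ (D `*` setT).
  have -> : (fun t => \int[mu]_(s in D) h (s, t)) = fubini_G mu h2.
    apply/funext => t; rewrite /fubini_G [LHS]integral_mkcond; apply: eq_integral => s _.
    by rewrite /h2 /patch in_setX in_setT andbT.
  apply: measurable_fun_fubini_tonelli_G => [|p]; last by rewrite /h2 /patch; case: ifP.
  apply: (measurable_restrictT h (measurableX mD measurableT)).1; exact: measurable_funS mh.
have -> : avg (fun s => avg (fun t => h (s, t))) =
    ((2 * pi)^-1)%:E * avg (fun s => \int[mu]_(t in D) h (s, t)).
  by apply: avgZ => // s; exact: integral_ge0.
have -> : avg (fun t => avg (fun s => h (s, t))) =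
    ((2 * pi)^-1)%:E * avg (fun t => \int[mu]_(s in D) h (s, t)).
  by apply: avgZ => // s; exact: integral_ge0.
rewrite /avg -/D E1 E2; congr (_ * (_ * _)); exact: (fubini_tonelli g).
Qed.

End Avg.

Section LscMin.
Context {R : realType}.
Local Open Scope ereal_scope.

(** The sets [K] intersected with [f <= r], for [r] above the infimum [m], generate a proper filter;
    at a cluster point given by compactness, semicontinuity excludes [m < f x]. If [m] is infinite,
    every point is a minimum. *)
Lemma lsc_attains_min (T : topologicalType) (K : set T) (f : T -> \bar R) :
  compact K -> K !=set0 -> (forall x, K x -> lsc_at f x) ->
  exists2 x, K x & forall y, K y -> f x <= f y.
Proof.
move=> cK [x0 Kx0] lf; set m := ereal_inf (f @` K).
have mK y : K y -> m <= f y by move=> Ky; apply: ereal_inf_lbound; exists y.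
have [my|] := eqVneq m +oo.
  by exists x0 => // y /mK; rewrite my leye_eq => /eqP ->; exact: leey.
rewrite -ltey => moo.
pose F := filter_from [set r : \bar R | m < r] (fun r => K `&` [set x | f x <= r]).
have FF : ProperFilter F.
  apply: filter_from_proper.
    apply: filter_from_filter; first by exists +oo.
    move=> r s /= mr ms; exists (mine r s); first by rewrite /= lt_min mr.
    by move=> x /= [Kx]; rewrite le_min => /andP[].
  move=> r /= mr; have [_ [y Ky <-] yr] := ereal_inf_lt mr.
  by exists y; split => //=; exact: ltW.
have [|x [Kx clx]] := cK F FF; first by exists +oo => // x [].
exists x => // y /mK; apply: le_trans; rewrite leNgt; apply/negP => mx.
have [r /andP[mr rx]] := ereal_between mx.
have [z [[Kz /= zr]]] : (K `&` [set x | f x <= r%:E]) `&` [set z | r%:E < f z] !=set0.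
  by apply: clx; [exists r%:E|exact: lf].
by rewrite ltNge zr.
Qed.

Lemma near_all (T : topologicalType) (x : T) (P : T -> Prop) :
  (forall y, P y) -> \forall y \near x, P y.
Proof. exact: nearW. Qed.

Lemma lsc_atD (T : topologicalType) (f : T -> \bar R) (g : T -> R) (x : T) :
  (forall y, 0 <= f y) -> lsc_at f x -> {for x, continuous g} ->
  lsc_at (fun y => f y + (g y)%:E) x.
Proof.
move=> f0 lf cg q.
rewrite -lteBlDr// -EFinB => /ereal_between[r /andP[qr /lf rf]].
have gq : (q - r < g x)%R by move: qr; rewrite lte_fin; lra.
apply: filterS2 rf (cvgr_gt (g x) cg (q - r)%R gq) => y ry qy.
by rewrite -lteBlDr// -EFinB (le_lt_trans _ ry)// lee_fin; lra.
Qed.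

End LscMin.

(** * From local to global supermean inequalities in one variable *)

Section Disc.
Context {R : realType}.
Local Open Scope ereal_scope.
Implicit Types f : R[i] -> \bar R.

(** The radius [e] serves all centres near [x], and [x] runs through the closed disc with its
    boundary, so that compactness applies. *)
Definition local_supermean f := forall x, (cabs x <= 1)%R -> exists2 e : R, (0 < e)%R &
  forall y b, (cabs (y - x) < e)%R -> (cabs b < e)%R -> avg (fun t => f (y + cis t * b)%R) <= f y.

Lemma invn_lt (e : R) : (0 < e)%R -> exists N, forall k, (N <= k)%N -> (k.+1%:R^-1 < e)%R.
Proof.
move=> e0; have [N _ HN] := near_infty_natSinv_lt (PosNum e0).
by exists N => k Nk; exact: HN.
Qed.

(** Compactness of the closed disc makes the radius independent of the centre; radii [1 / (k + 1)]
    turn this into a covering statement with [k] tending to infinity. *)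
Lemma uniform_supermean f : local_supermean f -> exists2 e : R, (0 < e)%R &
  forall y b, (cabs y <= 1)%R -> (cabs b < e)%R -> avg (fun t => f (y + cis t * b)%R) <= f y.
Proof.
move=> lf; pose P (k : nat) y := forall b, (cabs b < k.+1%:R^-1)%R -> avg (fun t => f (y + cis t * b)%R) <= f y.
have cov x : [set z : R[i] | (cabs z <= 1)%R] x -> \forall x' \near x & k \near \oo, P k x'.
  move=> /= /lf[e e0 xe]; have [N HN] := invn_lt e0.
  exists ([set y | cabs (y - x) < e]%R, [set k | (N <= k)%N]); first split => /=.
  - by apply/nbhs_cabsP; exists e.
  - by exists N.
  - by move=> [y k] [/= ye Nk] b bk; apply: xe => //; exact: lt_trans (HN k Nk).
have [N _ NP] := (compact_near_coveringP _).1 (@compact_cdisc R 1) nat \oo P _ cov.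
exists N.+1%:R^-1%R; first by rewrite invr_gt0.
by move=> y b y1 bN; apply: (NP N) => //=.
Qed.

Lemma cabs_basis (x : R[i]) : let B k := [set y | (cabs (y - x) < k.+1%:R^-1)%R] in
  (forall U, nbhs x U -> exists N, forall k, (N <= k)%N -> B k `<=` U) /\
  (forall k, nbhs x (B k)).
Proof.
split=> [U /nbhs_cabsP[e /invn_lt[N HN] eU]|k].
  by exists N => k Nk y /= yk; apply: eU; exact: lt_trans (HN k Nk).
by apply/nbhs_cabsP; exists k.+1%:R^-1%R.
Qed.

Lemma continuous_mulc (T : topologicalType) (g h : T -> R[i]) (x : T) :
  {for x, continuous g} -> {for x, continuous h} -> {for x, continuous (fun t => g t * h t)%R}.
Proof. by move=> gx hx; exact: (@continuousM R[i] T g h x gx hx). Qed.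

Lemma continuous_addc (T : topologicalType) (g h : T -> R[i]) (x : T) :
  {for x, continuous g} -> {for x, continuous h} -> {for x, continuous (fun t => g t + h t)%R}.
Proof. by move=> gx hx; exact: (@continuousD R[i] R[i] T g h x gx hx). Qed.

Lemma continuous_mulcl (c : R[i]) : continuous (fun y : R[i] => c * y)%R.
Proof.
move=> y; apply: (@continuous_mulc R[i] (fun=> c) id y); last by move=> U.
exact: cst_continuous.
Qed.

Lemma continuous_circle (z b : R[i]) : continuous (fun t : R => z + cis t * b)%R.
Proof.
move=> t; apply: (@continuous_addc R (fun=> z) (fun t => cis t * b)%R t); first exact: cst_continuous.
by apply: (@continuous_mulc R cis (fun=> b) t); [exact: continuous_cis|exact: cst_continuous].
Qed.

Lemma continuous_rot_circle (z b : R[i]) :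
  continuous (fun p : R * R => cis p.1 * (z + cis p.2 * b))%R.
Proof.
move=> p.
apply: (@continuous_mulc (R * R)%type (fun p => cis p.1) (fun p => z + cis p.2 * b)%R p).
  by apply: (@continuous_comp (R * R)%type R R[i] fst cis p); [exact: cvg_fst|exact: continuous_cis].
apply: (@continuous_comp (R * R)%type R R[i] snd (fun t => z + cis t * b)%R p); first exact: cvg_snd.
exact: continuous_circle.
Qed.

Lemma lsc_cst_comp f (T : topologicalType) (g : T -> R[i]) : (forall x, lsc_at f x) ->
  continuous g -> forall x, lsc_at (f \o g) x.
Proof. by move=> lf cg x; apply: lsc_at_comp; [exact: cg|exact: lf]. Qed.

Lemma lsc_rot f : (forall x, 0 <= f x) -> (forall x, lsc_at f x) ->
  forall z, lsc_at (fun z => avg (fun s => f (cis s * z)%R)) z.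
Proof.
move=> f0 lf z; have [B1 B2] := cabs_basis z.
apply: (@lsc_at_avg _ _ _ _ (fun z s => f (cis s * z)%R) B1 B2).
- by move=> y t; exact: f0.
- apply: near_all => y; apply: lsc_measurable.
  apply: (@lsc_cst_comp f R (fun s => cis s * y)%R lf) => s.
  apply: continuous_mulc; [exact: continuous_cis|exact: cst_continuous].
- move=> t; apply: (@lsc_cst_comp f R[i] (fun y => cis t * y)%R lf) => y.
  exact: continuous_mulcl.
Qed.

Lemma sqr_cabs_addcis (z : R[i]) (e t : R) :
  (cabs (z + cis t * e%:C%C) ^+ 2 = cabs z ^+ 2 + e ^+ 2 +
    2 * e * complex.Re z * cos t + 2 * e * complex.Im z * sin t)%R.
Proof.
case: z => x y; rewrite !sqr_cabs /=.
have := cos2Dsin2 t; set c := cos t; set s := sin t => cs.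
rewrite !mulr0 subr0 add0r.
have -> : (e ^+ 2 = e ^+ 2 * (c ^+ 2 + s ^+ 2))%R by rewrite cs mulr1.
ring.
Qed.

(* Averaging over rotations makes the boundary values constant, and [- eta |z|^2]
   turns the supermean inequality into a strict one at an interior minimum. *)
Lemma disc_supermean f : (forall x, 0 <= f x) -> (forall x, lsc_at f x) ->
  local_supermean f -> avg (fun t => f (cis t)) <= f 0%R.
Proof.
move=> f0 lf /uniform_supermean[e e0 ef].
pose F z := avg (fun s => f (cis s * z)%R).
have F00 z : 0 <= F z by apply: avg_ge0.
have F0 : F 0%R = f 0%R.
  rewrite /F (@eq_avg _ _ (fun=> f 0%R)); last by move=> s; rewrite mulr0.
  exact: avg_cst.
have F1 : F 1%R = avg (fun t => f (cis t)).
  by apply: eq_avg => s; rewrite mulr1.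
rewrite -F0 -F1 leNgt; apply/negP => /ereal_between[q /andP[F0q qF1]].
have [r /andP[F0r]] := ereal_between F0q; rewrite lte_fin => rq.
(* With this gap [G 0 < r], while on the unit circle [G = F 1 - eta > q - eta = r]; so the minimum
   of [G] is interior. *)
pose eta := (q - r)%R; have eta0 : (0 < eta)%R by rewrite subr_gt0.
pose G z := F z + (- (eta * cabs z ^+ 2))%:E.
have [z /= z1 zmin] : exists2 z, (cabs z <= 1)%R & forall y, (cabs y <= 1)%R -> G z <= G y.
  apply: (@lsc_attains_min _ _ [set z : R[i] | (cabs z <= 1)%R]).
  - exact: compact_cdisc.
  - by exists 0%R; rewrite /= cabs0.
  - move=> z _; apply: lsc_atD => //; first exact: lsc_rot.
    apply: continuousN; apply: continuousM; first exact: cst_continuous.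
    by apply: continuousM; exact: continuous_cabs.
have Gz0 : G z < r%:E.
  apply: le_lt_trans (zmin 0%R _) _; first by rewrite cabs0.
  by rewrite /G cabs0 expr0n/= mulr0 oppr0 adde0.
have [z1'|z1'] := eqVneq (cabs z) 1%R.
  have [s s02 zs] := cis_exists z1'.
  have Fz : F z = F 1%R.
    rewrite F1 /F zs -(@avg_shift _ (fun t => f (cis t)) s)//.
    - by apply: eq_avg => t; rewrite cisD.
    - by apply: lsc_measurable; apply: lsc_cst_comp => //; exact: continuous_cis.
    - by move=> t; rewrite mulr_natl cisD2pi.
  move: Gz0; rewrite /G Fz z1' expr1n mulr1 -lteBrDr// -EFinB ltNge => /negP; apply.
  by apply/ltW; move: qF1; rewrite (_ : r - - eta = q)%R// /eta; ring.
have {z1 z1'}z1 : (cabs z < 1)%R by rewrite lt_neqAle z1'.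
have Fzfin : F z \is a fin_num.
  rewrite ge0_fin_numE//; move: Gz0; rewrite /G -lteBrDr// => /lt_trans; apply.
  by rewrite -EFinB ltry.
pose d := (Num.min (e / 2) (1 - cabs z))%R.
have d0 : (0 < d)%R by rewrite lt_min divr_gt0// subr_gt0.
have de : (d < e)%R by rewrite gt_min; apply/orP; left; lra.
have dz : (d <= 1 - cabs z)%R by rewrite ge_min lexx orbT.
have cdd : cabs (d%:C%C : R[i]) = d by rewrite cabs_real gtr0_norm.
pose h (p : R * R) := f (cis p.1 * (z + cis p.2 * d%:C%C))%R.
have lh p : lsc_at h p.
  by apply: lsc_cst_comp => //; exact: continuous_rot_circle.
(* A rotation carries the circle about [z] to one of the same radius about the rotated centre, so
   the small-circle inequality for [f] passes to [F] by exchanging the two means. *)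
have FzF : avg (fun t => F (z + cis t * d%:C%C)%R) <= F z.
  rewrite (_ : avg _ = avg (fun s => avg (fun t => h (s, t)))); last by rewrite avg_swap// => p; exact: f0.
  apply: le_avg.
  - by move=> s; apply: avg_ge0 => t; exact: f0.
  - by apply: measurable_avg => // p; exact: f0.
  - apply: lsc_measurable; apply: lsc_cst_comp => // s.
    by apply: continuous_mulc; [exact: continuous_cis|exact: cst_continuous].
  - move=> s; rewrite (@eq_avg _ _ (fun t => f (cis s * z + cis t * (cis s * d%:C%C))%R)).
      by apply: ef; rewrite cabsM cabs_cis mul1r ?cdd// ltW.
    by move=> t; rewrite /h/=; congr f; ring.
have Gfin : G z = (fine (F z) - eta * cabs z ^+ 2)%:E by rewrite /G -{1}(fineK Fzfin) -EFinD.
(* Minimality of [G] at [z] gives [F (z + d cis t) >= F z + eta * (|z + d cis t|^2 - |z|^2)], and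
   the right-hand side has mean [F z + eta * d^2]. *)
have : (fine (F z) + eta * d ^+ 2)%:E <= F z.
  apply: le_trans FzF.
  have -> : (fine (F z) + eta * d ^+ 2 = (fine (F z) + eta * d ^+ 2) + 0 / 2)%R by rewrite mul0r addr0.
  apply: (@avg_ge_trig _ _ (eta * (2 * d * complex.Re z)) (eta * (2 * d * complex.Im z)))%R.
  - by move=> t; exact: F00.
  - apply: lsc_measurable => t.
    apply: (@lsc_cst_comp F R (fun t => z + cis t * d%:C%C)%R); first exact: lsc_rot.
    exact: continuous_circle.
  - move=> t; have : (cabs (z + cis t * d%:C%C) <= 1)%R.
      apply: le_trans (ler_cabsD _ _) _; rewrite cabsM cabs_cis mul1r cdd; lra.
    move=> /zmin; rewrite Gfin /G EFinN leeBrDr// -EFinD; apply: le_trans.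
    by rewrite lee_fin sqr_cabs_addcis le_eqVlt; apply/orP; left; apply/eqP; ring.
rewrite -[leRHS](fineK Fzfin) lee_fin gerDl leNgt => /negP; apply.
by rewrite mulr_gt0// exprn_gt0.
Qed.

End Disc.

(** * Comparison with the logarithm on a punctured disc *)

Section Annulus.
Context {R : realType}.

(** The difference [h] of the two sides, as a function of [y = 1 + x], has derivative
    [(y - 1)^3 / y]. It has the sign of [y - 1], so [h] is minimal at 1, where it vanishes. *)
Lemma ln1D_le (x : R) : -1 < x -> ln (1 + x) <= x - x ^+ 2 / 2 + x ^+ 3 / 3.
Proof.
move=> x1; pose h (y : R) := (y - 1) - (y - 1) ^+ 2 / 2 + (y - 1) ^+ 3 / 3 - ln y.
have dh (y : R) : 0 < y -> is_derive y (1 : R) h ((y - 1) ^+ 3 / y).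
  move=> y0; have dln := is_derive1_ln y0.
  rewrite /h; apply: is_derive_eq; rewrite /GRing.scale/= ?mulr1 ?subr0 ?scaler0.
  by field; rewrite gt_eqF.
have ch a b : 0 < a -> {within `[a, b], continuous h}.
  move=> a0; apply: derivable_within_continuous => y; rewrite in_itv/= => /andP[ay _].
  by have [] := dh y (lt_le_trans a0 ay).
have h1 : h 1 = 0 by rewrite /h ln1 subrr !expr0n/= !mul0r !subr0 addr0.
have xE : h (1 + x) = x - x ^+ 2 / 2 + x ^+ 3 / 3 - ln (1 + x).
  by rewrite /h (addrC 1) addrK.
rewrite -subr_ge0 -xE; have [x0|x0|<-] := ltgtP 0 x; last by rewrite addr0 h1.
- have [] := @MVT _ h (fun y => (y - 1) ^+ 3 / y) 1 (1 + x).
  + by rewrite ltrDl.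
  + by move=> y; rewrite in_itv/= => /andP[y1 _]; apply: dh; lra.
  + exact: ch.
  + move=> c; rewrite in_itv/= h1 subr0 => /andP[c1 _] ->.
    by rewrite mulr_ge0 ?divr_ge0 ?exprn_ge0//; lra.
- have [] := @MVT _ h (fun y => (y - 1) ^+ 3 / y) (1 + x) 1.
  + by rewrite gtrDl.
  + by move=> y; rewrite in_itv/= => /andP[y1 _]; apply: dh; lra.
  + by apply: ch; lra.
  + move=> c; rewrite in_itv/= h1 sub0r => /andP[c1 c2] H.
    have : h (1 + x) = (1 - c) ^+ 3 / c * (- x).
      by rewrite -[LHS]opprK H; field; apply/eqP; lra.
    by move=> ->; rewrite mulr_ge0 ?divr_ge0 ?exprn_ge0//; lra.
Qed.

Lemma sqr_cabs_1Dcis (r t : R) :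
  cabs (1 + cis t * r%:C%C) ^+ 2 = 1 + (2 * r * cos t + r ^+ 2).
Proof. by rewrite sqr_cabs_addcis cabs1 /=; ring. Qed.

Local Open Scope ereal_scope.

(* With [s = cabs z], on the circles [z (1 + r cis t)] the average of [ln] exceeds
   [ln s] by at most [O(r^3)], which [eta r^2 s^2] beats for small [r]. *)
Lemma annulus_supermean (f : R[i] -> \bar R) (K e0 : R) :
  (forall x, 0 <= f x) -> (forall x, lsc_at f x) -> local_supermean f -> (0 < e0)%R ->
  (forall x, (0 < cabs x < e0)%R -> (- ln (cabs x) - K)%:E <= f x) ->
  forall x, (0 < cabs x <= 1)%R -> (- ln (cabs x))%:E <= f x.
Proof.
move=> f0 lf /uniform_supermean[e e_gt0 ef] e0_gt0 fK x /andP[x0].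
rewrite le_eqVlt => /orP[/eqP ->|x1]; first by rewrite ln1 oppr0.
pose L := (- ln (cabs x))%R; have L0 : (0 < L)%R by rewrite oppr_gt0 ln_lt0// x0.
rewrite leNgt; apply/negP => fxL.
have [r rfx] : exists r, f x = r%:E.
  by exists (fine (f x)); rewrite fineK// ge0_fin_numE// (lt_trans fxL)// ltry.
move: fxL; rewrite rfx lte_fin -/L => rL.
have r0 : (0 <= r)%R by rewrite -lee_fin -rfx.
(* Lowering the coefficient of [ln] from 1 to [1 - k] lets the pole of [f] outweigh the unknown [K].
   Since [k * L = 2 * eta], one has [G x = - 2 eta - eta |x|^2 < - eta], whereas [G >= - eta] will
   hold on both boundary circles. *)
pose k := ((L - r) / (2 * L))%R; pose eta := ((L - r) / 4)%R.
have k0 : (0 < k)%R by rewrite divr_gt0 ?subr_gt0 ?mulr_gt0.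
have kL : (k * L = (L - r) / 2)%R by rewrite /k; field; rewrite gt_eqF.
have k1 : (k <= 1)%R by rewrite /k ler_pdivrMr ?mulr_gt0// mul1r; lra.
have eta0 : (0 < eta)%R by rewrite divr_gt0// subr_gt0.
(* On the inner circle the pole bound is available as [d < e0], and the exponential gives
   [k * ln d + K <= 0], hence [G >= - eta] there; [d <= |x|] keeps [x] in the annulus. *)
pose d := Num.min (e0 / 2)%R (Num.min (cabs x) (expR (- (`|K| / k)))%R).
have d0 : (0 < d)%R by rewrite !lt_min divr_gt0// x0 expR_gt0.
have de0 : (d < e0)%R by rewrite gt_min; apply/orP; left; lra.
have dx : (d <= cabs x)%R by rewrite !ge_min lexx orbT.
have dK : (k * ln d + K <= 0)%R.
  have : (ln d <= - (`|K| / k))%R.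
    rewrite -[leRHS]expRK ler_ln ?posrE ?expR_gt0//.
    by rewrite /d !ge_min lexx !orbT.
  rewrite -(ler_pM2l k0) => /le_trans h.
  have /h : (k * - (`|K| / k) <= - K)%R; last by rewrite -lerBrDr sub0r.
  by rewrite mulrN mulrCA divff ?gt_eqF// mulr1 lerN2 ler_norm.
pose g (z : R[i]) := ((1 - k) * ln (cabs z) - eta * cabs z ^+ 2)%R.
pose G z := f z + (g z)%:E.
have [z /= [z1 dz] zmin] : exists2 z, (cabs z <= 1 /\ d <= cabs z)%R &
    forall y, (cabs y <= 1 /\ d <= cabs y)%R -> G z <= G y.
  apply: (@lsc_attains_min _ _ [set z : R[i] | (cabs z <= 1 /\ d <= cabs z)%R]).
  - apply: (subclosed_compact _ (@compact_cdisc R 1)); last by move=> z [].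
    apply: closedI.
      apply: (@closed_comp _ _ cabs [set x | (x <= 1)%R]); [by move=> + _; exact: continuous_cabs|exact: closed_le].
    apply: (@closed_comp _ _ cabs [set x | (d <= x)%R]); [by move=> + _; exact: continuous_cabs|exact: closed_ge].
  - by exists x; split => //; exact: ltW.
  - move=> z [z1 dz]; have z0 : (0 < cabs z)%R := lt_le_trans d0 dz.
    apply: lsc_atD => //.
    apply: (@continuous_comp _ _ _ cabs (fun s => (1 - k) * ln s - eta * s ^+ 2)%R).
      exact: continuous_cabs.
    apply: differentiable_continuous; apply/derivable1_diffP.
    by have dln := is_derive1_ln z0; exact: ex_derive.
have z0 : (0 < cabs z)%R := lt_le_trans d0 dz.
have Gx : G x < (- eta)%:E.
  rewrite /G rfx -EFinD lte_fin /g -/L.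
  have -> : (ln (cabs x) = - L)%R by rewrite opprK.
  have := mulr_gt0 eta0 (exprn_gt0 2 x0); rewrite /eta; lra.
have Gz := le_lt_trans (zmin x (conj (ltW x1) dx)) Gx.
have [z1'|z1'] := eqVneq (cabs z) 1%R.
  move: Gz; rewrite /G /g z1' ln1 mulr0 expr1n mulr1 add0r ltNge => /negP; apply.
  by rewrite leeDr.
have {z1 z1'}z1 : (cabs z < 1)%R by rewrite lt_neqAle z1'.
have [dz'|dz'] := eqVneq (cabs z) d.
  have := fK z; rewrite dz' d0 de0 => /(_ isT) fz.
  move: Gz; rewrite /G ltNge => /negP; apply.
  apply: le_trans (leeD fz (lexx _)); rewrite -EFinD lee_fin /g dz'.
  have : (d ^+ 2 <= 1)%R by rewrite exprn_ile1 ?ltW// -dz'.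
  rewrite -(ler_pM2l eta0); lra.
have {dz dz'}dz : (d < cabs z)%R by rewrite lt_neqAle eq_sym dz'.
have fzfin : f z \is a fin_num.
  rewrite ge0_fin_numE//; move: Gz; rewrite /G -lteBrDr// => /lt_trans; apply.
  by rewrite -EFinB ltry.
set s := cabs z in z0 z1 dz.
(* The circle [z (1 + rho cis t)] has to be admissible for [ef] and to stay in the annulus; the
   bound by [eta * s^2 / 10] makes the cubic error, at most [9/2 * rho^3], smaller than the gain
   [eta * s^2 * rho^2]. *)
pose rho := Num.min (e / 2)%R (Num.min (1 - s)%R (Num.min (s - d)%R
  (Num.min 6^-1%R (eta * s ^+ 2 / 10)%R))).
have rho0 : (0 < rho)%R.
  have h1 : (0 < eta * s ^+ 2 / 10)%R by rewrite divr_gt0// mulr_gt0// exprn_gt0.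
  have h2 : (0 < e / 2)%R by rewrite divr_gt0.
  by rewrite !lt_min h2 !subr_gt0 z1 dz h1 !andbT /= invr_gt0.
have rho_e : (rho < e)%R by rewrite gt_min; apply/orP; left; lra.
have rho1 : (rho <= 1 - s)%R by rewrite !ge_min lexx !orbT.
have rhod : (rho <= s - d)%R by rewrite !ge_min lexx !orbT.
have rho6 : (rho <= 6^-1)%R by rewrite !ge_min lexx !orbT.
have rhoeta : (rho <= eta * s ^+ 2 / 10)%R by rewrite /rho !ge_min lexx !orbT.
clearbody rho.
have crho : cabs (rho%:C%C : R[i]) = rho by rewrite cabs_real gtr0_norm.
have Gfin : G z = (fine (f z) + g z)%:E by rewrite /G -{1}(fineK fzfin) -EFinD.
have srho : (s * rho <= rho)%R by rewrite ger_pMl// ltW.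
have avgf : avg (fun t => f (z + cis t * (z * rho%:C%C))%R) <= f z.
  by apply: ef; [exact: ltW|rewrite cabsM crho (le_lt_trans srho)].
(* Half of [1 - k], because the Taylor bound is applied to [ln (c^2) = 2 * ln c]. *)
pose kk := ((1 - k) / 2)%R.
have kk0 : (0 <= kk)%R by rewrite /kk; lra.
have kk2 : (kk <= 2^-1)%R by rewrite /kk; lra.
pose m := fine (f z).
(* The constant terms of the expansion. Its [- kk * rho^2] cancels against half the coefficient
   [2 * kk * rho^2] of [cos t ^+ 2]: this is the harmonicity of [ln |z|] to second order. *)
pose a := (m - kk * (rho ^+ 2 - rho ^+ 4 / 2 + 9 * rho ^+ 3) + eta * s ^+ 2 * rho ^+ 2)%R.
have : (a + (2 * kk * rho ^+ 2) / 2)%:E <= f z.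
  apply: le_trans avgf.
  apply: (@avg_ge_trig _ _ (- kk * (2 * rho - 2 * rho ^+ 3) + eta * s ^+ 2 * (2 * rho))%R 0%R).
  - by move=> t; exact: f0.
  - by apply: lsc_measurable => t; apply: (@lsc_cst_comp _ f R _ lf); exact: continuous_circle.
  - move=> t; set y := (z + _)%R.
    have yE : y = (z * (1 + cis t * rho%:C%C))%R by rewrite /y; ring.
    have cy : cabs y = (s * cabs (1 + cis t * rho%:C%C))%R by rewrite yE cabsM.
    set c := cabs (1 + _)%R in cy.
    have c2 : (c ^+ 2 = 1 + (2 * rho * cos t + rho ^+ 2))%R by exact: sqr_cabs_1Dcis.
    have cle : (c <= 1 + rho)%R.
      by rewrite /c (le_trans (ler_cabsD _ _))// cabs1 cabsM cabs_cis mul1r crho.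
    have cge : (1 - rho <= c)%R.
      have := ler_cabsD (1 + cis t * rho%:C%C)%R (- (cis t * rho%:C%C))%R.
      by rewrite addrK cabs1 cabsN cabsM cabs_cis mul1r crho lerBlDr.
    have c0 : (0 < c)%R by lra.
    have /zmin : (cabs y <= 1 /\ d <= cabs y)%R.
      have : (s * c <= s * (1 + rho))%R by rewrite ler_pM2l.
      have : (s * (1 - rho) <= s * c)%R by rewrite ler_pM2l.
      rewrite cy; lra.
    rewrite Gfin /G -leeBlDr// -EFinB; apply: le_trans; rewrite lee_fin /g cy -/s lnM ?posrE//.
    set X := (2 * rho * cos t + rho ^+ 2)%R in c2.
    have cm : (-1 <= cos t <= 1)%R by rewrite cos_geN1 cos_le1.
    have Xle : (X <= 3 * rho)%R.
      have : (rho * cos t <= rho)%R by rewrite ger_pMr//; case/andP: cm.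
      have : (rho ^+ 2 <= rho)%R by rewrite expr2 ger_pMr//; lra.
      rewrite /X; lra.
    have X1 : (-1 < X)%R.
      have : (0 < c ^+ 2)%R by rewrite exprn_gt0.
      by rewrite c2; lra.
    (* The term [9 * rho^3] is [(3 * rho)^3 / 3]. *)
    have lnc : (2 * ln c <= X - X ^+ 2 / 2 + 9 * rho ^+ 3)%R.
      rewrite mulr_natl -lnXn// c2; apply: le_trans (ln1D_le X1) _.
      rewrite lerD2l.
      have : (X ^+ 3 <= (3 * rho) ^+ 3)%R.
        have [X0|X0] := leP 0%R X; first by rewrite lerXn2r// nnegrE mulr_ge0// ltW.
        apply: (@le_trans _ _ 0%R); last by rewrite exprn_ge0// mulr_ge0// ltW.
        by rewrite exprS mulr_le0_ge0 ?sqr_ge0// ltW.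
      by rewrite exprMn; lra.
    have := ler_wpM2l kk0 lnc; rewrite exprMn c2 /a /kk -/m /X; lra.
rewrite -[leRHS](fineK fzfin) lee_fin -/m leNgt => /negP; apply.
have r3 : (0 < rho ^+ 2)%R by rewrite exprn_gt0.
have h1 : (rho ^+ 2 * rho <= rho ^+ 2 * (eta * s ^+ 2 / 10))%R by rewrite ler_pM2l.
have h2 : (0 <= kk * rho ^+ 4)%R by rewrite mulr_ge0// exprn_ge0// ltW.
have h3 : (kk * rho ^+ 3 <= 2^-1 * rho ^+ 3)%R by rewrite ler_pM2r// exprn_gt0.
have h4 : (0 < eta * s ^+ 2 * rho ^+ 2)%R by apply: mulr_gt0 => //; apply: mulr_gt0 => //; exact: exprn_gt0.
rewrite /a; lra.
Qed.

End Annulus.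

(** * Plurisubharmonic functions in charts *)

Section Charts.
Context {R : realType} {n : nat} {M : ptopologicalType}.
Implicit Types c : chart R n M.

Lemma crangeK c p : is_chart c -> crange c p -> cmap c (cinv c p) = p.
Proof. by move=> [_ _ cK _ _] [z cz <-]; rewrite cK// inE. Qed.

Lemma cdom_cinv c p : is_chart c -> crange c p -> cdom c (cinv c p).
Proof. by move=> [_ _ cK _ _] [z cz <-]; rewrite cK// inE. Qed.

Lemma cdomK c z : is_chart c -> cdom c z -> cinv c (cmap c z) = z.
Proof. by move=> [_ _ cK _ _] cz; rewrite cK// inE. Qed.

Lemma crange_cmap c z : cdom c z -> crange c (cmap c z).
Proof. by move=> cz; exists z. Qed.

Lemma continuous_cmap c z : is_chart c -> cdom c z -> {for z, continuous (cmap c)}.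
Proof.
move=> [od _ _ + _] cz; rewrite continuous_open_subspace// => /(_ z); apply.
by rewrite inE.
Qed.

Lemma continuous_cinv c p : is_chart c -> crange c p -> {for p, continuous (cinv c)}.
Proof.
move=> [_ oR _ _ +] cp; rewrite continuous_open_subspace// => /(_ p); apply.
by rewrite inE.
Qed.

Local Open Scope ereal_scope.

(* For [f >= 0], extending by 0 keeps lower semicontinuity on all of C^n. *)
Definition chart_ext c (f : M -> \bar R) (p : 'rV[R[i]]_n) : \bar R :=
  if p \in crange c then f (cinv c p) else 0.

Lemma chart_extE c f p : crange c p -> chart_ext c f p = f (cinv c p).
Proof. by move=> cp; rewrite /chart_ext mem_set. Qed.

Lemma chart_ext_ge0 c f p : (forall z, 0 <= f z) -> 0 <= chart_ext c f p.
Proof. by move=> f0; rewrite /chart_ext; case: ifP. Qed.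

Lemma lsc_chart_ext c f : is_chart c -> (forall z, 0 <= f z) -> (forall z, lsc_at f z) ->
  forall p, lsc_at (chart_ext c f) p.
Proof.
move=> hc f0 lf p; have [_ oR _ _ _] := hc.
have [cp|ncp] := pselect (crange c p).
  apply: (@near_lsc_at _ _ (f \o cinv c)).
    by apply: filterS (open_nbhs_nbhs (conj oR cp)) => y cy; rewrite chart_extE.
  by apply: lsc_at_comp; [exact: continuous_cinv|exact: lf].
move=> q; rewrite /chart_ext memNset// => q0.
by apply: near_all => y; apply: lt_le_trans q0 _; exact: chart_ext_ge0.
Qed.

Lemma continuous_line (a b : 'rV[R[i]]_n) : continuous (fun x : R[i] => a + x *: b)%R.
Proof.
move=> x U /nbhs_enormP[e e0 eU]; apply/nbhs_cabsP.
(* Adding 1 covers the degenerate line [b = 0]. *)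
exists (e / (enorm b + 1))%R; first by rewrite divr_gt0// ltr_wpDl// enorm_ge0.
move=> y yx; apply: eU; rewrite addrAC opprD addrA subrr add0r addrC -scalerBl enormZ.
have b1 : (0 < enorm b + 1)%R by rewrite ltr_wpDl// enorm_ge0.
rewrite (le_lt_trans (y := cabs (y - x) * (enorm b + 1))%R)//.
  by rewrite ler_wpM2l ?cabs_ge0// lerDl.
by rewrite -ltr_pdivlMr.
Qed.

Lemma continuous_circle_line (a b : 'rV[R[i]]_n) : continuous (fun t : R => a + cis t *: b)%R.
Proof.
move=> t; apply: (@continuous_comp R R[i] _ cis (fun x => a + x *: b)%R t).
  exact: continuous_cis.
exact: continuous_line.
Qed.

Lemma enorm_basis (x : 'rV[R[i]]_n) : let B k := [set y | (enorm (y - x) < k.+1%:R^-1)%R] in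
  (forall U, nbhs x U -> exists N, forall k, (N <= k)%N -> B k `<=` U) /\
  (forall k, nbhs x (B k)).
Proof.
split=> [U /nbhs_enormP[e /invn_lt[N HN] eU]|k].
  by exists N => k Nk y /= yk; apply: eU; exact: lt_trans (HN k Nk).
by apply/nbhs_enormP; exists k.+1%:R^-1%R.
Qed.

Variable A : set (chart R n M).
Hypothesis hA : A `<=` @is_chart R n M.

Definition disc_in c (a b : 'rV[R[i]]_n) :=
  forall x : R[i], (cabs x <= 1)%R -> crange c (a + x *: b)%R.

(* [superh f] says that [- f] is a negative psh function. *)
Definition superh (f : M -> \bar R) := [/\ (forall z, 0 <= f z), (forall z, lsc_at f z) &
  forall c, A c -> forall a b, disc_in c a b ->
    avg (fun t => f (cinv c (a + cis t *: b)%R)) <= f (cinv c a)].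

Lemma disc_in_center c a b : disc_in c a b -> crange c a.
Proof. by move/(_ 0%R); rewrite cabs0 scale0r addr0; exact. Qed.

Lemma disc_in_circle c a b t : disc_in c a b -> crange c (a + cis t *: b)%R.
Proof. by move/(_ (cis t)); rewrite cabs_cis; exact. Qed.

(** Negation turns the possibly infinite means of the definition into integrals of nonnegative
    functions, for which monotonicity, Fatou and Tonelli require no integrability. *)
Lemma neg_pshP (u : M -> \bar R) : neg_psh A u <-> superh (fun z => - u z).
Proof.
have E (f : R -> \bar R) : (forall t, f t <= 0) ->
    ((2 * pi)^-1)%:E * \int[lebesgue_measure]_(t in `[0%R, (2 * pi)%R]) f t = - avg (fun t => - f t).
  move=> f0; rewrite /avg -muleN -integral_ge0N; last by move=> t _; rewrite oppe_ge0.
  by congr (_ * _); apply: eq_integral => t _; rewrite oppeK.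
split=> [[[_ lu uA] u0]|[u0 lu uA]].
  split=> [z|z|c cA a b ab]; first by rewrite oppe_ge0.
  - exact: (lower_semicontinuous_at _).1.
  - rewrite leeNr -E; last by move=> t; exact: u0.
    by apply: uA => // x; rewrite lec_cabs; exact: ab.
have u0' z : u z <= 0 by rewrite -oppe_ge0.
split => //; split.
- by move=> z; rewrite (le_lt_trans (u0' z)).
- exact/lower_semicontinuous_at.
- move=> c cA a b ab; rewrite (E (fun t => u (cinv c (a + cis t *: b)%R))) 1?leeNr; last by move=> t.
  by apply: uA => // x; rewrite -lec_cabs; exact: ab.
Qed.

Lemma measurable_circle f c a b : superh f -> A c -> disc_in c a b ->
  measurable_fun setT (fun t : R => f (cinv c (a + cis t *: b)%R)).
Proof.
move=> [f0 lf _] cA ab; rewrite (_ : (fun t => _) = chart_ext c f \o (fun t => a + cis t *: b)%R).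
  apply: lsc_measurable => t; apply: lsc_at_comp; first exact: continuous_circle_line.
  by apply: lsc_chart_ext => //; exact: hA.
by apply/funext => t /=; rewrite chart_extE//; exact: disc_in_circle.
Qed.

Lemma superh_cst (C : R) : (0 <= C)%R -> superh (cst C%:E).
Proof.
move=> C0; split=> [z|z q|c cA a b ab] //=.
  by move=> qC; exact: near_all.
by rewrite avg_cst.
Qed.

Lemma superhZ (k : R) f : (0 < k)%R -> superh f -> superh (fun z => k%:E * f z).
Proof.
move=> k0 sf; have [f0 lf fA] := sf; split=> [z|z q|c cA a b ab].
- by rewrite mule_ge0// lee_fin ltW.
- rewrite -lte_pdivrMl// -EFinM => /lf; apply: filterS => y.
  by rewrite EFinM lte_pdivrMl.
- rewrite avgZ ?(ltW k0)//; last exact: measurable_circle.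
  by apply: lee_wpmul2l; [rewrite lee_fin ltW|exact: fA].
Qed.

Lemma superhDc (C : R) f : (0 <= C)%R -> superh f -> superh (fun z => f z + C%:E).
Proof.
move=> C0 sf; have [f0 lf fA] := sf; split=> [z|z|c cA a b ab].
- by rewrite adde_ge0.
- by apply: lsc_atD => //; exact: cst_continuous.
- rewrite avgD//; last exact: measurable_circle.
  by rewrite avg_cst leeD2r//; exact: fA.
Qed.

Lemma superh_min f g : superh f -> superh g -> superh (fun z => mine (f z) (g z)).
Proof.
move=> sf sg; have [f0 lf fA] := sf; have [g0 lg gA] := sg; split=> [z|z q|c cA a b ab].
- by rewrite le_min f0 g0.
- rewrite lt_min => /andP[/lf qf /lg qg].
  by apply: filterS2 qf qg => y qfy qgy; rewrite lt_min qfy.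
- have mf := measurable_circle sf cA ab; have mg := measurable_circle sg cA ab.
  have mm : measurable_fun setT (fun t : R => mine (f (cinv c (a + cis t *: b)%R)) (g (cinv c (a + cis t *: b)%R))).
    exact: measurable_mine.
  rewrite le_min; apply/andP; split.
    apply: le_trans (fA c cA a b ab); apply: le_avg => // t; first by rewrite le_min f0 g0.
    by rewrite ge_min lexx.
  apply: le_trans (gA c cA a b ab); apply: le_avg => // t; first by rewrite le_min f0 g0.
  by rewrite ge_min lexx orbT.
Qed.

(** Near a point of the disc [v] agrees with a superharmonic function, whose mean value inequality
    applies to small circles on the complex line through [a] in direction [b]. *)
Lemma local_supermean_disc v c a b :
  (forall p : M, exists2 f, superh f & \forall z \near p, v z = f z) -> A c -> disc_in c a b ->
  local_supermean (fun x => chart_ext c v (a + x *: b)%R).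
Proof.
move=> vloc cA ab x x1; set p := (a + x *: b)%R.
have hc := hA cA; have [_ oR _ _ _] := hc.
have cp : crange c p by exact: ab.
have [f [_ _ fA] vf] := vloc (cinv c p).
have : \forall q \near p, crange c q /\ v (cinv c q) = f (cinv c q).
  by apply: filterS2 (open_nbhs_nbhs (conj oR cp)) (continuous_cinv hc cp vf).
move=> /nbhs_enormP[e e0 eP].
have b1 : (0 < enorm b + 1)%R by rewrite ltr_wpDl// enorm_ge0.
(* Half of the room is for the displacement of the centre and half for the radius of the circle. *)
exists (e / (2 * (enorm b + 1)))%R; first by rewrite divr_gt0// mulr_gt0.
move=> y d yx dd.
have H z : (cabs z <= 1)%R -> crange c (a + y *: b + z *: (d *: b))%R /\
    v (cinv c (a + y *: b + z *: (d *: b))%R) = f (cinv c (a + y *: b + z *: (d *: b))%R).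
  move=> z1; apply: eP.
  rewrite (_ : _ - p = (y - x + z * d) *: b)%R; last first.
    by apply/rowP => i; rewrite !mxE; ring.
  rewrite enormZ; apply: (@le_lt_trans _ _ (cabs (y - x + z * d) * (enorm b + 1))%R).
    by rewrite ler_wpM2l ?cabs_ge0// lerDl.
  rewrite -ltr_pdivlMr//; apply: le_lt_trans (ler_cabsD _ _) _.
  have zd : (cabs (z * d) <= cabs d)%R by rewrite cabsM ler_piMl ?cabs_ge0.
  have E : (e / (enorm b + 1) = e / (2 * (enorm b + 1)) + e / (2 * (enorm b + 1)))%R.
    by field; rewrite gt_eqF.
  by rewrite E ltrD// (le_lt_trans zd).
have [cy vy] : crange c (a + y *: b)%R /\ v (cinv c (a + y *: b)%R) = f (cinv c (a + y *: b)%R).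
  by have := H 0%R; rewrite cabs0 scale0r addr0; apply.
rewrite (chart_extE _ cy) vy.
rewrite (@eq_avg _ _ (fun t => f (cinv c (a + y *: b + cis t *: (d *: b))%R))).
  by apply: fA => // z z1; have [] := H z z1.
move=> t; have [] := H (cis t); first by rewrite cabs_cis.
rewrite scalerA -addrA -scalerDl => cyt vyt.
by rewrite chart_extE.
Qed.

(** Each disc in a chart is parametrized by the unit disc, which reduces the claim to
    [disc_supermean]. *)
Lemma superh_local (v : M -> \bar R) :
  (forall p : M, exists2 f, superh f & \forall z \near p, v z = f z) -> superh v.
Proof.
move=> vloc; have v0 z : 0 <= v z.
  by have [f [f0 _ _] /nbhs_singleton ->] := vloc z.
have lv z : lsc_at v z.
  have [f [_ lf _] vf] := vloc z; apply: near_lsc_at (lf z).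
  by apply: filterS vf => y ->.
split=> // c cA a b ab; have hc := hA cA.
pose f x := chart_ext c v (a + x *: b)%R.
have -> : v (cinv c a) = f 0%R by rewrite /f scale0r addr0 chart_extE//; exact: disc_in_center ab.
rewrite (@eq_avg _ _ (fun t => f (cis t))); last first.
  by move=> t; rewrite /f chart_extE//; exact: disc_in_circle.
apply: disc_supermean.
- by move=> x; exact: chart_ext_ge0.
- move=> x; apply: (@lsc_at_comp R R[i] _ (fun x => a + x *: b)%R (chart_ext c v)).
    exact: continuous_line.
  exact: lsc_chart_ext.
- exact: local_supermean_disc.
Qed.

End Charts.

(** * Lipschitz bound for a differentiable map at a point *)

Section DiffBound.
Context {R : realType} {n : nat}.
Implicit Types z : 'rV[R[i]]_n.

Lemma normr_le_enorm z : `|z| <= (enorm z)%:C%C.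
Proof.
have [z0|z0] := eqVneq (mx_norm z) 0.
  by rewrite {1}/Num.norm/= z0 lecR enorm_ge0.
have [[i j] /= zij] := mx_norm_neq0 z0.
by rewrite {1}/Num.norm/= zij cabsE lecR (ord1 i) cabs_le_enorm.
Qed.

Lemma enorm_le_normr z : enorm z <= n.+1%:R * complex.Re `|z|.
Proof.
have z0 : 0 <= complex.Re `|z|.
  by have := normr_ge0 z; rewrite lecE/= => /andP[].
have zi i : cabs (z ord0 i) <= complex.Re `|z|.
  have : `|z ord0 i| <= `|z|.
    rewrite [leRHS]/Num.norm/= mx_normE -[leLHS]nngE num_le.
    by apply: (le_trans _ (le_bigmax _ _ (ord0, i))).
  by rewrite lecE/= => /andP[].
rewrite -(@ler_pXn2r _ 2)// ?nnegrE ?mulr_ge0 ?enorm_ge0// sqr_enorm.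
apply: (@le_trans _ _ (\sum_(i < n) complex.Re `|z| ^+ 2)).
  by apply: ler_sum => i _; rewrite lerXn2r ?nnegrE ?cabs_ge0.
rewrite sumr_const card_ord exprMn -[leLHS]mulr_natl ler_wpM2r ?sqr_ge0//.
by rewrite -natrX ler_nat (@leq_trans (n.+1 ^ 1))// leq_pexp2l.
Qed.

(** The differential is a bounded linear map and the remainder is at most [|y - x|] near [x]; [n.+1]
    converts the sup norm into the Euclidean one. For a coordinate change this bounds the effect on
    [ln |z - w|] by a constant. *)
Lemma differentiable_bound (f : 'rV[R[i]]_n -> 'rV[R[i]]_n) (x : 'rV[R[i]]_n) :
  differentiable f x -> exists2 L : R, 0 < L &
    \forall y \near x, enorm (f y - f x) <= L * enorm (y - x).
Proof.
move=> df; have [cdf _] := (diff_locallyxP x f).1 df.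
have /eqaddoP H := diff_locally df.
have [B HB] : exists B : R[i], forall h, `|'d f x h| <= B * `|h|.
  have := (linear_boundedP _).1 ((linear_bounded_continuous _).2 cdf).
  by move=> /filter_ex.
have /H/nbhs_enormP[e e0 He] : 0 < 1 :> R[i] by [].
pose C := `|complex.Re B| + 1.
have C0 : 0 < C by rewrite ltr_wpDl.
exists (n.+1%:R * C); first by rewrite mulr_gt0.
apply/nbhs_enormP; exists e => // y yx.
have /= := He (y - x); rewrite subr0 => /(_ yx); rewrite mul1r !fctE/= subrK => yH.
apply: le_trans (enorm_le_normr _) _; rewrite -mulrA ler_pM2l//.
have ReM (u v : R[i]) : u <= v -> complex.Re u <= complex.Re v by rewrite lecE => /andP[].
set h := y - x in yH *; set r := f y - _ in yH.
have hE : complex.Re `|h| <= enorm h by have := ReM _ _ (normr_le_enorm h).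
have h0 : 0 <= complex.Re `|h| by have := ReM _ _ (normr_ge0 h).
have rh : complex.Re `|r| <= complex.Re `|h| by exact: ReM.
have dh : complex.Re `|'d f x h| <= complex.Re B * complex.Re `|h|.
  apply: le_trans (ReM _ _ (HB h)) _.
  have : complex.Im `|h| = 0 by have := normr_ge0 h; rewrite lecE/= => /andP[/eqP].
  by case: (B) (`|h|) => [a b] [c d] /= ->; rewrite mulr0 subr0.
have fE : f y - f x = 'd f x h + r.
  by rewrite /r; apply/rowP => i; rewrite !mxE; ring.
have : complex.Re `|f y - f x| <= complex.Re `|'d f x h| + complex.Re `|r|.
  by rewrite -raddfD; apply: ReM; rewrite fE ler_normD.
have BC : complex.Re B * complex.Re `|h| <= `|complex.Re B| * complex.Re `|h|.
  by rewrite ler_wpM2r// ler_norm.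
have : C * complex.Re `|h| <= C * enorm h by rewrite ler_pM2l.
rewrite /C; lra.
Qed.

End DiffBound.

Lemma continuous_enormB (R : realType) (n : nat) (z : 'rV[R[i]]_n) :
  continuous (fun p : 'rV[R[i]]_n => enorm (p - z)).
Proof.
move=> p U /nbhs_ballP[e /= e0 eU]; apply/nbhs_enormP; exists e => // y /= H.
apply: eU; rewrite /ball/=.
have h1 := enorm_triangle p y z; have h2 := enorm_triangle y p z.
rewrite (enormB p y) in h1.
rewrite ltr_norml; lra.
Qed.

(** * Green functions *)

Section Green.
Context {R : realType} {n : nat} {M : ptopologicalType}.
Variable A : set (chart R n M).
Hypothesis mA : complex_manifold A.
Local Open Scope ereal_scope.

Lemma atlas_chart : A `<=` @is_chart R n M.
Proof. by have [_ _ []] := mA. Qed.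

Lemma chart_at (w : M) : exists2 c, A c & cdom c w.
Proof.
have [_ _ [_ cov _ _]] := mA.
have [c cA cw] : (\bigcup_(c in A) cdom c) w by rewrite cov.
by exists c.
Qed.

Lemma chart_ball c w : A c -> cdom c w -> exists2 r : R, (0 < r)%R &
  forall p, (enorm (p - cmap c w) <= r)%R -> crange c p.
Proof.
move=> cA cw; have [_ oR _ _ _] := atlas_chart cA.
have /nbhs_enormP[e e0 eP] := open_nbhs_nbhs (conj oR (crange_cmap cw)).
exists (e / 2)%R; first by rewrite divr_gt0.
by move=> p pe; apply: eP; lra.
Qed.

(** The closed disc is compact and the range open, so all small translates of the disc stay in the
    range. *)
Lemma near_disc_in (c : chart R n M) (a b : 'rV[R[i]]_n) : is_chart c -> disc_in c a b -> \forall p \near a, disc_in c p b.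
Proof.
move=> hc ab; have [_ oR _ _ _] := hc.
have b1 : (0 < enorm b + 1)%R by rewrite ltr_wpDl// enorm_ge0.
apply: ((compact_near_coveringP _).1 (@compact_cdisc R 1) _ (nbhs a)
  (fun p x => crange c (p + x *: b)%R)) => x x1.
have /nbhs_enormP[e e0 eP] := open_nbhs_nbhs (conj oR (ab x x1)).
exists ([set x' | cabs (x' - x) < e / 2 / (enorm b + 1)]%R, [set p | enorm (p - a) < e / 2]%R).
  split => /=; [apply/nbhs_cabsP|apply/nbhs_enormP]; eexists; [|by move=> y; exact| |by move=> y; exact].
    by rewrite !divr_gt0.
  by rewrite divr_gt0.
move=> [x' p] [/= xx' pa]; apply: eP.
have -> : (p + x' *: b - (a + x *: b) = (p - a) + (x' - x) *: b)%R.
  by apply/rowP => i; rewrite !mxE; ring.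
apply: le_lt_trans (ler_enormD _ _) _; rewrite enormZ [ltRHS]splitr ltr_leD//.
rewrite ltr_pdivlMr// in xx'.
apply: le_trans (ltW xx'); by rewrite ler_wpM2l ?cabs_ge0// lerDl.
Qed.

(** The lower semicontinuous regularization of [h]. The neighbourhoods contain [z] itself, so the
    result lies below [h]. *)
Definition lsc_reg (h : M -> \bar R) (z : M) : \bar R :=
  ereal_sup [set ereal_inf (h @` U) | U in nbhs z].

Lemma lsc_reg_le h z : lsc_reg h z <= h z.
Proof.
apply: ge_ereal_sup => _ [U zU <-]; apply: ereal_inf_lbound.
by exists z => //; exact: nbhs_singleton.
Qed.

Lemma lsc_reg_ge (h : M -> \bar R) z x : (\forall y \near z, x <= h y) -> x <= lsc_reg h z.
Proof.
move=> xh; apply: le_trans (ereal_sup_ubound _); last by exists [set y | x <= h y].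
by apply: le_ereal_inf_tmp => _ [y ? <-].
Qed.

Lemma lsc_at_lsc_reg h z : lsc_at (lsc_reg h) z.
Proof.
move=> q /ereal_sup_gt[_ [U zU <-] qU]; apply: filterS (nbhs_interior zU) => y yU.
by apply: lt_le_trans qU _; apply: ereal_sup_ubound; exists U.
Qed.

(** For every [f] in [F] the circle mean of [g] is at most that of [f], hence at most [f] at the
    centre; so it is at most [h] at the centre. The mean of [g] is lower semicontinuous in the
    centre by Fatou, and therefore also lies below the regularization [g] of [h]. *)
Lemma superh_lsc_reg_inf (F : set (M -> \bar R)) : (forall f, F f -> superh A f) ->
  superh A (lsc_reg (fun z => ereal_inf [set f z | f in F])).
Proof.
move=> sF; set h := fun z => _; set g := lsc_reg h.
have h0 z : 0 <= h z.
  by apply: le_ereal_inf_tmp => _ [f Ff <-]; have [+ _ _] := sF f Ff.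
have g0 z : 0 <= g z by apply: lsc_reg_ge; exact: near_all.
have lg z : lsc_at g z by exact: lsc_at_lsc_reg.
have gF f z : F f -> g z <= f z.
  by move=> Ff; apply: le_trans (lsc_reg_le h z) _; apply: ereal_inf_lbound; exists f.
split=> // c cA a b ab; have hc := atlas_chart cA.
have ca := disc_in_center ab.
rewrite leNgt; apply/negP => /ereal_between[q /andP[gq qavg]].
have [B1 B2] := enorm_basis a.
pose G (p : 'rV[R[i]]_n) := avg (fun t : R => chart_ext c g (p + cis t *: b)%R).
have lG : lsc_at G a.
  apply: (@lsc_at_avg _ _ a _ (fun p t => chart_ext c g (p + cis t *: b)%R) B1 B2).
  - by move=> y t; exact: chart_ext_ge0.
  - apply: near_all => p; apply: lsc_measurable => t.
    apply: (@lsc_at_comp _ _ _ (fun t => p + cis t *: b)%R (chart_ext c g)); first exact: continuous_circle_line.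
    exact: lsc_chart_ext.
  - move=> t; apply: (@lsc_at_comp _ 'rV[R[i]]_n 'rV[R[i]]_n (fun p => p + cis t *: b)%R (chart_ext c g)).
      move=> U /nbhs_enormP[e e0 eU]; apply/nbhs_enormP; exists e => // y ya; apply: eU.
      by rewrite (_ : _ - _ = y - a)%R//; apply/rowP => i; rewrite !mxE; ring.
    exact: lsc_chart_ext.
have GE p : disc_in c p b -> G p = avg (fun t => g (cinv c (p + cis t *: b)%R)).
  by move=> pb; apply: eq_avg => t; rewrite chart_extE//; exact: disc_in_circle.
have qG : q%:E < G a by rewrite GE.
have H : \forall p \near a, q%:E < G p /\ disc_in c p b.
  by apply: filterS2 (lG q qG) (near_disc_in hc ab) => p; split.
have cz : cdom c (cinv c a) by exact: cdom_cinv.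
have od : open (cdom c) by have [] := hc.
have H' : \forall z \near cinv c a, cdom c z /\ (q%:E < G (cmap c z) /\ disc_in c (cmap c z) b).
  have H2 : \forall z \near cinv c a, q%:E < G (cmap c z) /\ disc_in c (cmap c z) b.
    have H0 : nbhs (cmap c (cinv c a)) (fun p => q%:E < G p /\ disc_in c p b).
      by rewrite crangeK.
    exact: (continuous_cmap hc cz H0).
  exact: filterI (open_nbhs_nbhs (conj od cz)) H2.
have : q%:E <= g (cinv c a).
  apply: lsc_reg_ge; apply: filterS H' => z [cz' [qz zb]].
  apply: le_ereal_inf_tmp => _ [f Ff <-]; apply: le_trans (ltW qz) _; rewrite GE//.
  have sf := sF f Ff; have [f0 _ fA] := sf.
  rewrite -[in leRHS](cdomK hc cz').
  apply: le_trans (fA c cA _ _ zb); apply: le_avg => [t|||t] //.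
  - rewrite (_ : (fun t => _) = chart_ext c g \o (fun t => cmap c z + cis t *: b)%R).
      apply: lsc_measurable => t; apply: lsc_at_comp; first exact: continuous_circle_line.
      exact: lsc_chart_ext.
    by apply/funext => t /=; rewrite chart_extE//; exact: disc_in_circle.
  - exact: (measurable_circle atlas_chart sf cA zb).
  - exact: gF.
by rewrite leNgt gq.
Qed.

Lemma cmap_inj c z w : A c -> cdom c z -> cdom c w -> cmap c z = cmap c w -> z = w.
Proof.
by move=> cA cz cw zw; rewrite -(cdomK (atlas_chart cA) cz) zw (cdomK (atlas_chart cA) cw).
Qed.

Lemma log_pole_chart (u : M -> \bar R) (w : M) c : A c -> cdom c w -> log_pole A u w ->
  exists K : R, \forall z \near w, z != w ->
    cdom c z /\ u z <= (ln (enorm (cmap c z - cmap c w)) + K)%:E.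
Proof.
move=> cA cw [c' [c'A c'w] [K]]; rewrite near_withinE => uK.
have hc := atlas_chart cA; have hc' := atlas_chart c'A.
have [_ _ [_ _ compat _]] := mA.
have /differentiable_bound[L L0 HL] : differentiable (cmap c' \o cinv c) (cmap c w).
  by apply: (compat c c' cA c'A); exists w.
have od : open (cdom c) by have [] := hc.
have od' : open (cdom c') by have [] := hc'.
exists (ln L + K)%R.
have HL' := continuous_cmap hc cw HL.
apply: filterS2 (filterI uK HL') (filterI (open_nbhs_nbhs (conj od cw)) (open_nbhs_nbhs (conj od' c'w))).
move=> z [/= uz Lz] [cz c'z] zw; split => //; apply: le_trans (uz zw) _.
rewrite /= !(cdomK hc)// in Lz.
have p0 : (0 < enorm (cmap c z - cmap c w))%R.
  by rewrite enorm_gt0 subr_eq0; apply: contra_neq zw; exact: cmap_inj.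
have p'0 : (0 < enorm (cmap c' z - cmap c' w))%R.
  by rewrite enorm_gt0 subr_eq0; apply: contra_neq zw; exact: cmap_inj.
rewrite lee_fin addrA lerD2r addrC -lnM ?posrE// ler_ln ?posrE ?mulr_gt0//.
Qed.

Lemma log_pole_near (u : M -> \bar R) (w : M) c (K : R) : A c -> cdom c w ->
  (\forall z \near w, z != w -> u z <= (ln (enorm (cmap c z - cmap c w)) + K)%:E) ->
  log_pole A u w.
Proof. by move=> cA cw H; exists c => //; exists K; rewrite near_withinE. Qed.

(* The maximum principle on complex lines through [w] gives a bound independent
   of the function. *)
Lemma log_pole_le (u : M -> \bar R) (w : M) c (r : R) : A c -> cdom c w -> (0 < r)%R ->
  (forall p, (enorm (p - cmap c w) <= r)%R -> crange c p) ->
  neg_psh A u -> log_pole A u w ->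
  forall z, cdom c z -> (0 < enorm (cmap c z - cmap c w) <= r)%R ->
    u z <= (ln (enorm (cmap c z - cmap c w) / r))%:E.
Proof.
move=> cA cw r0 cr /neg_pshP su /(log_pole_chart cA cw)[K uK] z cz /andP[z0 zr].
have hc := atlas_chart cA; have [u0 lu uA] := su.
set p0 := cmap c w; set s := enorm _ in z0 zr *.
(* The direction from [p0] to [z], rescaled to length [r]: the unit disc is mapped into the ball of
   radius [r], and [z] has parameter [s / r]. *)
pose b := ((r / s)%:C%C *: (cmap c z - p0))%R.
have nb : enorm b = r.
  rewrite enormZ cabs_real -/s gtr0_norm ?divr_gt0//; field; by rewrite gt_eqF.
have bin : disc_in c p0 b.
  move=> x x1; apply: cr; rewrite addrAC subrr add0r enormZ nb.
  by rewrite ler_piMl// ltW.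
pose f x := chart_ext c (fun z => - u z) (p0 + x *: b)%R.
have /nbhs_enormP[e e0 He] : \forall p \near p0, p != p0 -> crange c p ->
    (- ln (enorm (p - p0)) - K)%:E <= - u (cinv c p).
  have : nbhs (cinv c p0) [set y | y != w -> cdom c y /\ u y <= (ln (enorm (cmap c y - cmap c w)) + K)%:E].
    by rewrite cdomK.
  move=> H1.
  have H2 : \forall p \near p0, cinv c p != w -> cdom c (cinv c p) /\
      u (cinv c p) <= (ln (enorm (cmap c (cinv c p) - cmap c w)) + K)%:E.
    exact: (continuous_cinv hc (crange_cmap cw) H1).
  apply: filterS H2 => p /= H pp0 cp.
  have /H[_] : cinv c p != w.
    by apply: contra_neq pp0 => cpw; rewrite -(crangeK hc cp) cpw.
  by rewrite crangeK// -opprD EFinN leeN2.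
(* The parameter [x] stands for a point at distance [|x| * r] from [p0]; hence the shift of the
   constant by [ln r] and the radius [e / r]. *)
have := @annulus_supermean R f (K + ln r)%R (Num.min (e / r) 1)%R.
have -> : (ln (s / r) = - - ln (cabs (s / r)%:C%C))%R.
  by rewrite cabs_real opprK gtr0_norm// divr_gt0.
move=> H; rewrite EFinN leeNr.
have E : (p0 + (s / r)%:C%C *: b = cmap c z)%R.
  rewrite scalerA -rmorphM/= (_ : s / r * (r / s) = 1)%R; last by field; rewrite !gt_eqF.
  by rewrite scale1r addrC subrK.
have <- : f (s / r)%:C%C = - u z.
  by rewrite /f E chart_extE ?(cdomK hc)//; exact: crange_cmap.
apply: H.
- by move=> x; exact: chart_ext_ge0.
- move=> x; apply: (@lsc_at_comp R R[i] _ (fun x => p0 + x *: b)%R (chart_ext c _)).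
    exact: continuous_line.
  exact: lsc_chart_ext.
- apply: (local_supermean_disc atlas_chart) => // p; exists (fun z => - u z) => //.
  exact: near_all.
- by rewrite lt_min divr_gt0/=.
- move=> x; rewrite lt_min => /and3P[x0 xe /ltW x1].
  have xb : enorm (p0 + x *: b - p0)%R = (cabs x * r)%R by rewrite addrAC subrr add0r enormZ nb.
  have cx := bin x x1.
  rewrite /f chart_extE//; apply: le_trans (He _ _ _ cx).
  + by rewrite xb lnM ?posrE// lee_fin; lra.
  + by rewrite xb -ltr_pdivlMr.
  + by rewrite -subr_eq0 -enorm_eq0 xb mulf_neq0 ?gt_eqF.
- rewrite cabs_real gtr0_norm ?divr_gt0//= ler_pdivrMr// mul1r//.
Qed.

Lemma green_le (w : M) c (r : R) : A c -> cdom c w -> (0 < r)%R ->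
  (forall p, (enorm (p - cmap c w) <= r)%R -> crange c p) ->
  forall z, cdom c z -> (0 < enorm (cmap c z - cmap c w) <= r)%R ->
    green A z w <= (ln (enorm (cmap c z - cmap c w) / r))%:E.
Proof.
move=> cA cw r0 cr z cz zr; apply: ge_ereal_sup => _ [u [un uw] <-].
exact: (log_pole_le cA cw r0 cr un uw cz zr).
Qed.

(* By the uniform bound [green_le], minus the regularized infimum of the family
   [- u] still has a logarithmic pole at [w], so it is itself a competitor and
   equals [green]. *)
Lemma neg_psh_green (w : M) :
  neg_psh A (fun z => green A z w) /\ log_pole A (fun z => green A z w) w.
Proof.
pose S := [set u | neg_psh A u /\ log_pole A u w].
pose F := [set (fun z => - u z) | u in S].
pose h z := ereal_inf [set f z | f in F].
have hE z : h z = - green A z w.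
  rewrite /h /green /ereal_inf; congr (- ereal_sup _); apply/seteqP; split.
    by move=> _ [_ [_ [u Su <-] <-] <-]; exists u => //; rewrite oppeK.
  move=> _ [u Su <-]; exists (- u z); last by rewrite oppeK.
  by exists (fun z => - u z) => //; exists u.
have sg : superh A (lsc_reg h).
  by apply: superh_lsc_reg_inf => _ [u [un _] <-]; exact/neg_pshP.
have [c cA cw] := chart_at w; have [r r0 cr] := chart_ball cA cw.
have hc := atlas_chart cA; have od : open (cdom c) by have [] := hc.
pose l z := enorm (cmap c z - cmap c w).
have cl z : cdom c z -> {for z, continuous l}.
  move=> cz.
  exact: (continuous_comp (continuous_cmap hc cz) (@continuous_enormB _ _ (cmap c w) _)).
have [gn gl] : neg_psh A (fun z => - lsc_reg h z) /\ log_pole A (fun z => - lsc_reg h z) w.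
  split; first by apply/neg_pshP; rewrite (_ : (fun z => _) = lsc_reg h)//; apply/funext => z; rewrite oppeK.
  apply: (@log_pole_near _ _ c (- ln r)%R) => //.
  have lw : \forall z \near w, (l z < r)%R.
    have l0 : (l w < r)%R by rewrite /l subrr enorm0.
    exact: (cvgr_lt (l w) (cl w cw) r l0).
  apply: filterS2 (open_nbhs_nbhs (conj od cw)) lw => z cz lz zw.
  have lz0 : (0 < l z)%R.
    by rewrite enorm_gt0 subr_eq0; apply: contra_neq zw; exact: cmap_inj.
  rewrite leeNl -EFinN opprD opprK -/(l z) leNgt; apply/negP => /ereal_between[q /andP[gq]].
  rewrite lte_fin => ql.
  (* In this form [q < ln r - ln (l z)] is visibly an open condition; wherever it holds near [z],
     the uniform bound gives [h >= q], and so the regularization is at least [q] at [z]. *)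
  have lE : (l z < expR (ln r - q))%R.
    rewrite -[ltLHS]lnK ?posrE// ltr_expR; lra.
  have : q%:E <= lsc_reg h z.
    apply: lsc_reg_ge.
    have H1 := open_nbhs_nbhs (conj od cz).
    have H2 : \forall y \near z, (l y < expR (ln r - q))%R by exact: (cvgr_lt (l z) (cl z cz) _ lE).
    have H3 : \forall y \near z, (l y < r)%R by exact: (cvgr_lt (l z) (cl z cz) _ lz).
    have H4 : \forall y \near z, (0 < l y)%R by exact: (cvgr_gt (l z) (cl z cz) _ lz0).
    apply: filterS (filterI (filterI H1 H2) (filterI H3 H4)) => y [[/= cy yE] [/= yr y0]].
    rewrite hE leeNr -EFinN; apply: le_trans (green_le cA cw r0 cr cy _) _.
      by rewrite -/(l y) y0 ltW.
    rewrite -/(l y) lee_fin ln_div ?posrE// lerBlDr -[leRHS]expRK ler_ln ?posrE ?expR_gt0// ltW//.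
    by rewrite addrC.
  by rewrite leNgt gq.
have E : (fun z => green A z w) = (fun z => - lsc_reg h z).
  apply/funext => z; apply/eqP; rewrite eq_le; apply/andP; split.
    by rewrite leeNr -hE lsc_reg_le.
  by apply: ereal_sup_ubound; exists (fun z => - lsc_reg h z) => //; split.
by rewrite E; split.
Qed.

End Green.

(** * Gluing, and comparison of Green functions with nearby poles *)

Section Compare.
Context {R : realType} {n : nat} {M : ptopologicalType}.
Variable A : set (chart R n M).
Hypothesis mA : complex_manifold A.

Definition chart_cball (c : chart R n M) (p : 'rV[R[i]]_n) (r : R) : set M :=
  [set z | cdom c z /\ enorm (cmap c z - p) <= r].

Definition chart_oball (c : chart R n M) (p : 'rV[R[i]]_n) (r : R) : set M :=
  [set z | cdom c z /\ enorm (cmap c z - p) < r].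

Lemma continuous_dist c p z : A c -> cdom c z ->
  {for z, continuous (fun z => enorm (cmap c z - p))}.
Proof.
move=> /(atlas_chart mA) hc cz.
exact: (continuous_comp (continuous_cmap hc cz) (@continuous_enormB _ _ p _)).
Qed.

Lemma open_cdom c : A c -> open (cdom c).
Proof. by move=> /(atlas_chart mA)[]. Qed.

Lemma near_cdom c z : A c -> cdom c z -> \forall y \near z, cdom c y.
Proof. by move=> cA cz; exact: (open_nbhs_nbhs (conj (open_cdom cA) cz)). Qed.

Lemma near_dist_lt c p z (r : R) : A c -> cdom c z -> enorm (cmap c z - p) < r ->
  \forall y \near z, cdom c y /\ enorm (cmap c y - p) < r.
Proof.
move=> cA cz zr.
have H : \forall y \near z, enorm (cmap c y - p) < r.
  pose l y := enorm (cmap c y - p).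
  have cl : {for z, continuous l} by exact: continuous_dist.
  by exact: (cvgr_lt (l z) cl r zr).
exact: filterI (near_cdom cA cz) H.
Qed.

Lemma near_dist_gt c p z (r : R) : A c -> cdom c z -> r < enorm (cmap c z - p) ->
  \forall y \near z, cdom c y /\ r < enorm (cmap c y - p).
Proof.
move=> cA cz zr.
have H : \forall y \near z, r < enorm (cmap c y - p).
  pose l y := enorm (cmap c y - p).
  have cl : {for z, continuous l} by exact: continuous_dist.
  by exact: (cvgr_gt (l z) cl r zr).
exact: filterI (near_cdom cA cz) H.
Qed.

Lemma open_chart_oball c p r : A c -> open (chart_oball c p r).
Proof.
by move=> cA; rewrite openE => z [cz zr]; exact: near_dist_lt.
Qed.

(** Closed in [M], and not just in the domain of the chart, as the image of a compact ball in a
    Hausdorff space. *)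
Lemma closed_chart_cball c p r : A c -> (forall q, enorm (q - p) <= r -> crange c q) ->
  closed (chart_cball c p r).
Proof.
move=> cA cr; have hc := atlas_chart mA cA; have [hM _ _] := mA.
apply: compact_closed => //.
have -> : chart_cball c p r = cinv c @` [set q | enorm (q - p) <= r].
  apply/seteqP; split=> [z [cz zr]|_ [q /= qr <-]].
    by exists (cmap c z) => //; exact: cdomK.
  by split; [exact: cdom_cinv (cr q qr)|rewrite (crangeK hc (cr q qr))].
apply: continuous_compact; last exact: compact_enorm_ball.
have [_ _ _ _ +] := hc; apply: continuous_subspaceW => q /= qr; exact: cr.
Qed.

Lemma enorm_sub_ge (x y z : 'rV[R[i]]_n) : enorm (x - z) - enorm (y - z) <= enorm (x - y).
Proof. by rewrite lerBlDr; exact: enorm_triangle. Qed.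

Local Open Scope ereal_scope.

(** [O] and the complement of [B] form an open cover; the glued function equals [f] on the one and
    [g] on the other, so locality of superharmonicity applies. *)
Lemma superh_glue (O B : set M) (f g : M -> \bar R) : open O -> closed B -> B `<=` O ->
  superh A f -> superh A g -> (forall z, O z -> ~ B z -> f z = g z) ->
  superh A (fun z => if z \in B then f z else g z).
Proof.
move=> oO cB BO sf sg fg; apply: (superh_local (atlas_chart mA)) => p.
have [Op|nOp] := pselect (O p).
  exists f => //; apply: filterS (open_nbhs_nbhs (conj oO Op)) => z Oz.
  by case: ifPn => // /negP; rewrite in_setE => nB; rewrite fg.
exists g => //; have nBp : (~` B) p by move=> /BO.
have oB : open (~` B) by exact: closed_openC.
apply: filterS (open_nbhs_nbhs (conj oB nBp)) => z nBz.
by rewrite memNset.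
Qed.

Lemma superh_green w : superh A (fun z => - green A z w).
Proof. by apply/neg_pshP; have [] := neg_psh_green mA w. Qed.

Lemma green_le0 z w : green A z w <= 0.
Proof. by have [[_ +] _] := neg_psh_green mA w; exact. Qed.

Lemma green_max (v : M -> \bar R) w z : superh A v -> log_pole A (fun z => - v z) w ->
  - green A z w <= v z.
Proof.
move=> sv pv; rewrite leeNl; apply: ereal_sup_ubound; exists (fun z => - v z) => //.
by split => //; apply/neg_pshP; rewrite (_ : (fun z => _) = v)//; apply/funext => y; rewrite oppeK.
Qed.

Lemma near_log_pole (u v : M -> \bar R) w : (\forall z \near w, v z <= u z) ->
  log_pole A u w -> log_pole A v w.
Proof.
move=> vu [c [cA cw] [K]]; rewrite near_withinE => uK; exists c => //; exists K.
rewrite near_withinE; apply: filterS2 vu uK => z vz uz zw.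
exact: le_trans vz (uz zw).
Qed.

(* On the annulus around [p0] the function [(1 + d) (- green z w)] is the larger
   one near the inner sphere and [- green z w' + C] is the larger one near the
   outer sphere, so the two can be glued into a competitor for [green z w']. *)
Lemma green_compare c (p0 : 'rV[R[i]]_n) (K r1 : R) : A c -> (0 < r1)%R ->
  (forall q, (enorm (q - p0) <= 2 * r1)%R -> crange c q) ->
  (forall w z, cdom c w -> (enorm (cmap c w - p0) < r1)%R -> cdom c z -> z != w ->
    (ln (enorm (cmap c z - cmap c w)) + K)%:E <= green A z w) ->
  forall d rho : R, (0 < d)%R -> (0 < rho)%R ->
  exists2 s : R, (0 < s)%R & forall w w', chart_oball c p0 s w -> chart_oball c p0 s w' ->
    forall z, ~ chart_cball c p0 rho z -> - green A z w' <= (1 + d)%:E * (- green A z w).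
Proof.
move=> cA r10 cr gK d rho d0 rho0.
have d1 : (0 < 1 + d)%R by lra.
pose r2 := Num.min rho (r1 / 2)%R.
have r20 : (0 < r2)%R by rewrite lt_min rho0 divr_gt0.
have r2rho : (r2 <= rho)%R by rewrite ge_min lexx.
have r2r1 : (r2 <= r1 / 2)%R by rewrite ge_min lexx orbT.
clearbody r2.
(* Where [r2 / 2 < |z - p0| < r2] one has [|z - w| >= r2 / 4], so the lower bound on [green] gives
   [f1 <= C <= f2] there. *)
pose C := Num.max 0%R ((1 + d) * (- ln (r2 / 4) - K))%R.
have C0 : (0 <= C)%R by rewrite le_max lexx.
have CE : ((1 + d) * (- ln (r2 / 4) - K) <= C)%R by rewrite le_max lexx orbT.
clearbody C.
(* [Y <= d * - ln s1] is the inequality [f2 <= f1] for [s1 < |z - p0| < 2 * s1], once [- green z w']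
   is bounded by [- ln (s1 / 2) - K] and [- green z w] from below by [- ln (4 * s1 / r1)]. *)
pose Y := (ln 2 - K + C + (1 + d) * (ln 4 - ln r1))%R.
pose s1 := Num.min (r2 / 16)%R (expR (- (Y / d))).
have s10 : (0 < s1)%R by rewrite lt_min divr_gt0//= expR_gt0.
have s1r2 : (s1 <= r2 / 16)%R by rewrite ge_min lexx.
have s1Y : (Y <= d * - ln s1)%R.
  rewrite mulrN -lerN2 opprK -ler_pdivlMl// mulrN (mulrC _ Y) -[leRHS]expRK.
  by rewrite ler_ln ?posrE ?expR_gt0// ge_min lexx orbT.
clearbody s1.
exists (s1 / 2)%R; first by rewrite divr_gt0.
move=> w w' [cw ws] [cw' ws'].
pose f1 z := (1 + d)%:E * (- green A z w).
pose f2 z := - green A z w' + C%:E.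
have sf1 : superh A f1 by apply: superhZ => //; [exact: atlas_chart|exact: superh_green].
have sf2 : superh A f2 by apply: superhDc => //; [exact: atlas_chart|exact: superh_green].
have sm : superh A (fun z => mine (f1 z) (f2 z)) by apply: superh_min => //; exact: atlas_chart.
have wr1 : (enorm (cmap c w - p0) < r1)%R by lra.
have w'r1 : (enorm (cmap c w' - p0) < r1)%R by lra.
have crr q : (enorm (q - p0) <= r2)%R -> crange c q by move=> h; apply: cr; lra.
(* The competitor is [f2] in the inner ball, [mine f1 f2] up to radius [r2 / 2] and [f1] beyond; by
   the choice of [C] and [s1] the minimum equals [f2] just outside the inner sphere and [f1] just
   outside the outer one. *)
pose v1 z := if z \in chart_cball c p0 s1 then f2 z else mine (f1 z) (f2 z).
have sv1 : superh A v1.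
  apply: (@superh_glue (chart_oball c p0 (2 * s1))) => //.
  - exact: open_chart_oball.
  - by apply: closed_chart_cball => // q h; apply: crr; lra.
  - by move=> z [cz zs]; split => //; lra.
  - move=> z [cz zs] nz; have {nz}sz : (s1 < enorm (cmap c z - p0))%R.
      by rewrite ltNge; apply/negP => h; apply: nz.
    apply/esym/min_idPr.
    have zw1 := enorm_triangle (cmap c z) p0 (cmap c w).
    rewrite (enormB p0) in zw1.
    have zw2 := enorm_sub_ge (cmap c z) (cmap c w) p0.
    have zw2' := enorm_sub_ge (cmap c z) (cmap c w') p0.
    have h1 : - green A z w' <= (- ln (s1 / 2) - K)%:E.
      have zw' : z != w' by apply/eqP => zw'; rewrite zw' in sz; lra.
      apply: (@le_trans _ _ (- (ln (enorm (cmap c z - cmap c w')) + K)%:E)).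
        by rewrite leeN2; exact: gK.
      rewrite -EFinN lee_fin opprD lerD2r lerN2 ler_ln ?posrE ?divr_gt0//; lra.
    have h2 : (- ln (4 * s1 / r1))%:E <= - green A z w.
      rewrite EFinN leeN2; apply: le_trans (green_le mA cA cw r10 _ cz _) _.
      (* The ball of radius [2 * r1] about [p0] contains the ball of radius [r1] about [w], to which
         the upper bound refers. *)
      - move=> q qw; apply: cr; have := enorm_triangle q (cmap c w) p0; lra.
      - lra.
      - rewrite lee_fin ler_ln ?posrE ?divr_gt0 ?mulr_gt0//; last lra.
        by rewrite ler_pM2r ?invr_gt0//; lra.
    apply: (@le_trans _ _ ((- ln (s1 / 2) - K) + C)%:E); first by rewrite EFinD leeD2r.
    apply: (@le_trans _ _ ((1 + d) * (- ln (4 * s1 / r1)))%:E).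
      rewrite lee_fin !ln_div ?posrE ?mulr_gt0// lnM ?posrE//.
      move: s1Y; rewrite /Y; lra.
    by rewrite EFinM lee_wpmul2l// lee_fin ltW.
pose v z := if z \in chart_cball c p0 (r2 / 2) then v1 z else f1 z.
have sv : superh A v.
  apply: (@superh_glue (chart_oball c p0 r2)) => //.
  - exact: open_chart_oball.
  - by apply: closed_chart_cball => // q h; apply: crr; lra.
  - by move=> z [cz zs]; split => //; lra.
  - move=> z [cz zs] nz; have {nz}sz : (r2 / 2 < enorm (cmap c z - p0))%R.
      by rewrite ltNge; apply/negP => h; apply: nz.
    rewrite /v1 memNset; last by move=> [_]; lra.
    apply/min_idPl.
    have zw2 := enorm_sub_ge (cmap c z) (cmap c w) p0.
    have zw : z != w by apply/eqP => zw; rewrite zw in sz; lra.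
    have h1 : - green A z w <= (- ln (r2 / 4) - K)%:E.
      apply: (@le_trans _ _ (- (ln (enorm (cmap c z - cmap c w)) + K)%:E)).
        by rewrite leeN2; exact: gK.
      rewrite -EFinN lee_fin opprD lerD2r lerN2 ler_ln ?posrE ?divr_gt0//; lra.
    apply: (@le_trans _ _ ((1 + d) * (- ln (r2 / 4) - K))%:E).
      by rewrite EFinM lee_wpmul2l// lee_fin ltW.
    apply: (@le_trans _ _ C%:E); first by rewrite lee_fin.
    by rewrite /f2 leeDr// oppe_ge0 green_le0.
(* Near [w'] the function [v] is [f2], which dominates [- green z w'] because [C >= 0]. *)
have pv : log_pole A (fun z => - v z) w'.
  have [_] := neg_psh_green mA w'; apply: near_log_pole.
  have : (enorm (cmap c w' - p0) < s1)%R by lra.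
  move=> /(near_dist_lt cA cw'); apply: filterS => z [cz zs].
  rewrite /v mem_set; last by split => //; lra.
  rewrite /v1 mem_set; last by split => //; lra.
  by rewrite /f2 leeNl leeDl.
move=> z nz; apply: le_trans (green_max z sv pv) _.
rewrite /v memNset// => -[cz zr]; apply: nz; split => //; lra.
Qed.

End Compare.

(** * Green functions with distinct poles are not proportional *)

Section Separation.
Context {R : realType} {n : nat} {M : ptopologicalType}.
Variable A : set (chart R n M).
Hypothesis mA : complex_manifold A.
Hypothesis n_gt0 : (0 < n)%N.

Lemma exists_enorm (s : R) : 0 <= s -> exists b : 'rV[R[i]]_n, enorm b = s.
Proof.
move=> s0; pose b : 'rV[R[i]]_n := const_mx 1.
have b0 : b != 0.
  apply/eqP => /rowP/(_ (Ordinal n_gt0)); rewrite !mxE; apply/eqP; exact: oner_neq0.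
exists ((s / enorm b)%:C%C *: b); rewrite enormZ cabs_real ger0_norm ?divr_ge0 ?enorm_ge0//.
by rewrite divfK// enorm_eq0.
Qed.

(** In positive dimension no point is isolated; the bounds near a pole are stated off the pole and
    need such points as witnesses. *)
Lemma punctured_ball_neq0 c w (r : R) : A c -> cdom c w -> 0 < r ->
  exists2 z, chart_oball c (cmap c w) r z & z != w.
Proof.
move=> cA cw r0; have [e e0 ce] := chart_ball mA cA cw; have hc := atlas_chart mA cA.
pose s := Num.min e (r / 2); have s0 : 0 < s by rewrite lt_min e0 divr_gt0.
have se : s <= e by rewrite ge_min lexx.
have sr : s < r by rewrite gt_min; apply/orP; right; lra.
have [b bs] := exists_enorm (ltW s0).
have E : enorm (cmap c w + b - cmap c w) = s by rewrite addrAC subrr add0r.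
have cb : crange c (cmap c w + b) by apply: ce; rewrite E.
exists (cinv c (cmap c w + b)); first by split; [exact: cdom_cinv|rewrite crangeK// E].
apply/eqP => /(congr1 (cmap c)); rewrite (crangeK hc cb) => h.
have b0 : b = 0 by rewrite -[b](addKr (cmap c w)) h addNr.
by move: s0; rewrite -bs b0 enorm0 ltxx.
Qed.

Lemma open_neq (w : M) : open [set z | z != w].
Proof.
have [hM _ _] := mA.
have -> : [set z | z != w] = ~` [set w].
  by apply/seteqP; split => z /=; [move/eqP|move=> h; apply/eqP].
by apply: closed_openC; apply: accessible_closed_set1; exact: hausdorff_accessible.
Qed.

Lemma chart_ball_sub c w (U : set M) : A c -> cdom c w -> open U -> U w ->
  exists2 r : R, 0 < r & forall z, chart_oball c (cmap c w) r z -> U z.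
Proof.
move=> cA cw oU Uw; have hc := atlas_chart mA cA.
have : nbhs (cinv c (cmap c w)) U by rewrite cdomK//; exact: (open_nbhs_nbhs (conj oU Uw)).
move=> /(continuous_cinv hc (crange_cmap cw))/nbhs_enormP[r r0 H].
exists r => // z [cz zr]; have := H _ zr; by rewrite /= cdomK.
Qed.

Local Open Scope ereal_scope.

(** [E] will be a set of full measure, of which only density matters: lower semicontinuity of
    [- green] spreads an upper bound from [E], and the contradiction appears at a single point of
    [E] close to [w]. *)
Lemma green_inj c (w w' : M) (K t : R) (E : set M) : A c -> cdom c w -> w != w' ->
  (forall z, cdom c z -> z != w -> (ln (enorm (cmap c z - cmap c w)) + K)%:E <= green A z w) ->
  (forall O, open O -> O !=set0 -> O `&` E !=set0) -> (0 < t)%R ->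
  (forall z, E z -> green A z w' = t%:E * green A z w) -> False.
Proof.
move=> cA cw ww' gK Ed t0 gE; have hc := atlas_chart mA cA.
set p0 := cmap c w in gK *.
have [r [r0 cr rw']] : exists r, [/\ (0 < r)%R, (forall q, (enorm (q - p0) <= r)%R -> crange c q) &
    forall z, chart_oball c p0 r z -> z != w'].
  have [r r0 cr] := chart_ball mA cA cw.
  have [s s0 sw'] := chart_ball_sub cA cw (open_neq w') ww'.
  exists (Num.min r s); split; first by rewrite lt_min r0.
  - by move=> q; rewrite le_min => /andP[qr _]; exact: cr.
  - by move=> z [cz]; rewrite lt_min => /andP[_ zs]; exact: sw'.
have oE z : cdom c z -> z != w -> (0 < enorm (cmap c z - p0))%R.
  by move=> cz zw; rewrite enorm_gt0 subr_eq0; apply: contra_neq zw; exact: (cmap_inj mA).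
have gE' z : E z -> - green A z w' = t%:E * (- green A z w) by move=> Ez; rewrite gE// muleN.
(* By semicontinuity a strict violation at [z] would persist on an open set, hence occur at a point
   of [E], where proportionality and the lower bound on [green] exclude it. *)
have up z : cdom c z -> z != w -> - green A z w' <= (t * (- ln (enorm (cmap c z - p0)) - K))%:E.
  move=> cz zw; rewrite leNgt; apply/negP => /ereal_between[q /andP[]].
  rewrite lte_fin => tq qg.
  have [_ /(_ z q qg) gq _] := superh_green mA w'.
  have zw0 := oE z cz zw.
  have zq : (expR (- (q / t) - K) < enorm (cmap c z - p0))%R.
    rewrite -[ltRHS]lnK ?posrE// ltr_expR ltrBlDr ltrNl ltr_pdivlMr//; move: tq; lra.
  have H1 := near_dist_gt mA cA cz zq.
  have H2 := open_nbhs_nbhs (conj (open_neq w) zw).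
  have : nbhs z [set y | q%:E < - green A y w' /\
     ((cdom c y /\ (expR (- (q / t) - K) < enorm (cmap c y - p0))%R) /\ y != w)].
    exact: filterI gq (filterI H1 H2).
  rewrite nbhsE => -[B [oB Bz] BH].
  have [y [/BH + Ey]] := Ed B oB (ex_intro _ z Bz); move=> [qy [[cy yE] yw]].
  move: qy; rewrite (gE' y Ey) ltNge => /negP; apply.
  apply: (@le_trans _ _ (t%:E * - (ln (enorm (cmap c y - p0)) + K)%:E)).
    by rewrite lee_wpmul2l ?lee_fin ?(ltW t0)// leeN2; exact: gK.
  rewrite -EFinN -EFinM lee_fin mulrC -ler_pdivlMr//.
  have : (- (q / t) - K < ln (enorm (cmap c y - p0)))%R.
    by rewrite -[ltLHS]expRK ltr_ln ?posrE ?expR_gt0//; exact: oE.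
  lra.
(* By [up], [- green z w'] is at most [K1] just outside the ball of radius [r / 4], so truncation at
   [K1] inside the ball glues; as the ball avoids [w'], the pole there is untouched. *)
pose K1 := Num.max 0%R (t * (- ln (r / 4) - K))%R.
have K10 : (0 <= K1)%R by rewrite le_max lexx.
have K1E : (t * (- ln (r / 4) - K) <= K1)%R by rewrite le_max lexx orbT.
clearbody K1.
have cB : closed (chart_cball c p0 (r / 4)).
  by apply: (closed_chart_cball mA cA) => q qr; apply: cr; lra.
pose v z := if z \in chart_cball c p0 (r / 4) then mine (- green A z w') K1%:E else - green A z w'.
have sv : superh A v.
  apply: (@superh_glue _ _ _ _ mA (chart_oball c p0 (r / 2))) => //.
  - exact: (open_chart_oball mA).
  - by move=> z [cz zr]; split => //; lra.
  - apply: superh_min; [exact: (atlas_chart mA)|exact: (superh_green mA)|].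
    exact: superh_cst K10.
  - exact: (superh_green mA).
  - move=> z [cz zr] nz; have {nz}rz : (r / 4 < enorm (cmap c z - p0))%R.
      by rewrite ltNge; apply/negP => h; apply: nz.
    apply/min_idPl.
    have zw : z != w by apply/eqP => zw; rewrite zw /p0 subrr enorm0 in rz; lra.
    apply: le_trans (up z cz zw) _; rewrite lee_fin (le_trans _ K1E)// ler_pM2l//.
    by rewrite lerD2r lerN2 ler_ln ?posrE ?divr_gt0//; [exact: ltW|lra].
have pv : log_pole A (fun z => - v z) w'.
  have [_] := neg_psh_green mA w'; apply: near_log_pole.
  have nw' : (~` chart_cball c p0 (r / 4)) w'.
    move=> [cw' w'r]; have := rw' w'; rewrite eqxx => h; apply/negP: isT; apply: h; split => //; lra.
  apply: filterS (open_nbhs_nbhs (conj (closed_openC cB) nw')) => z nz.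
  by rewrite /v memNset// oppeK.
have gK1 z : chart_cball c p0 (r / 4) z -> - green A z w' <= K1%:E.
  move=> zr; apply: le_trans (green_max z sv pv) _.
  by rewrite /v mem_set// ge_min lexx orbT.
(* At distance less than [tau] from [w] the bound of [green_le], multiplied by [t], makes
   [- t * green y w] at least [K1 + 1]. *)
pose tau := Num.min (r / 4)%R (r * expR (- ((K1 + 1) / t)))%R.
have tau0 : (0 < tau)%R by rewrite lt_min divr_gt0// mulr_gt0// expR_gt0.
have taur : (tau <= r / 4)%R by rewrite ge_min lexx.
have tauE : (tau <= r * expR (- ((K1 + 1) / t)))%R by rewrite ge_min lexx orbT.
have [z0 z0tau z0w] := punctured_ball_neq0 cA cw tau0.
have [|y [[[cy ytau] yw] Ey]] := Ed (chart_oball c p0 tau `&` [set z | z != w]) _ (ex_intro _ z0 (conj z0tau z0w)).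
  by apply: openI; [exact: (open_chart_oball mA)|exact: open_neq].
have y0 := oE y cy yw.
have : - green A y w' <= K1%:E by apply: gK1; split => //; lra.
rewrite gE'// leNgt => /negP; apply.
apply: (@lt_le_trans _ _ (t%:E * - (ln (enorm (cmap c y - p0) / r))%:E)).
  rewrite -EFinN -EFinM lte_fin mulrC -ltr_pdivrMr//.
  have : (ln (enorm (cmap c y - p0) / r) <= - ((K1 + 1) / t))%R.
    rewrite -[leRHS]expRK ler_ln ?posrE ?expR_gt0 ?divr_gt0// ler_pdivrMr// mulrC.
    by rewrite (le_trans (ltW ytau)).
  have : (K1 / t < (K1 + 1) / t)%R by rewrite ltr_pM2r ?invr_gt0// ltrDl.
  lra.
rewrite lee_wpmul2l ?lee_fin ?(ltW t0)// leeN2.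
by apply: (green_le mA cA cw r0 cr cy); rewrite y0/=; lra.
Qed.

End Separation.

(** * Volume estimates *)

Section Box.
Context {R : realType}.
Local Notation mR := (measurableTypeR R).
Local Open Scope ereal_scope.

(** The integral of a nonnegative function is a supremum over simple functions below it, so
    monotonicity needs no measurability. This allows the density of [V] in a chart to be compared
    with constants directly. *)
Lemma le_integral_nonmeasurable d (T : measurableType d) (mu : {measure set T -> \bar R})
    (D : set T) (f g : T -> \bar R) : (forall x, D x -> 0 <= f x <= g x) ->
  \int[mu]_(x in D) f x <= \int[mu]_(x in D) g x.
Proof.
move=> fg; rewrite !ge0_integralE; first last.
- by move=> x /fg /andP[].
- by move=> x /fg /andP[f0 ?]; exact: le_trans f0 _.
apply: ge_ereal_sup => _ [h /= hf <-]; apply: ereal_sup_ubound; exists h => // x.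
by apply: le_trans (hf x) _; rewrite /patch; case: ifPn => // /set_mem /fg /andP[].
Qed.

Definition box m (s : m.-tuple R) (r : R) : set (m.-tuple mR) :=
  [set t | forall i, (`|tnth t i - tnth s i| < r)%R].

Lemma measurable_box m (s : m.-tuple R) r : measurable (box s r).
Proof.
have -> : box s r = \bigcap_(i in [set: 'I_m])
    ((tnth (T := mR))^~ i @^-1` `](tnth s i - r)%R, (tnth s i + r)%R[%classic).
  apply/seteqP; split => [t ts i _ /=|t ts i].
    by rewrite in_itv/= -ltr_distlC distrC; exact: ts.
  by have := ts i I; rewrite /= in_itv/= -ltr_distlC distrC.
apply: fin_bigcap_measurable => // i _; rewrite -[X in measurable X]setTI.
by apply: measurable_tnth => //; exact: measurable_itv.
Qed.

Lemma leb_box m (s : m.-tuple R) (r : R) : (0 < r)%R ->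
  leb_tuple R m (box s r) = ((2 * r) ^+ m)%:E.
Proof.
move=> r0; elim: m s => [|m IH] s.
  rewrite /= diracE mem_set ?expr0//.
  by move=> i; case: i.
rewrite /= /leb_cons /pushforward.
pose I := `](thead s - r)%R, (thead s + r)%R[%classic.
pose s' : m.-tuple R := [tuple of behead s].
rewrite (_ : _ @^-1` _ = I `*` box s' r); last first.
  apply/seteqP; split => [[x t] /= xt|[x t] [/= xI tb] i].
    split.
      have := xt ord0; rewrite /= tnth0 -/(thead s) => xs.
      by rewrite /I/= in_itv/= -ltr_distlC distrC.
    move=> i; have := xt (lift ord0 i); rewrite tnthS.
    by rewrite (tuple_eta s) tnthS.
  case: (unliftP ord0 i) => [j|] ->.
    by have := tb j; rewrite tnthS (tuple_eta s) tnthS.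
  by move: xI; rewrite /I/= in_itv/= -ltr_distlC distrC tnth0.
rewrite product_measure1E; [|exact: measurable_itv|exact: measurable_box].
have I2r : lebesgue_measure I = (2 * r)%:E.
  rewrite /I lebesgue_measure_itv/= lte_fin ifT; last lra.
  by rewrite -EFinB; congr (_%:E); ring.
by rewrite [X in X * _]I2r IH -EFinM exprS.
Qed.

End Box.

Section VolumeForm.
Context {R : realType} {n : nat} {M : ptopologicalType}.
Variable A : set (chart R n M).
Variable V : {measure set (borel M) -> \bar R}.
Hypothesis mA : complex_manifold A.
Hypothesis vV : volume_form A V.
Hypothesis n_gt0 : (0 < n)%N.

Lemma open_measurable_borel (U : set M) : open U -> measurable (U : set (borel M)).
Proof. by move=> oU; apply: sub_sigma_algebra. Qed.

(** Cubes in the real coordinates replace balls, since their Lebesgue measure is explicit. *)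
Definition cube (p : 'rV[R[i]]_n) (r : R) : set 'rV[R[i]]_n :=
  [set q | forall i, `|complex.Re (q ord0 i) - complex.Re (p ord0 i)| < r /\
                     `|complex.Im (q ord0 i) - complex.Im (p ord0 i)| < r].

Definition center (p : 'rV[R[i]]_n) : (n + n).-tuple R :=
  [tuple of [tuple complex.Re (p ord0 i) | i < n] ++ [tuple complex.Im (p ord0 i) | i < n]].

Lemma preimage_cube p r : of_reals @^-1` cube p r = box (center p) r.
Proof.
apply/seteqP; split=> [t tp i|t tp i].
  rewrite /center; case: (splitP i) => j ij.
    have -> : i = lshift n j by exact: val_inj.
    by rewrite tnth_lshift tnth_mktuple; have [+ _] := tp j; rewrite /of_reals mxE.
  have -> : i = rshift n j by exact: val_inj.
  by rewrite tnth_rshift tnth_mktuple; have [_ +] := tp j; rewrite /of_reals mxE.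
rewrite /of_reals mxE/=; split.
  by have := tp (lshift n i); rewrite tnth_lshift tnth_mktuple.
by have := tp (rshift n i); rewrite tnth_rshift tnth_mktuple.
Qed.

Lemma sub_ball_cube p q r : enorm (q - p) < r -> cube p r q.
Proof.
move=> qr i; have := cabs_le_enorm (q - p) i; rewrite !mxE => qp.
have := normr_Re_le (q ord0 i - p ord0 i); have := normr_Im_le (q ord0 i - p ord0 i).
rewrite !raddfB /= => h1 h2; split.
  by rewrite (le_lt_trans h2)// (le_lt_trans qp).
by rewrite (le_lt_trans h1)// (le_lt_trans qp).
Qed.

(** The sharp factor is the square root of [2 * n]; [2 * n] itself is large enough. *)
Lemma sub_cube_ball p q r : 0 < r -> cube p r q -> enorm (q - p) < (2 * n)%:R * r.
Proof.
move=> r0 qr; have rn : 0 < (2 * n)%:R * r by rewrite mulr_gt0// ltr0n muln_gt0.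
rewrite -(@ltr_pXn2r _ 2)// ?nnegrE ?enorm_ge0 ?(ltW rn)// sqr_enorm.
apply: (@lt_le_trans _ _ (\sum_(i < n) (r ^+ 2 + r ^+ 2))).
  apply: ltr_sum => [|i _]; first by apply/hasP; exists (Ordinal n_gt0); rewrite ?mem_index_enum.
  rewrite sqr_cabs !mxE !raddfB/=; have [h1 h2] := qr i.
  by rewrite ltrD// -[ltLHS]real_normK ?num_real// ltr_pXn2r ?nnegrE// ltW.
rewrite sumr_const card_ord -mulr2n -mulrnA -[leLHS]mulr_natl exprMn ler_wpM2r ?sqr_ge0//.
by rewrite -natrX ler_nat (@leq_trans ((2 * n) ^ 1))// leq_pexp2l// muln_gt0.
Qed.

Lemma open_cube p r : open (cube p r).
Proof.
rewrite openE => q qr.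
suff H j : \forall y \near q, `|complex.Re ((y : 'rV[R[i]]_n) ord0 j) - complex.Re (p ord0 j)| < r /\
    `|complex.Im ((y : 'rV[R[i]]_n) ord0 j) - complex.Im (p ord0 j)| < r.
  exact: (@filter_forall _ _ _ (nbhs q) _ H).
have [h1 h2] := qr j.
set d1 := `|_| in h1; set d2 := `|_| in h2.
apply/nbhs_enormP; exists (Num.min (r - d1) (r - d2))%R; first by rewrite lt_min !subr_gt0 h1.
move=> y; rewrite lt_min => /andP[y1 y2].
have yq := cabs_le_enorm (y - q) j; rewrite !mxE in yq.
have := normr_Re_le (y ord0 j - q ord0 j); have := normr_Im_le (y ord0 j - q ord0 j).
rewrite !raddfB /= => k2 k1; split.
  apply: le_lt_trans (ler_distD (complex.Re (q ord0 j)) _ _) _.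
  by rewrite -/d1 -ltrBrDr (le_lt_trans k1)// (le_lt_trans yq).
apply: le_lt_trans (ler_distD (complex.Im (q ord0 j)) _ _) _.
by rewrite -/d2 -ltrBrDr (le_lt_trans k2)// (le_lt_trans yq).
Qed.

Local Open Scope ereal_scope.

Definition chart_cube (c : chart R n M) p r : set M := [set z | cdom c z /\ cube p r (cmap c z)].

Lemma open_chart_cube c p r : A c -> open (chart_cube c p r).
Proof.
move=> cA; rewrite openE => z [cz zr].
have H := open_nbhs_nbhs (conj (@open_cube p r) zr).
exact: filterI (near_cdom mA cA cz) (continuous_cmap (atlas_chart mA cA) cz H).
Qed.

(** Near [p0] the continuous positive density lies between half and twice its value at [p0]. *)
Lemma volume_cube c p0 : A c -> crange c p0 -> exists a b e : R, [/\ (0 < a)%R, (0 < b)%R, (0 < e)%R &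
  forall p r, (enorm (p - p0) < e)%R -> (0 < r < e)%R ->
    (a * (2 * r) ^+ (n + n))%:E <= V (chart_cube c p r) <= (b * (2 * r) ^+ (n + n))%:E].
Proof.
move=> cA cp0; have hc := atlas_chart mA cA; have [_ oR _ _ _] := hc.
have [f [cf f0 Vf]] := vV cA.
have fp0 := f0 _ cp0.
have : \forall q \near p0, crange c q /\ (f p0 / 2 < f q < 2 * f p0)%R.
  have H1 := open_nbhs_nbhs (conj oR cp0).
  have cfp : {for p0, continuous f}.
    by move: cf; rewrite continuous_open_subspace// => /(_ p0); apply; rewrite inE.
  have H2 : \forall q \near p0, (f p0 / 2 < f q)%R.
    by apply: (cvgr_gt (f p0) cfp); lra.
  have H3 : \forall q \near p0, (f q < 2 * f p0)%R.
    by apply: (cvgr_lt (f p0) cfp); lra.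
  by apply: filterS (filterI H1 (filterI H2 H3)) => q /= [cq [-> ->]].
move=> /nbhs_enormP[d d0 dP].
pose N : R := (2 * n)%:R.
have N0 : (0 <= N)%R by exact: ler0n.
(* A cube of half-side less than [e] lies within [N * e] of its centre, which is within [e] of [p0];
   and [N * e + e = d]. *)
pose e := (d / (N + 1))%R.
have n0 : (0 < N + 1)%R by rewrite ltr_wpDl.
have e0 : (0 < e)%R by rewrite divr_gt0.
exists (f p0 / 2)%R, (2 * f p0)%R, e; split => //; [by rewrite divr_gt0|by rewrite mulr_gt0|].
move=> p r pe /andP[r0 re].
have sub q : cube p r q -> crange c q /\ (f p0 / 2 < f q < 2 * f p0)%R.
  move=> /(sub_cube_ball r0) qr; apply: dP.
  apply: le_lt_trans (enorm_triangle q p p0) _.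
  have -> : (d = N * e + e)%R by rewrite /e; field; rewrite gt_eqF.
  rewrite ltrD// (lt_le_trans qr)// ler_wpM2l// ltW//.
rewrite Vf; last 2 first.
- by apply: open_measurable_borel; exact: open_chart_cube.
- by move=> z [].
have -> : cmap c @` chart_cube c p r = cube p r.
  apply/seteqP; split => [_ [z [cz zr] <-]//|q qr].
  have [cq _] := sub q qr; exists (cinv c q); last exact: crangeK.
  by split; [exact: cdom_cinv|rewrite crangeK].
rewrite preimage_cube.
have mB := measurable_box (center p) r.
have lB := leb_box (center p) r0.
apply/andP; split.
  rewrite EFinM -lB -integral_cst//; apply: le_integral_nonmeasurable => t.
  rewrite -preimage_cube => /sub[_ /andP[h _]]; rewrite !lee_fin ltW//=; last by rewrite divr_gt0.
  exact: ltW.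
rewrite EFinM -lB -integral_cst//; apply: le_integral_nonmeasurable => t.
rewrite -preimage_cube => /sub[cq /andP[_ h]]; rewrite !lee_fin ltW ?f0//=.
exact: ltW.
Qed.

End VolumeForm.

Section VolumeEstimates.
Context {R : realType} {n : nat} {M : ptopologicalType}.
Variable A : set (chart R n M).
Variable V : {measure set (borel M) -> \bar R}.
Hypothesis mA : complex_manifold A.
Hypothesis vV : volume_form A V.
Hypothesis n_gt0 : (0 < n)%N.
Local Open Scope ereal_scope.

Lemma lsc_measurable_borel (f : M -> \bar R) : (forall z, lsc_at f z) ->
  measurable_fun [set: borel M] f.
Proof.
move=> lf; apply: (measurability _ (ErealGenOInfty.measurableE R)).
move=> /= _ [_ [a ->]] <-; apply: measurableI => //; apply: open_measurable_borel.
by rewrite preimage_itvoy; apply: (lower_semicontinuousP _).1; exact/lower_semicontinuous_at.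
Qed.

Lemma volume_open_gt0 (U : set M) : open U -> U !=set0 -> 0 < V U.
Proof.
move=> oU [w Uw]; have [c cA cw] := chart_at mA w.
have [r r0 rU] := chart_ball_sub mA cA cw oU Uw.
have [a [b [e [a0 _ e0 H]]]] := volume_cube mA vV n_gt0 cA (crange_cmap cw).
have n2 : (0 < (2 * n)%:R :> R)%R by rewrite ltr0n muln_gt0.
pose s := Num.min (e / 2)%R (r / (2 * n)%:R)%R.
have s0 : (0 < s)%R by rewrite lt_min !divr_gt0.
have se : (s < e)%R by rewrite gt_min; apply/orP; left; lra.
have sr : ((2 * n)%:R * s <= r)%R.
  by rewrite mulrC -ler_pdivlMr// ge_min lexx orbT.
have /andP[h _] : (a * (2 * s) ^+ (n + n))%:E <= V (chart_cube c (cmap c w) s) <= (b * (2 * s) ^+ (n + n))%:E.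
  by apply: H; [rewrite subrr enorm0|rewrite s0].
apply: (@lt_le_trans _ _ (V (chart_cube c (cmap c w) s))).
  by apply: lt_le_trans h; rewrite lte_fin mulr_gt0// exprn_gt0// mulr_gt0.
apply: le_measure; rewrite ?inE.
- by apply: open_measurable_borel; exact: (open_chart_cube mA).
- exact: open_measurable_borel.
- move=> z [cz zs]; apply: rU; split => //.
  exact: lt_le_trans (sub_cube_ball n_gt0 s0 zs) sr.
Qed.

(** A bound linear in [s] replaces the true order [s^(2n)] and is enough for summing over
    geometrically decreasing radii. It follows from [(2 s)^(2n) <= 2 s], whence the restriction
    [s < 1/2]. *)
Lemma volume_ball_le c p0 : A c -> crange c p0 -> exists C e : R, [/\ (0 < C)%R, (0 < e)%R &
  forall p s, (enorm (p - p0) < e)%R -> (0 < s < e)%R ->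
    V (chart_oball c p s) <= (C * s)%:E].
Proof.
move=> cA cp0; have [a [b [e [_ b0 e0 H]]]] := volume_cube mA vV n_gt0 cA cp0.
exists (2 * b)%R, (Num.min e 2^-1)%R; split; [by rewrite mulr_gt0|by rewrite lt_min e0/= invr_gt0 ltr0n|].
move=> p s; rewrite lt_min => /andP[pe _]; rewrite lt_min => /and3P[s0 se s2].
apply: (@le_trans _ _ (V (chart_cube c p s))).
  apply: le_measure; rewrite ?inE.
  - by apply: open_measurable_borel; exact: (open_chart_oball mA).
  - by apply: open_measurable_borel; exact: (open_chart_cube mA).
  - by move=> z [cz zs]; split => //; exact: sub_ball_cube.
have /andP[_ h] := H p s pe (introT andP (conj s0 se)); apply: le_trans h _.
rewrite lee_fin -mulrA [leRHS]mulrCA ler_pM2l//.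
rewrite -[leRHS]expr1 ler_wiXn2l// ?addn_gt0 ?n_gt0//; first by rewrite mulr_ge0// ltW.
by rewrite -ler_pdivlMl// mulr1 ltW.
Qed.

Lemma measurable_green w : measurable_fun [set: borel M] (fun z => - green A z w).
Proof. by apply: lsc_measurable_borel; have [_ + _] := superh_green mA w. Qed.

(* Layer-cake bound: the set where [- green z w > k] lies in the ball of radius
   [expR (- k - K)] about [w]. *)
Lemma green_uniform_integrable c (p0 : 'rV[R[i]]_n) (K r1 : R) : A c -> crange c p0 -> (0 < r1)%R ->
  (forall w z, cdom c w -> (enorm (cmap c w - p0) < r1)%R -> cdom c z -> z != w ->
    (ln (enorm (cmap c z - cmap c w)) + K)%:E <= green A z w) ->
  forall eps : R, (0 < eps)%R -> exists2 rho : R, (0 < rho)%R &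
    forall w, chart_oball c p0 rho w ->
      \int[V]_(z in (chart_oball c p0 rho : set (borel M))) (- green A z w) <= eps%:E.
Proof.
move=> cA cp0 r10 gK eps eps0.
have [C [e [C0 e0 HV]]] := volume_ball_le cA cp0.
(* The superlevel sets will lie in balls of radius at most [d / 2^k], whose volumes add up to at
   most [2 * C * d <= eps / 2]. *)
pose d := Num.min (e / 2)%R (eps / (4 * C))%R.
have d0 : (0 < d)%R by rewrite lt_min !divr_gt0// mulr_gt0.
have de : (d < e)%R by rewrite gt_min; apply/orP; left; lra.
have dC : (C * d <= eps / 4)%R.
  rewrite -ler_pdivlMl// (le_trans (y := eps / (4 * C)))%R ?ge_min ?lexx ?orbT//.
  by rewrite le_eqVlt; apply/orP; left; apply/eqP; field; rewrite gt_eqF.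
have [N HN] : exists N : nat, (- K - ln d <= N%:R)%R.
  exists (Num.bound `|- K - ln d|%R); apply: ltW; apply: le_lt_trans (ler_norm _) _.
  by apply: archi_boundP.
pose rk (k : nat) := expR (- (N%:R + k%:R) - K).
have rk0 k : (0 < rk k)%R by exact: expR_gt0.
have rkd k : (rk k <= d / 2 ^+ k)%R.
  have -> : rk k = (expR (- N%:R - K) * expR (- k%:R))%R by rewrite -expRD /rk; congr expR; ring.
  apply: ler_pM; rewrite ?expR_ge0//.
    by rewrite -[leRHS]lnK ?posrE// ler_expR; lra.
  rewrite expRN lef_pV2 ?posrE ?expR_gt0 ?exprn_gt0// -[k%:R]mul1r expRM_natr.
  by rewrite lerXn2r ?nnegrE ?expR_ge0// (le_trans _ (expR_ge1Dx 1)).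
(* The last bound gives [N * V B <= eps / 2], which takes care of the part of [- green] below the
   level [N]. *)
pose rho := Num.min (Num.min r1 (e / 2)%R) (eps / (2 * C * N.+1%:R))%R.
have rho0 : (0 < rho)%R by rewrite !lt_min r10 !divr_gt0// !mulr_gt0.
have rhor1 : (rho <= r1)%R by rewrite !ge_min lexx.
have rhoe : (rho < e)%R by rewrite !gt_min; apply/orP; left; apply/orP; right; lra.
have rhoN : (N%:R * (C * rho) <= eps / 2)%R.
  apply: (@le_trans _ _ (N.+1%:R * (C * rho)))%R.
    by rewrite ler_wpM2r ?ler_nat// mulr_ge0// ltW.
  apply: (@le_trans _ _ (N.+1%:R * (C * (eps / (2 * C * N.+1%:R)))))%R.
    by rewrite !ler_pM2l// /rho ge_min lexx orbT.
  rewrite le_eqVlt; apply/orP; left; apply/eqP.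
  have : (0 < N.+1%:R :> R)%R by [].
  by move: (N.+1%:R : R) => x x0; field; rewrite !gt_eqF.
exists rho => // w [cw wrho].
set B := chart_oball c p0 rho.
have mB : measurable (B : set (borel M)).
  by apply: open_measurable_borel; exact: (open_chart_oball mA).
pose g z := - green A z w.
have [g0 lg _] := superh_green mA w.
pose U k : set (borel M) := [set z | cdom c z /\ (N%:R + k%:R)%:E < g z].
have mU k : measurable (U k).
  apply: open_measurable_borel; rewrite openE => z [cz zk].
  exact: filterI (near_cdom mA cA cz) (lg z _ zk).
have VU k : V (U k) <= (eps / 2 / (2 ^ k.+1)%:R)%:E.
  apply: (@le_trans _ _ (V (chart_oball c (cmap c w) (rk k)))).
    apply: le_measure; rewrite ?inE//.
      by apply: open_measurable_borel; exact: (open_chart_oball mA).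
    move=> z [cz zk]; split => //.
    have [->|zw] := eqVneq z w; first by rewrite subrr enorm0.
    have zw0 : (0 < enorm (cmap c z - cmap c w))%R.
      by rewrite enorm_gt0 subr_eq0; apply: contra_neq zw; exact: (cmap_inj mA).
    have := gK w z cw (lt_le_trans wrho rhor1) cz zw; rewrite -leeN2 => h.
    have := lt_le_trans zk h; rewrite -EFinN lte_fin => h'.
    by rewrite -[ltLHS]lnK ?posrE// ltr_expR; lra.
  apply: le_trans (HV _ _ (lt_trans wrho rhoe) _) _.
    rewrite rk0/= (le_lt_trans (rkd k))// (le_lt_trans _ de)//.
    by rewrite ler_pdivrMr ?exprn_gt0// ler_peMr ?(ltW d0)// exprn_ege1// ler1n.
  rewrite lee_fin (le_trans (ler_wpM2l (ltW C0) (rkd k)))// mulrA natrX exprS invfM !mulrA.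
  rewrite ler_pM2r ?invr_gt0 ?exprn_gt0//; lra.
have gB z : B z -> g z <= N%:R%:E + \sum_(k <oo) (\1_(U k) z)%:E.
  move=> [cz _].
  have S0 k : 0 <= (\1_(U k) z : R)%:E by rewrite lee_fin.
  (* The layer-cake bound at finite height, by induction: raising the height from [N + m] to
     [N + m + 1] costs one unit, and only when [z] is in [U m]. *)
  have P m : mine (g z) (N%:R + m%:R)%:E <= N%:R%:E + \sum_(0 <= k < m) (\1_(U k) z)%:E.
    elim: m => [|m IH]; first by rewrite big_geq// adde0 addr0 ge_min lexx orbT.
    rewrite big_nat_recr//= addeA.
    have [gm|gm] := leP (g z) (N%:R + m%:R)%:E.
      move: IH; rewrite (min_idPl gm) => IH.
      by rewrite ge_min; apply/orP; left; apply: le_trans IH _; rewrite leeDl.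
    move: IH; rewrite (min_idPr (ltW gm)) => IH.
    rewrite ge_min; apply/orP; right; rewrite indicE mem_set//.
    by rewrite -natr1 addrA EFinD leeD2r.
  have Pm m : mine (g z) (N%:R + m%:R)%:E <= N%:R%:E + \sum_(k <oo) (\1_(U k) z)%:E.
    apply: le_trans (P m) _; rewrite leeD2l//.
    by apply: nneseries_lim_ge => k _ _; exact: S0.
  (* If [S < g z] then [S] is finite, and a height above [S] contradicts [Pm]; this includes
     [g z = +oo]. *)
  set S := _ + _ in Pm *; rewrite leNgt; apply/negP => Sg.
  have S00 : 0 <= S by rewrite adde_ge0// ?lee_fin// nneseries_ge0.
  have Sfin : S \is a fin_num by rewrite ge0_fin_numE// (lt_le_trans Sg)// leey.
  have := Pm (Num.bound `|fine S|%R); rewrite leNgt => /negP; apply.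
  rewrite lt_min Sg/= -[ltLHS](fineK Sfin) lte_fin.
  rewrite ltr_wpDl// (le_lt_trans (ler_norm _))// archi_boundP//.
have mind k : measurable_fun (B : set (borel M)) (fun z => (\1_(U k) z : R)%:E).
  by apply/measurable_EFinP; exact: measurable_indic.
apply: (@le_trans _ _ (\int[V]_(z in (B : set (borel M))) (N%:R%:E + \sum_(k <oo) (\1_(U k) z)%:E))).
  apply: ge0_le_integral.
  - exact: mB.
  - by move=> z _; exact: g0.
  - by apply: measurable_funTS; exact: measurable_green.
  - by apply: emeasurable_funD => //; apply: ge0_emeasurable_sum.
  - exact: gB.
rewrite ge0_integralD; [|exact: mB|by []|by []| |]; last 2 first.
- by move=> z _; exact: nneseries_ge0.
- by apply: ge0_emeasurable_sum.
rewrite integral_cst// integral_nneseries//.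
have -> : eps = (eps / 2 + eps / 2)%R by field.
rewrite EFinD; apply: leeD.
  apply: (@le_trans _ _ (N%:R%:E * (C * rho)%:E)).
    rewrite lee_wpmul2l ?lee_fin//; apply: HV; first by rewrite subrr enorm0.
    by rewrite rho0.
  by rewrite -EFinM lee_fin.
apply: le_trans (epsilon_trick0 xpredT _); last by rewrite divr_ge0// ltW.
apply: lee_nneseries => k // _; first by rewrite integral_ge0// => z _; rewrite lee_fin.
rewrite integral_indic//; apply: le_trans (VU k); apply: le_measure; rewrite ?inE//.
exact: measurableI.
Qed.

End VolumeEstimates.

(** * The space L^1 *)

Section L1Space.
Context d (T : measurableType d) (R : realType).
Variable mu : {measure set T -> \bar R}.
Local Open Scope ereal_scope.

(** An element of [L1] is a class modulo equality a.e. together with a proof of finite norm; its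
    value as a function is a chosen representative, hence equal to [f] only almost everywhere. *)
Lemma exists_L1 (f : T -> R) : mu.-integrable setT (EFin \o f) ->
  exists F : L1 mu, (F : T -> R) = f %[ae mu].
Proof.
move=> /integrableP[/measurable_EFinP mf foo].
have mf' : measurable_fun setT (f : T -> measurableTypeR R) by exact: mf.
pose f' : {mfun T >-> measurableTypeR R} := HB.pack (f : T -> measurableTypeR R)
  (isMeasurableFun.Build _ _ T (measurableTypeR R) f mf').
pose q : {mfun_ mu, T >-> measurableTypeR R} := (\pi_{mfun_ mu, T >-> measurableTypeR R} f')%qT.
have qf : (q : T -> R) = f %[ae mu].
  have : (repr q == f' %[mod {mfun_ mu, T >-> measurableTypeR R}])%qT by rewrite reprK.
  by rewrite eqmodE => /asboolP.
have fq : finite_norm mu 1 (q : T -> R).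
  rewrite /finite_norm Lnorm1; apply: le_lt_trans foo.
  rewrite le_eqVlt; apply/orP; left; apply/eqP; apply: ge0_ae_eq_integral => //.
  - apply: measurableT_comp => //; apply/measurable_EFinP.
    exact: measurable_aeEqMfun.
  - by apply: measurableT_comp => //; apply/measurable_EFinP.
  - by apply: filterS qf => x /= h _; rewrite h.
pose F : LspaceType mu (@lexx _ _ 1) := HB.pack q (isFinLebesgue.Build _ _ _ _ _ (@lexx _ _ 1) q fq).
by exists F.
Qed.

(** The underlying classes coincide because a.e. equality is the quotient relation, and the attached
    proofs coincide by proof irrelevance. *)
Lemma L1_ae_eq (f g : L1 mu) : (f : T -> R) = g %[ae mu] -> f = g.
Proof.
move=> fg.
have E : LebesgueSpace.sort (f : LspaceType mu (@lexx _ _ 1)) =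
         LebesgueSpace.sort (g : LspaceType mu (@lexx _ _ 1)).
  set F := LebesgueSpace.sort _; set G := LebesgueSpace.sort _.
  have : (F == G %[mod {mfun_ mu, T >-> measurableTypeR R}])%qT by apply/ae_eqP.
  by rewrite !reprK => /eqP.
move: f g E {fg} => [f [[cf]]] [g [[cg]]] /= E; rewrite E in cf *.
by rewrite (Prop_irrelevance cf cg).
Qed.

Lemma L1_hausdorff : hausdorff_space (L1 mu).
Proof.
rewrite ball_hausdorff => f g /eqP fg.
have mfg : measurable_fun setT (EFin \o (f \- g)%R).
  by apply/measurable_EFinP; apply: measurable_funB; exact: measurable_L1_fun.
have N0 : 0 < 'N[mu]_1[EFin \o (f \- g)%R].
  rewrite lt_def Lnorm_ge0 andbT; apply/eqP => N0; apply: fg; apply: L1_ae_eq.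
  have := Lnorm_eq0_eq0 mfg lte01 N0; apply: filterS => x /= /(_ I) [] /eqP.
  by rewrite subr_eq0 => /eqP.
have [r /andP[r0 rN]] := ereal_between N0; rewrite lte_fin in r0.
have r20 : (0 < r / 2)%R by rewrite divr_gt0.
exists (PosNum r20, PosNum r20) => /=; apply/eqP; rewrite -subset0 => h [fh /ball_sym hg].
have := ball_triangle fh hg; rewrite -splitr.
by rewrite /ball/= /L1_ball/= ltNge (ltW rN).
Qed.

End L1Space.

(** For an open [B] around [x] the image of the compact set [N] minus [B] is closed, and its
    complement is a neighbourhood of [f x] whose points in the image of [N] are sent back into
    [B]. *)
Lemma compact_homeomorphism (S : ptopologicalType) (T : topologicalType) (f : S -> T) (N : set S) :
  hausdorff_space T -> compact N -> continuous f -> injective f ->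
  is_homeomorphism N (f @` N) f.
Proof.
move=> hT cN cf fi.
have gP y : exists x, (f @` N) y -> f x = y.
  have [[x _ <-]|ny] := pselect ((f @` N) y); first by exists x.
  by exists point => /ny.
have [g gK] := choice gP.
have gf x : N x -> g (f x) = x.
  by move=> Nx; apply: fi; apply: gK; exists x.
split.
- split; [by move=> x Nx; exists x|by move=> x y _ _; exact: fi|by move=> _ [x Nx <-]; exists x].
- exact: continuous_subspaceT.
- exists g; split; first by move=> x /set_mem; exact: gf.
  apply/subspace_continuousP => y [x Nx <-]; rewrite /from_subspace gf// => U xU.
  suff : nbhs (f x) [set z | (f @` N) z -> U (g z)] by [].
  have [B [oB Bx] BU] : exists2 B, open_nbhs x B & B `<=` U.
    by have : nbhs x U := xU; rewrite nbhsE.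
  have cNB : compact (N `&` ~` B) by apply: compact_closedI => //; exact: open_closedC.
  have cl : closed (f @` (N `&` ~` B)).
    apply: compact_closed => //; apply: continuous_compact => //.
    exact: continuous_subspaceT.
  have : nbhs (f x) (~` (f @` (N `&` ~` B))).
    apply: open_nbhs_nbhs; split; first exact: closed_openC.
    by move=> [x' [_ nBx'] /fi xx']; apply: nBx'; rewrite xx'.
  apply: filterS => z nz [x' Nx' zx']; apply: BU; rewrite -zx' gf//.
  by apply: contrapT => nB; apply: nz; exists x'.
Qed.

(** * Norms of Green functions and their continuity in L^1 *)

Section NormalizedGreen.
Context {R : realType} {n : nat} {M : ptopologicalType}.
Variable A : set (chart R n M).
Variable V : {measure set (borel M) -> \bar R}.
Hypothesis n_gt0 : (0 < n)%N.
Hypothesis mA : complex_manifold A.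
Hypothesis gA : loc_unif_pluriGreenian A.
Hypothesis vV : volume_form A V.
Hypothesis nV : norming A V.
Local Open Scope ereal_scope.

(** The hypothesis in the shape that the comparison and the volume estimates use: coordinate balls
    about [w0], with twice the radius inside the range of the chart. *)
Lemma green_local_bound (w0 : M) : exists c (K r : R), [/\ A c, cdom c w0, (0 < r)%R,
  (forall q, (enorm (q - cmap c w0) <= 2 * r)%R -> crange c q) &
  forall w z, cdom c w -> (enorm (cmap c w - cmap c w0) < r)%R -> cdom c z -> z != w ->
    (ln (enorm (cmap c z - cmap c w)) + K)%:E <= green A z w].
Proof.
have [c [cA cw0] [W [K [oW _ Ww0 H]]]] := gA w0.
have [r r0 cr] := chart_ball mA cA cw0.
have [s s0 sW] := chart_ball_sub mA cA cw0 oW Ww0.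
exists c, K, (Num.min (r / 2) s)%R; split => //.
- by rewrite lt_min divr_gt0.
- move=> q qr; apply: cr; apply: le_trans qr _.
  by rewrite mulrC -ler_pdivlMr// ge_min lexx.
- move=> w z cw; rewrite lt_min => /andP[_ ws] cz zw; apply/ltW/H => //.
  by apply: sW.
Qed.

Lemma green_fin_point w : exists z, green A z w != -oo.
Proof.
have [c [K [r [cA cw r0 _ gK]]]] := green_local_bound w.
have [z [cz _] zw] := punctured_ball_neq0 mA n_gt0 cA cw r0.
exists z; rewrite gt_eqF//; apply: lt_le_trans (gK w z cw _ cz zw); first exact: ltNyr.
by rewrite subrr enorm0.
Qed.

Lemma abse_green z w : `|green A z w| = - green A z w.
Proof. by rewrite lee0_abs// (green_le0 mA). Qed.

Lemma green_normE w : green_norm A V w = \int[V]_z (- green A z w).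
Proof. by apply: eq_integral => z _; exact: abse_green. Qed.

Lemma green_norm_fin w : green_norm A V w < +oo.
Proof.
have [nV1 _ _] := nV; apply: nV1; split; last exact: green_fin_point.
by have [] := neg_psh_green mA w.
Qed.

(** The upper bound by [ln (|z - w| / r)] makes [green] strictly negative on a nonempty open set,
    and such sets have positive volume. *)
Lemma green_norm_gt0 w : 0 < green_norm A V w.
Proof.
rewrite lt_def; apply/andP; split; last by apply: integral_ge0 => z _; exact: abse_ge0.
apply/eqP => c0.
have mg : measurable_fun [set: borel M] (fun z => green A z w).
  rewrite (_ : (fun z => _) = (fun z => - - green A z w)); last by apply/funext => z; rewrite oppeK.
  by apply: measurableT_comp => //; exact: measurable_green.
have /(ae_eq_integral_abs V measurableT mg)[N [mN VN0 NP]] := c0.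
have [c cA cw] := chart_at mA w; have [r r0 cr] := chart_ball mA cA cw.
pose B := chart_oball c (cmap c w) r `&` [set z | z != w].
have oB : open B by apply: openI; [exact: (open_chart_oball mA)|exact: (open_neq mA)].
have [z0 z0r z0w] := punctured_ball_neq0 mA n_gt0 cA cw r0.
have : 0 < V B by apply: (volume_open_gt0 mA vV n_gt0 oB); exists z0.
apply/negP; rewrite -leNgt -VN0; apply: le_measure; rewrite ?inE//.
  exact: open_measurable_borel.
move=> z [[cz zr] /= zw]; apply: NP => /= /(_ I) gz.
have zw0 : (0 < enorm (cmap c z - cmap c w))%R.
  by rewrite enorm_gt0 subr_eq0; apply: contra_neq zw; exact: (cmap_inj mA).
have := green_le mA cA cw r0 cr cz; rewrite zw0 (ltW zr) gz lee_fin => /(_ isT).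
by rewrite leNgt ln_lt0// divr_gt0//= ltr_pdivrMr// mul1r.
Qed.

Definition cV w : R := fine (green_norm A V w).

Lemma cVE w : green_norm A V w = (cV w)%:E.
Proof. by rewrite /cV fineK// ge0_fin_numE ?green_norm_fin// ltW// green_norm_gt0. Qed.

Lemma cV_gt0 w : (0 < cV w)%R.
Proof. by rewrite -lte_fin -cVE green_norm_gt0. Qed.

(** [fine] sends [-oo] to 0, so this differs from [green] on a null set only. *)
Definition rgreen w z : R := fine (green A z w).

Lemma measurable_rgreen w : measurable_fun [set: borel M] (rgreen w).
Proof.
apply: (measurableT_comp (fine_measurable measurableT)).
rewrite (_ : (fun z => _) = (fun z => - - green A z w)); last by apply/funext => z; rewrite oppeK.
by apply: measurableT_comp => //; exact: measurable_green.
Qed.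

Lemma ae_green_fin w : \forall z \ae V, (rgreen w z)%:E = green A z w.
Proof.
have ig : V.-integrable [set: borel M] (fun z => - green A z w).
  apply/integrableP; split; first exact: measurable_green.
  under eq_integral do rewrite abseN.
  exact: green_norm_fin.
have := integrable_ae measurableT ig; apply: filterS => z /= /(_ I).
by rewrite fin_numN => h; rewrite /rgreen fineK.
Qed.

Lemma integral_rgreen w : \int[V]_z (`|rgreen w z|)%:E = (cV w)%:E.
Proof.
rewrite -cVE; apply: ge0_ae_eq_integral => //.
- by apply/measurable_EFinP; apply: measurableT_comp => //; exact: measurable_rgreen.
- under eq_fun do rewrite abse_green.
  exact: measurable_green.
- apply: (@filterS _ (almost_everywhere V) _ _ _ _ (ae_green_fin w)) => z /= h _; by rewrite -h.
Qed.

Lemma normr_rgreen_le w z : (`|rgreen w z|)%:E <= - green A z w.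
Proof.
rewrite -abse_green /rgreen; case: (green A z w) => [x| |] //=; exact: leey.
Qed.

(** With [h = - green z w] and [h' = - green z w']: [h - h' <= d h'], and
    [h' - h <= d h <= d (1 + d) h' <= 2 d h']. The two comparisons force infinite values to occur
    together, where both [rgreen] vanish. *)
Lemma rgreen_sub_le w w' z (d : R) : (0 < d <= 1)%R ->
  - green A z w <= (1 + d)%:E * - green A z w' -> - green A z w' <= (1 + d)%:E * - green A z w ->
  (`|rgreen w z - rgreen w' z|)%:E <= (2 * d)%:E * - green A z w'.
Proof.
move=> /andP[d0 d1]; have := green_le0 mA z w; have := green_le0 mA z w'.
have d10 : (0 < 1 + d)%R by lra.
rewrite /rgreen; case: (green A z w) => [x| |] //=; case: (green A z w') => [y| |] //=.
- rewrite -!EFinM !lee_fin => y0 x0 h1 h2; rewrite ler_norml.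
  have : (d * (- x) <= d * ((1 + d) * - y))%R by rewrite ler_pM2l.
  have : (d * (d * - y) <= d * - y)%R by rewrite ler_pM2l// ler_piMl// oppr_ge0.
  move=> k1 k2; apply/andP; split; lra.
- by move=> _ _ _ _; rewrite subrr normr0 gt0_muley ?lte_fin ?leey// mulr_gt0.
Qed.

Lemma green_L1_continuous (w0 : M) (eps : R) : (0 < eps)%R ->
  \forall w \near w0, \int[V]_z (`|rgreen w z - rgreen w0 z|)%:E <= eps%:E.
Proof.
move=> eps0; have [c [K [r [cA cw0 r0 cr gK]]]] := green_local_bound w0.
pose p0 := cmap c w0; have cp0 : crange c p0 by exact: crange_cmap.
have c0 := cV_gt0 w0.
(* One third of [eps] is for the complement of a ball, where the difference is at most
   [2 * d * - green z w0]; the other two are for the integrals of both functions over the ball. *)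
pose d := Num.min 1%R (eps / (6 * cV w0))%R.
have d0 : (0 < d)%R by rewrite lt_min ltr01 divr_gt0// mulr_gt0.
have d1 : (d <= 1)%R by rewrite ge_min lexx.
have dc : (2 * d * cV w0 <= eps / 3)%R.
  apply: (@le_trans _ _ (2 * (eps / (6 * cV w0)) * cV w0))%R.
    by rewrite ler_pM2r// ler_pM2l// ge_min lexx orbT.
  by rewrite le_eqVlt; apply/orP; left; apply/eqP; field; rewrite gt_eqF.
have eps3 : (0 < eps / 3)%R by rewrite divr_gt0.
have [rho rho0 Hrho] := green_uniform_integrable mA vV n_gt0 cA cp0 r0 gK eps3.
have rho20 : (0 < rho / 2)%R by rewrite divr_gt0.
(* The comparison holds off the closed ball of radius [rho / 2], which lies in the open ball of
   radius [rho] of the integrability estimate. *)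
have [s s0 Hs] := green_compare mA cA r0 cr gK d0 rho20.
have w0s : (enorm (cmap c w0 - p0) < Num.min s rho)%R.
  by rewrite subrr enorm0 lt_min s0.
apply: filterS (near_dist_lt mA cA cw0 w0s) => w [cw]; rewrite lt_min => /andP[ws wrho].
have w0b e : (0 < e)%R -> chart_oball c p0 e w0 by move=> e0; split => //; rewrite subrr enorm0.
pose B : set (borel M) := chart_oball c p0 rho.
have mB : measurable B by apply: open_measurable_borel; exact: (open_chart_oball mA).
pose g v z := - green A z v.
have mg v : measurable_fun [set: borel M] (g v) by exact: measurable_green.
have g0 v z : 0 <= g v z by rewrite /g oppe_ge0 (green_le0 mA).
have mgB v : measurable_fun [set: borel M] (g v \_ B).
  by apply/(measurable_restrictT _ mB); exact: measurable_funS (mg v).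
have gB0 v z : 0 <= (g v \_ B) z by rewrite /patch; case: ifP.
apply: (@le_trans _ _ (\int[V]_z ((2 * d)%:E * g w0 z + ((g w \_ B) z + (g w0 \_ B) z)))).
  apply: ge0_le_integral => //.
  - apply/measurable_EFinP; apply: measurableT_comp => //.
    by apply: measurable_funB; exact: measurable_rgreen.
  - apply: emeasurable_funD; first exact: measurable_funeM.
    exact: emeasurable_funD.
  - move=> z _; have [zB|zB] := boolP (z \in B).
      rewrite /patch zB; apply: (@le_trans _ _ (g w z + g w0 z)).
        apply: le_trans (leeD (normr_rgreen_le w z) (normr_rgreen_le w0 z)).
        by rewrite -EFinD lee_fin ler_normB.
      by rewrite leeDr// mule_ge0// lee_fin mulr_ge0// ltW.
    rewrite /patch (negPf zB) !adde0.
    have nz : ~ chart_cball c p0 (rho / 2) z.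
      by move=> [cz zr]; move/negP: zB; rewrite in_setE; apply; split => //; lra.
    apply: rgreen_sub_le; first by rewrite d0.
      by apply: Hs nz => //; exact: w0b.
    by apply: Hs nz => //; exact: w0b.
have p1 (z : borel M) : [set: borel M] z -> 0 <= (2 * d)%:E * g w0 z.
  by move=> _; rewrite mule_ge0// lee_fin mulr_ge0// ltW.
have p2 (z : borel M) : [set: borel M] z -> 0 <= (g w \_ B) z + (g w0 \_ B) z.
  by move=> _; exact: adde_ge0.
have m1 : measurable_fun [set: borel M] (fun z => (2 * d)%:E * g w0 z) by exact: measurable_funeM.
have m2 : measurable_fun [set: borel M] (fun z => (g w \_ B) z + (g w0 \_ B) z).
  exact: emeasurable_funD.
rewrite (ge0_integralD V measurableT p1 m1 p2 m2).
rewrite ge0_integralZl//; last by rewrite lee_fin mulr_ge0// ltW.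
rewrite (ge0_integralD V measurableT (fun z _ => gB0 w z) (mgB w) (fun z _ => gB0 w0 z) (mgB w0)).
have cg : \int[V]_z g w0 z = (cV w0)%:E by rewrite -cVE green_normE.
have IB v : chart_oball c p0 rho v -> \int[V]_z (g v \_ B) z <= (eps / 3)%:E.
  by move=> vB; rewrite -(integral_mkcond B (g v)); exact: Hrho.
have E3 : eps = (eps / 3 + (eps / 3 + eps / 3))%R by field.
rewrite cg -EFinM [in leRHS]E3 2!EFinD; apply: leeD; first by rewrite lee_fin.
by apply: leeD; apply: IB => //; exact: w0b.
Qed.

End NormalizedGreen.

Section L1Distance.
Context d (T : measurableType d) (R : realType).
Variable mu : {measure set T -> \bar R}.
Local Open Scope ereal_scope.
Implicit Types f h : T -> R.

Lemma measurable_norm_EFin f : measurable_fun setT f ->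
  measurable_fun setT (fun z => (`|f z|)%:E).
Proof. by move=> mf; apply/measurable_EFinP; exact: measurableT_comp. Qed.

Lemma integral_norm_triangle f h : measurable_fun setT f -> measurable_fun setT h ->
  \int[mu]_z (`|f z|)%:E <= \int[mu]_z (`|h z|)%:E + \int[mu]_z (`|h z - f z|)%:E.
Proof.
move=> mf mh; have mB : measurable_fun setT (h \- f)%R by exact: measurable_funB.
have p1 z : [set: T] z -> 0 <= (`|h z|)%:E by rewrite lee_fin.
have p2 z : [set: T] z -> 0 <= (`|h z - f z|)%:E by rewrite lee_fin.
rewrite -(ge0_integralD mu measurableT p1 (measurable_norm_EFin mh) p2 (measurable_norm_EFin mB)).
apply: ge0_le_integral => //; first exact: measurable_norm_EFin.
- by apply: emeasurable_funD; exact: measurable_norm_EFin.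
- move=> z _; rewrite -EFinD lee_fin -{1}(subKr (h z) (f z)).
  exact: ler_normB.
Qed.

Lemma dist_L1_norm f h (x y e : R) : measurable_fun setT f -> measurable_fun setT h ->
  \int[mu]_z (`|f z|)%:E = x%:E -> \int[mu]_z (`|h z|)%:E = y%:E ->
  \int[mu]_z (`|h z - f z|)%:E <= e%:E -> (`|x - y| <= e)%R.
Proof.
move=> mf mh fx hy fh; have h1 : (x <= y + e)%R.
  rewrite -lee_fin EFinD -fx -hy.
  exact: le_trans (integral_norm_triangle mf mh) (leeD2l _ fh).
have h2 : (y <= x + e)%R.
  rewrite -lee_fin EFinD -fx -hy.
  apply: le_trans (integral_norm_triangle mh mf) (leeD2l _ _).
  by apply: le_trans fh; under eq_integral do rewrite distrC.
by rewrite ler_distl; apply/andP; split; lra.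
Qed.

(** Write [f / x - h / y] as [(f - h) / x + (1 / x - 1 / y) h]. The second term has norm
    [|x - y| / x], and [|x - y| <= e] by the triangle inequality. *)
Lemma normalized_L1_dist f h (x y e : R) : (0 < x)%R -> (0 < y)%R ->
  measurable_fun setT f -> measurable_fun setT h ->
  \int[mu]_z (`|f z|)%:E = x%:E -> \int[mu]_z (`|h z|)%:E = y%:E ->
  \int[mu]_z (`|h z - f z|)%:E <= e%:E ->
  \int[mu]_z (`|x^-1 * f z - y^-1 * h z|)%:E <= (2 * e / x)%:E.
Proof.
move=> x0 y0 mf mh fx hy fh; have xy := dist_L1_norm mf mh fx hy fh.
have mB : measurable_fun setT (h \- f)%R by exact: measurable_funB.
pose k := `|x^-1 - y^-1|%R; have k0 : (0 <= k)%R by exact: normr_ge0.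
have p1 z : [set: T] z -> 0 <= x^-1%:E * (`|h z - f z|)%:E.
  by move=> _; rewrite mule_ge0// lee_fin invr_ge0 ltW.
have p2 z : [set: T] z -> 0 <= k%:E * (`|h z|)%:E.
  by move=> _; rewrite mule_ge0// lee_fin.
have m1 : measurable_fun setT (fun z => x^-1%:E * (`|h z - f z|)%:E).
  by apply: measurable_funeM; exact: (measurable_norm_EFin mB).
have m2 : measurable_fun setT (fun z => k%:E * (`|h z|)%:E).
  by apply: measurable_funeM; exact: measurable_norm_EFin.
apply: (@le_trans _ _ (\int[mu]_z (x^-1%:E * (`|h z - f z|)%:E + k%:E * (`|h z|)%:E))).
  apply: ge0_le_integral => //.
  - by apply: measurable_norm_EFin; apply: measurable_funB; exact: measurable_funM.
  - exact: emeasurable_funD.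
  - move=> z _; rewrite -!EFinM -EFinD lee_fin.
    have -> : (x^-1 * f z - y^-1 * h z = - (x^-1 * (h z - f z)) + (x^-1 - y^-1) * h z)%R.
      by ring.
    apply: le_trans (ler_normD _ _) _.
    by rewrite normrN !normrM (ger0_norm (x := x^-1)%R)// invr_ge0 ltW.
rewrite (ge0_integralD mu measurableT p1 m1 p2 m2).
rewrite ge0_integralZl//; last 2 first.
- exact: (measurable_norm_EFin mB).
- by rewrite lee_fin invr_ge0 ltW.
rewrite ge0_integralZl//; last exact: measurable_norm_EFin.
rewrite hy; apply: (@le_trans _ _ (x^-1%:E * e%:E + (k * y)%:E)).
  by rewrite leeD2r// lee_wpmul2l// lee_fin invr_ge0 ltW.
have -> : (k * y = `|x - y| / x)%R.
  have -> : (k = `|x - y| / (x * y))%R.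
    rewrite /k (_ : x^-1 - y^-1 = (y - x) / (x * y))%R; last by field; rewrite !gt_eqF.
    by rewrite normrM distrC normfV (gtr0_norm (mulr_gt0 x0 y0)).
  by field; rewrite !gt_eqF.
rewrite -EFinM -EFinD lee_fin [leLHS](_ : _ = (e + `|x - y|) / x)%R; last by ring.
by rewrite ler_pM2r ?invr_gt0// mulr_natl mulr2n lerD2l.
Qed.

End L1Distance.

Lemma eq_of_divL {R : realType} (x y : R) (X Y a b : \bar R) : 0 < x -> 0 < y ->
  X = x%:E -> Y = y%:E -> (X^-1 * a = Y^-1 * b -> b = (y / x)%:E * a)%E.
Proof.
move=> x0 y0 -> ->; rewrite !inver !gt_eqF// => /(congr1 (mule y%:E)).
by rewrite !muleA -!EFinM mulfV ?gt_eqF// mul1e => <-.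
Qed.

(** * The normalized Green map *)

Section Phi.
Context {R : realType} {n : nat} {M : ptopologicalType}.
Variable A : set (chart R n M).
Variable V : {measure set (borel M) -> \bar R}.
Hypothesis n_gt0 : (0 < n)%N.
Hypothesis mA : complex_manifold A.
Hypothesis gA : loc_unif_pluriGreenian A.
Hypothesis vV : volume_form A V.
Hypothesis nV : norming A V.
Local Open Scope ereal_scope.
Let c w := cV A V w.
Let g w := rgreen A w.

Let cgt0 w : (0 < c w)%R.
Proof. exact: (cV_gt0 n_gt0 mA gA vV nV). Qed.

Let Ic w : \int[V]_z (`|g w z|)%:E = (c w)%:E.
Proof. exact: (integral_rgreen n_gt0 mA gA vV nV). Qed.

Let cE w : green_norm A V w = (c w)%:E.
Proof. exact: (cVE n_gt0 mA gA vV nV). Qed.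

Let mg w : measurable_fun [set: borel M] (g w).
Proof. exact: (measurable_rgreen mA). Qed.

Definition hgreen w z : R := ((cV A V w)^-1 * rgreen A w z)%R.

Lemma measurable_hgreen w : measurable_fun [set: borel M] (hgreen w).
Proof. by apply: measurable_funM => //; exact: mg. Qed.

Lemma integrable_hgreen w : V.-integrable [set: borel M] (EFin \o hgreen w).
Proof.
apply/integrableP; split; first by apply/measurable_EFinP; exact: measurable_hgreen.
under eq_integral do rewrite /= normrM EFinM.
rewrite ge0_integralZl//; last by apply: measurable_norm_EFin; exact: mg.
by rewrite Ic -EFinM ltry.
Qed.

Lemma hgreen_L1_continuous (w0 : M) (eps : R) : (0 < eps)%R ->
  \forall w \near w0, \int[V]_z (`|hgreen w0 z - hgreen w z|)%:E < eps%:E.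
Proof.
move=> eps0; have c0 := cgt0 w0.
have e0 : (0 < eps * c w0 / 3)%R by rewrite divr_gt0// mulr_gt0.
apply: filterS (green_L1_continuous n_gt0 mA gA vV nV w0 e0) => w D.
apply: le_lt_trans (normalized_L1_dist c0 (cgt0 w) (mg w0) (mg w) (Ic w0) (Ic w) D) _.
rewrite lte_fin (_ : 2 * (eps * c w0 / 3) / c w0 = 2 / 3 * eps)%R; first lra.
by field; rewrite gt_eqF.
Qed.

Lemma normalized_greenE w z : (rgreen A w z)%:E = green A z w ->
  (hgreen w z)%:E = (green_norm A V w)^-1 * green A z w.
Proof.
by move=> <-; rewrite cE inver gt_eqF ?cgt0//.
Qed.

(** [V] charges every nonempty open set, so a null set contains none; this makes almost everywhere
    equalities usable in [green_inj]. *)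
Lemma ae_dense (P : M -> Prop) : (\forall z \ae V, P z) ->
  forall B : set M, open B -> B !=set0 -> B `&` P !=set0.
Proof.
move=> [N [mN VN NP]] B oB B0; apply: contrapT => nBP.
have : 0 < V B by exact: (volume_open_gt0 mA vV n_gt0 oB B0).
apply/negP; rewrite -leNgt -VN; apply: le_measure; rewrite ?inE//.
  exact: open_measurable_borel.
by move=> z Bz; apply: NP => Pz; apply: nBP; exists z.
Qed.

Lemma normalized_green_inj (Phi : M -> L1 V) : is_normalized_green A Phi -> injective Phi.
Proof.
move=> PhiE w w' ww'; apply: contrapT => /eqP nww'.
have [d [K [r [dA dw r0 _ gK]]]] := green_local_bound mA gA w.
(* If the normalized functions agree, the Green functions are proportional with the ratio of their
   norms as factor. *)
have t0 : (0 < c w' / c w)%R by rewrite divr_gt0.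
have H : \forall z \ae V, green A z w' = (c w' / c w)%:E * green A z w.
  have H1 := PhiE w; have H2 := PhiE w'.
  apply: (@filterS2 _ (almost_everywhere V) _ _ _ _ _ H1 H2) => z /= /(_ I) h1 /(_ I) h2.
  have h3 : (Phi w z)%:E = (Phi w' z)%:E by rewrite ww'.
  exact: (eq_of_divL (cgt0 w) (cgt0 w') (cE w) (cE w') (etrans (esym h1) (etrans h3 h2))).
apply: (green_inj mA n_gt0 dA dw nww' _ (ae_dense H) t0) => //.
by move=> z dz zw; apply: gK; rewrite // subrr enorm0.
Qed.

End Phi.

Unset Implicit Arguments.
Set Strict Implicit.

Theorem lemma6p2 (R : realType) (n : nat) (M : ptopologicalType)
    (A : set (chart R n M)) (V : {measure set (borel M) -> \bar R})
    (dim_gt0 : (0 < n)%N)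
    (manifoldM : complex_manifold A)
    (connectedM : connected [set: M])
    (greenianM : loc_unif_pluriGreenian A)
    (volumeV : volume_form A V)
    (normingV : norming A V) :
  exists Phi : M -> L1 V,
    [/\ is_normalized_green A Phi,
        continuous Phi /\ set_bij [set: M] (range Phi) Phi &
        forall N : set M, compact N -> is_homeomorphism N (Phi @` N) Phi].
Proof.
have [Phi PhiE] := choice (fun w => exists_L1
  (integrable_hgreen dim_gt0 manifoldM greenianM volumeV normingV w)).
have nPhi : is_normalized_green A Phi.
  move=> w; have H1 := PhiE w.
  have H2 := ae_green_fin dim_gt0 manifoldM greenianM normingV w.
  apply: (@filterS2 _ (almost_everywhere V) _ _ _ _ _ H1 H2) => z /= /(_ I) h1 h2 _.
  by rewrite h1; apply: normalized_greenE.
have iPhi := normalized_green_inj dim_gt0 manifoldM greenianM volumeV normingV nPhi.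
have cPhi : continuous Phi.
  move=> w0; apply/cvg_ballP => e e0.
  apply: filterS (hgreen_L1_continuous dim_gt0 manifoldM greenianM volumeV normingV w0 e0) => w.
  (* The norm depends only on classes, so the distance may be computed with the representatives
     [hgreen]. *)
  apply: le_lt_trans; rewrite Lnorm1 le_eqVlt; apply/orP; left; apply/eqP.
  apply: ge0_ae_eq_integral => //.
  - apply: measurableT_comp => //; apply/measurable_EFinP.
    by apply: measurable_funB; exact: measurable_L1_fun.
  - apply/measurable_EFinP; apply: measurableT_comp => //.
    by apply: measurable_funB; exact: measurable_hgreen.
  - have H1 := PhiE w0; have H2 := PhiE w.
    apply: (@filterS2 _ (almost_everywhere V) _ _ _ _ _ H1 H2) => z /= /(_ I) h1 /(_ I) h2 _.
    by rewrite /= h1 h2.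
exists Phi; split => //.
  split => //; split; [by move=> w _; exists w|by move=> x y _ _; exact: iPhi|].
  by move=> _ [w _ <-]; exists w.
by move=> N cN; apply: compact_homeomorphism => //; exact: L1_hausdorff.
Qed.
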